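(* Let $(\mathcal{F}(\Omega),\|\cdot\|,\tau)$ be a semi-Montel Saks space of $\mathbb{K}$-valued functions on a non-empty set $\Omega$ such that $\tau_{\mathrm{p}}\le\tau$, and let $\gamma=\gamma(\|\cdot\|,\tau)$. Let $\mathcal{F}(\Omega)_\gamma'$ denote the dual of $(\mathcal{F}(\Omega),\gamma)$ and $\|\cdot\|_{\mathcal{F}(\Omega)_\gamma'}$ the restriction to it of the dual norm of $(\mathcal{F}(\Omega),\|\cdot\|)'$. Then the following assertions are equivalent. (a) $(\mathcal{F}(\Omega),\gamma)$ has the approximation property. (b) $(\mathcal{F}(\Omega)_\gamma',\|\cdot\|_{\mathcal{F}(\Omega)_\gamma'})$ has the approximation property. (c) $\mathcal{F}(\Omega)\otimes E$ is dense in $(\mathcal{F}(\Omega,E)_\sigma,\gamma^E_{\sigma,\mathrm{s}})$ for every Banach space $E$ over $\mathbb{K}$. (d) $\mathcal{F}(\Omega)\otimes E$ is dense in $(\mathcal{F}(\Omega,E)_\sigma,\gamma^E_{\sigma,\mathrm{s}})$ for every complete locally convex Hausdorff space $E$ over $\mathbb{K}$.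
   Context: $\mathbb{K}\in\{\mathbb{R},\mathbb{C}\}$; for topologies, $\le$ means ''coarser than (or equal to)''. Saks spaces. Let $(X,\|\cdot\|)$ be a normed space and $\tau\le\tau_{\|\cdot\|}$ a locally convex Hausdorff topology on $X$. The mixed topology $\gamma(\|\cdot\|,\tau)$ is the finest linear topology on $X$ that coincides with $\tau$ on $\|\cdot\|$-bounded sets and satisfies $\tau\le\gamma\le\tau_{\|\cdot\|}$; it is locally convex Hausdorff. $(X,\|\cdot\|,\tau)$ is a Saks space if there is a directed system $\Gamma_\tau$ of continuous seminorms generating $\tau$ with $\|x\|=\sup_{q\in\Gamma_\tau}q(x)$ for all $x$. It is semi-Montel if $(X,\gamma)$ is a semi-Montel space (bounded sets are relatively compact). $\tau_{\mathrm{p}}$ is the topology of pointwise convergence on $\mathcal{F}(\Omega)\subset\mathbb{K}^\Omega$. Weak vector-valued functions. For a locally convex Hausdorff space $E$ over $\mathbb{K}$ let $\Gamma_E$ be a directed system of seminorms generating its topology, and for $p\in\Gamma_E$ let $U_p:=\{x\in E: p(x)<1\}$ with polar $U_p^\circ\subset E'$. Set $\mathcal{F}(\Omega,E)_\sigma:=\{f\colon\Omega\to E : e'\circ f\in\mathcal{F}(\Omega)\text{ for all }e'\in E'\}$. The topology $\gamma^E_{\sigma,\mathrm{s}}$ on $\mathcal{F}(\Omega,E)_\sigma$ is generated by the (finite) seminorms $f\mapsto\sup_{e'\in U_p^\circ}\sup_{n\in\mathbb{N}}q_n(e'\circ f)a_n$ for $p\in\Gamma_E$, $(q_n)_{n\in\mathbb{N}}\subset\Gamma_\tau$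 and real non-negative null-sequences $(a_n)_{n\in\mathbb{N}}$. Here $\mathcal{F}(\Omega)\otimes E$ is identified with the subspace of $\mathcal{F}(\Omega,E)_\sigma$ of all finite sums of functions $x\mapsto f(x)e$ with $f\in\mathcal{F}(\Omega)$, $e\in E$. Approximation property (of Schwartz): for locally convex Hausdorff spaces $Y,E$ let $Y'_\kappa$ be $Y'$ with the topology of uniform convergence on absolutely convex compact subsets of $Y$, and let $Y\varepsilon E:=L_e(Y'_\kappa,E)$ be the space of continuous linear maps $Y'_\kappa\to E$ with the topology of uniform convergence on equicontinuous subsets of $Y'$; $Y\otimes E$ is identified with the finite rank operators in $Y\varepsilon E$. $Y$ has the approximation property if and only if $Y\otimes E$ is dense in $Y\varepsilon E$ for all Banach spaces $E$. *)

(* Defs.v *)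
(* The scalar field K is a numFieldType (it is R or R[i] in
   the theorem), so norms and seminorms take their values in K itself; the
   order of R[i] only compares numbers with the same imaginary part, hence
   0 <= x makes x real and a supremum in K of a set of non-negative numbers is
   the usual real one. *)
From HB Require Import structures.
From mathcomp Require Import all_boot all_order all_algebra.
From mathcomp Require Import complex.
From mathcomp Require Import all_classical all_reals all_analysis.

Set Implicit Arguments.
Unset Strict Implicit.
Unset Printing Implicit Defensive.

Import Order.TTheory GRing.Theory Num.Theory.
Import numFieldNormedType.Exports.

Local Open Scope classical_set_scope.
Local Open Scope ring_scope.

Inductive real_or_complex : numFieldType -> Prop :=
| RealScalars (R : realType) : real_or_complex R
| ComplexScalars (R : realType) : real_or_complex R[i].

(* Several topologies live on one carrier, so topologies are first-class here;
   [topologized t] is the carrier of t seen as a topologicalType. *)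
Record topology (T : Type) := Topology {
  opens :> set_system T ;
  opens_setT : opens setT ;
  opens_setI : setI_closed opens ;
  opens_bigcup : forall (I : Type) (f : I -> set T),
    (forall i, opens (f i)) -> opens (\bigcup_i f i) }.

Definition coarser (T : Type) (t1 t2 : topology T) := t1 `<=` t2.

Definition topologized (T : Type) (t : topology T) : Type := T.

HB.instance Definition _ (T : choiceType) (t : topology T) :=
  Choice.on (topologized t).
HB.instance Definition _ (T : choiceType) (t : topology T) :=
  isOpenTopological.Build (topologized t)
    (opens_setT t) (@opens_setI _ t) (@opens_bigcup _ t).
HB.instance Definition _ (K : numDomainType) (X : lmodType K)
  (t : topology X) := GRing.Lmodule.on (topologized t).

Section open_topology.
Variable T : topologicalType.

Let open_bigcup (I : Type) (f : I -> set T) :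
  (forall i, open (f i)) -> open (\bigcup_i f i).
Proof. by move=> fo; apply: bigcup_open => i _; exact: fo. Qed.

Definition open_topology : topology T :=
  Topology (@openT T) (@openI T) open_bigcup.
End open_topology.

Definition init_topology (X : choiceType) (T : topologicalType) (f : X -> T)
  : topology X := open_topology (initial_topology f).

Section seminorms.
Variables (K : numFieldType) (X : lmodType K).
Implicit Types (q : X -> K) (Q : set (X -> K)).

Definition is_seminorm q :=
  [/\ forall x, 0 <= q x,
      forall x y, q (x + y) <= q x + q y &
      forall a x, q (a *: x) = `|a| * q x].

Definition is_norm q := is_seminorm q /\ forall x, q x = 0 -> x = 0.

(* Directed up to constants; this includes the families directed for the
   pointwise order. *)
Definition directed_seminorms Q :=
  [/\ Q !=set0,
      forall q, Q q -> is_seminorm q &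
      forall q1 q2, Q q1 -> Q q2 -> exists q3 C,
        [/\ Q q3, 0 <= C, forall x, q1 x <= C * q3 x &
            forall x, q2 x <= C * q3 x]].

Definition seminorm_open Q : set_system X :=
  [set U | forall x, U x -> exists (Q0 : set (X -> K)) (e : K),
     [/\ finite_set Q0, Q0 `<=` Q, 0 < e &
         [set y | forall q, Q0 q -> q (y - x) < e] `<=` U]].

Let seminorm_openT Q : seminorm_open Q setT.
Proof. by move=> x _; exists set0, 1; split=> //; exact: ltr01. Qed.

Let seminorm_openI Q : setI_closed (seminorm_open Q).
Proof.
move=> A B oA oB x [/oA[Q1 [e1 [f1 s1 p1 h1]]] /oB[Q2 [e2 [f2 s2 p2 h2]]]].
exists (Q1 `|` Q2), (Num.min e1 e2).
have re : e1 >=< e2 by apply: real_comparable; exact: gtr0_real.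
split.
- by rewrite finite_setU.
- by rewrite subUset.
- by rewrite comparable_lt_min ?p1.
- move=> y /= hy; split.
    by apply: h1 => q Qq; have := hy q (or_introl Qq);
      rewrite comparable_lt_min// => /andP[].
  by apply: h2 => q Qq; have := hy q (or_intror Qq);
    rewrite comparable_lt_min// => /andP[].
Qed.

Let seminorm_open_bigcup Q (I : Type) (f : I -> set X) :
  (forall i, seminorm_open Q (f i)) -> seminorm_open Q (\bigcup_i f i).
Proof.
move=> of_ x [i _ /of_[Q0 [e [fQ sQ e0 h]]]].
by exists Q0, e; split=> // y /h fy; exists i.
Qed.

Definition seminorm_topology Q : topology X :=
  Topology (@seminorm_openT Q) (@seminorm_openI Q) (@seminorm_open_bigcup Q).

Definition norm_topology q := seminorm_topology [set q].

Definition norm_bounded q (B : set X) := exists M, forall x, B x -> q x <= M.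

End seminorms.

Section topological_lmodules.
Variables (K : numFieldType) (Y : preTopologicalLmodType K).

Definition linear_topology :=
  continuous (fun z : Y * Y => z.1 + z.2) /\
  continuous (fun z : K^o * Y => z.1 *: z.2).

Definition locally_convex_hausdorff :=
  [/\ linear_topology,
      exists2 B : set_system Y,
        (forall b, b \in B -> convex_set b) & basis B &
      hausdorff_space Y].

Definition vn_bounded (B : set Y) := forall U : set Y, nbhs 0 U ->
  exists2 r : K, 0 < r & B `<=` [set r *: u | u in U].

Definition semi_montel :=
  forall B : set Y, vn_bounded B -> compact (closure B).

(* The uniformity of a tvsType need not be the translation invariant one,
   whence a completeness in terms of neighbourhoods of 0. *)
Definition tvs_cauchy (F : set_system Y) := forall U : set Y, nbhs 0 U ->
  exists2 A, F A & forall x y, A x -> A y -> U (x - y).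

Definition tvs_complete :=
  forall F : set_system Y, ProperFilter F -> tvs_cauchy F ->
    exists l : Y, F --> l.

Definition absolutely_convex (C : set Y) := forall (a b : K) (x y : Y),
  `|a| + `|b| <= 1 -> C x -> C y -> C (a *: x + b *: y).

Definition absolutely_convex_compact : set (set Y) :=
  [set C | absolutely_convex C /\ compact C].

End topological_lmodules.

Section saks_spaces.
Variables (K : numFieldType) (X : lmodType K).
Implicit Types (nrm : X -> K) (tau gamma : topology X).

Definition trace_topology tau (B : set X) : set_system X :=
  [set U `&` B | U in opens tau].

Definition mixed_candidate nrm tau gamma :=
  [/\ linear_topology (topologized gamma),
      forall B, norm_bounded nrm B ->
        trace_topology gamma B = trace_topology tau B,
      coarser tau gamma & coarser gamma (norm_topology nrm)].

Definition is_mixed_topology nrm tau gamma :=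
  mixed_candidate nrm tau gamma /\
  forall gamma', mixed_candidate nrm tau gamma' -> coarser gamma' gamma.

(* Gamma_tau is kept as a parameter, since the topology on the weak
   vector-valued functions refers to it. *)
Record saks_space nrm tau (Gamma_tau : set (X -> K)) : Prop := SaksSpace {
  saks_norm : is_norm nrm ;
  saks_lcs : locally_convex_hausdorff (topologized tau) ;
  saks_coarser : coarser tau (norm_topology nrm) ;
  saks_directed : directed_seminorms Gamma_tau ;
  saks_continuous : forall q, Gamma_tau q ->
    continuous (q : topologized tau -> K^o) ;
  saks_generates : opens tau = opens (seminorm_topology Gamma_tau) ;
  saks_sup : forall x, supremums [set q x | q in Gamma_tau] (nrm x) }.

End saks_spaces.

Section continuous_linear_maps.
Variable K : numFieldType.

Definition continuous_linear_pred (Y : preTopologicalLmodType K)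
    (Z : topologicalLmodType K) : {pred Y -> Z} :=
  fun f => `[< linear f /\ continuous f >].

Record continuous_linear (Y : preTopologicalLmodType K)
    (Z : topologicalLmodType K) := ContinuousLinear {
  cl_fun :> Y -> Z ;
  cl_funP : cl_fun \in @continuous_linear_pred Y Z }.

Section instances.
Variables (Y : preTopologicalLmodType K) (Z : topologicalLmodType K).

HB.instance Definition _ := [isSub for @cl_fun Y Z].
HB.instance Definition _ := [Choice of continuous_linear Y Z by <:].

Lemma continuous_linear_closed : submod_closed (@continuous_linear_pred Y Z).
Proof.
split; first by rewrite unfold_in; apply/asboolP; split;
  [move=> a u v /=; rewrite scaler0 addr0|exact: cst_continuous].
move=> a f g; rewrite !unfold_in => /asboolP[lf cf] /asboolP[lg cg].
apply/asboolP; split => [b u v|].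
  rewrite !fctE lf lg !scalerDr !scalerA mulrC -!addrA.
  by congr (_ + _); rewrite addrCA.
move=> x.
apply: (@continuous_comp _ _ _ (fun x => (a *: f x, g x))
  (fun z : Z * Z => z.1 + z.2)); last exact: add_continuous.
apply: cvg_pair; last exact: cg.
apply: (@continuous_comp Y (K^o * Z)%type Z (fun x => (a, f x))
  (fun z => z.1 *: z.2)); last exact: scale_continuous.
by apply: (@cvg_pair _ _ _ _ (nbhs (a : K^o))); [exact: cvg_cst|exact: cf].
Qed.

HB.instance Definition _ := GRing.isSubmodClosed.Build K (Y -> Z)
  (@continuous_linear_pred Y Z) continuous_linear_closed.
HB.instance Definition _ :=
  [SubChoice_isSubLmodule of continuous_linear Y Z by <:].

End instances.

Definition topdual (Y : preTopologicalLmodType K) := continuous_linear Y K^o.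

End continuous_linear_maps.

HB.instance Definition _ (K : numFieldType) (Y : preTopologicalLmodType K) :=
  GRing.Lmodule.on (topdual Y).

Section approximation_property.
Variable K : numFieldType.

Definition kappa_topology (Y : preTopologicalLmodType K) : topology (topdual Y) :=
  init_topology ((fun f => f) :
    topdual Y -> {family @absolutely_convex_compact K Y, Y -> K^o}).

Definition dual_kappa Y := topologized (kappa_topology Y).

Definition eps_product (Y : preTopologicalLmodType K) (E : normedModType K) :=
  continuous_linear (dual_kappa Y) E.

Definition equicontinuous_sets (Y : preTopologicalLmodType K)
  : set (set (topdual Y)) :=
  [set H | equicontinuous H (fun f : topdual Y => (f : Y -> K^o))].

Definition eps_topology (Y : preTopologicalLmodType K) (E : normedModType K)
  : topology (eps_product Y E) :=
  init_topology ((fun u => u) :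
    eps_product Y E -> {family @equicontinuous_sets Y, topdual Y -> E}).

(* Y (x) E inside Y eps E: y (x) e is the rank one operator y' |-> y'(y) e. *)
Definition eps_tensor (Y : preTopologicalLmodType K) (E : normedModType K)
  : set (eps_product Y E) :=
  [set u | exists (n : nat) (y : 'I_n -> Y) (e : 'I_n -> E),
     forall y' : topdual Y, u y' = \sum_(i < n) y' (y i) *: e i].

Definition approximation_property (Y : preTopologicalLmodType K) :=
  forall E : completeNormedModType K,
    dense (@eps_tensor Y E : set (topologized (eps_topology Y E))).

End approximation_property.

Definition dual_norm (K : numFieldType) (X : lmodType K) (gamma : topology X)
    (nrm : X -> K) (x' : topdual (topologized gamma)) : K :=
  supremum 0 [set `|x' x| | x in [set x : topologized gamma | nrm x <= 1]].

(* F(Omega) is the linear subspace S of K^Omega, with carrier X. *)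
Section function_spaces.
Variables (K : numFieldType) (Omega : Type) (S : {pred Omega -> K^o}).
Variable X : subLmodType S.

Definition pointwise_topology : topology X :=
  init_topology (\val : X -> {ptws Omega -> K^o}).

End function_spaces.

(* The space F(Omega, E)_sigma.  X is a phantom argument: it carries the proof
   that S is a linear subspace. *)
Definition weak_fun_pred (K : numFieldType) (Omega : Type)
    (S : {pred Omega -> K^o}) (X : subLmodType S) (E : tvsType K)
  : {pred Omega -> E} :=
  fun f => `[< forall e' : topdual E, ((e' \o f) : Omega -> K^o) \in S >].

Record weak_fun (K : numFieldType) (Omega : Type)
    (S : {pred Omega -> K^o}) (X : subLmodType S) (E : tvsType K) := WeakFun {
  weak_val :> Omega -> E ;
  weak_valP : weak_val \in @weak_fun_pred K Omega S X E }.

Section weak_functions.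
Variables (K : numFieldType) (Omega : Type) (S : {pred Omega -> K^o}).
Variables (X : subLmodType S) (E : tvsType K).
Local Notation weak_fun := (weak_fun X E).

HB.instance Definition _ := [isSub for @weak_val K Omega S X E].
HB.instance Definition _ := [Choice of weak_fun by <:].

Lemma weak_fun_closed : submod_closed (@weak_fun_pred K Omega S X E).
Proof.
have lin (e' : topdual E) : linear e'.
  by have := cl_funP e'; rewrite unfold_in => /asboolP[].
split.
  rewrite unfold_in; apply/asboolP => e'.
  suff -> : (e' \o (0 : Omega -> E)) = \val (0 : X) by exact: valP.
  rewrite raddf0; apply/funext => w /=.
  by have := lin e' (-1) 0 0; rewrite !scaleN1r !addNr.
move=> a f g; rewrite !unfold_in => /asboolP Sf /asboolP Sg.
apply/asboolP => e'.
suff -> : (e' \o (a *: f + g)) =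
    \val (a *: (@Sub _ S X _ (Sf e')) + @Sub _ S X _ (Sg e')) by exact: valP.
by rewrite linearP /= !SubK; apply/funext => w /=; exact: lin.
Qed.

HB.instance Definition _ :=
  GRing.isSubmodClosed.Build K (Omega -> E)
  (@weak_fun_pred K Omega S X E) weak_fun_closed.
HB.instance Definition _ := [SubChoice_isSubLmodule of weak_fun by <:].

Lemma weak_comp_subproof (f : weak_fun) (e' : topdual E) :
  ((e' \o f) : Omega -> K^o) \in S.
Proof. by have := weak_valP f; rewrite unfold_in => /asboolP. Qed.

(* e' \o f, as an element of F(Omega). *)
Definition weak_comp (f : weak_fun) (e' : topdual E) : X :=
  @Sub _ S X _ (weak_comp_subproof f e').

(* The polar of U_p = {p < 1}. *)
Definition polar_ball (p : E -> K) : set (topdual E) :=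
  [set e' | forall x, p x < 1 -> `|e' x| <= 1].

Definition weak_seminorm (p : E -> K) (q : nat -> X -> K) (a : nat -> K)
    (f : weak_fun) : K :=
  supremum 0 [set supremum 0 [set q n (weak_comp f e') * a n | n in setT]
             | e' in polar_ball p].

Definition weak_topology (Gamma_tau : set (X -> K)) (Gamma_E : set (E -> K))
  : topology weak_fun :=
  seminorm_topology [set s | exists (p : E -> K) (q : nat -> X -> K)
      (a : nat -> K),
    [/\ Gamma_E p, forall n, Gamma_tau (q n), forall n, 0 <= a n,
        a @ \oo --> (0 : K^o) & s = weak_seminorm p q a]].

Definition weak_tensor : set weak_fun :=
  [set f | exists (n : nat) (g : 'I_n -> X) (e : 'I_n -> E),
     forall w, f w = \sum_(i < n) (\val (g i) : Omega -> K^o) w *: e i].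

End weak_functions.

Definition generating_seminorms (K : numFieldType) (E : tvsType K)
    (Gamma_E : set (E -> K)) :=
  directed_seminorms Gamma_E /\ @open E = opens (seminorm_topology Gamma_E).

(* Gamma_E is an arbitrary directed system generating the topology of E; the
   topology obtained does not depend on its choice. *)
Definition weak_tensor_dense (K : numFieldType) (Omega : Type)
    (S : {pred Omega -> K^o}) (X : subLmodType S) (Gamma_tau : set (X -> K))
    (E : tvsType K) :=
  forall Gamma_E : set (E -> K), generating_seminorms Gamma_E ->
    dense (@weak_tensor K Omega S X E :
             set (topologized (weak_topology Gamma_tau Gamma_E))).

(* Main.v *)
(* Write X for F(Omega), B for its unit ball, and V for the dual of (X, gamma)
   with the dual norm. All four assertions are compared with the condition

     (AP) for every gamma-continuous seminorm p there are x_i in X, v_i in V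
          with p (y - sum_i v_i(y) x_i) <= 1 for all y in B.

   B is gamma-compact, since (X, gamma) is semi-Montel. As in the
   Banach-Dieudonne theorem, gamma is then generated by the seminorms
   sup_n q_n(x) a_n; by Helly's theorem and compactness every bounded functional
   on V is evaluation at a point of X (Dixmier-Ng). Hence V with its norm is the
   kappa-dual of (X, gamma) and (X, gamma) is the kappa-dual of V, because the
   polar of a gamma-continuous seminorm is norm-compact (Arzela-Ascoli).

   Composing a continuous operator with the approximating operators of (AP), or
   with their transposes, gives (a) and (b). Conversely (a) for E = V and the
   identity of V, and (b) for the completion of X under p and the canonical map,
   are transposed forms of (AP). The function w |-> (evaluation at w) from Omega
   to V turns (c) into (AP). Finally, the span of the point evaluations is norm
   dense in V, so the v_i in (AP) can be taken in it; such v_i act on every weak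
   function f, and sum_i x_i (x) v_i(f) approximates f because e' o f stays
   norm-bounded for e' in a polar, by a gliding hump argument. This gives (d). *)
Require Import Defs.
From HB Require Import structures.
From mathcomp Require Import all_boot all_order all_algebra.
From mathcomp Require Import complex ring zify.
From mathcomp Require Import all_classical all_reals all_analysis.

Set Implicit Arguments.
Unset Strict Implicit.
Unset Printing Implicit Defensive.

Import Order.TTheory GRing.Theory Num.Theory.
Import numFieldNormedType.Exports.

Local Open Scope classical_set_scope.
Local Open Scope ring_scope.

(** * Real and complex scalars *)

(** The mixed topology is given by a maximality property among linear topologies and comes without
    seminorms. Maximality enters through one device: a norm-bounded seminorm that is small near 0 on
    norm-bounded sets can be adjoined to [Gamma_tau] without leaving the class of candidates, hence
    it is [gamma]-continuous. This test yields the continuity of the weighted suprema, the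
    completeness of V, and the continuity on X of x |-> u(evaluation at x) for operators u on the
    kappa-dual of V. In (AP) the bound 1 stands for every bound, because p may be rescaled. Testing
    on B is enough: the transposed remainder w - sum_i w(x_i) v_i is measured by the dual norm,
    which is a supremum over B. The order of K is partial and [supremum] has a default value, so a
    supremum is an upper bound only once its set is known to be bounded; norms are therefore handled
    through their upper bounds. *)

Lemma real_supremums (K : numFieldType) (A : set K) (M : K) :
  real_or_complex K -> A !=set0 -> A `<=` [set x | x \is Num.real] ->
  ubound A M -> supremums A !=set0.
Proof.
move=> hK; case: hK A M => R A M [x0 Ax0] Ar AM.
  exists (sup A); have hA : has_sup A by split; [exists x0|exists M].
  by split=> [|y Ay]; [exact: sup_upper_bound|apply: ge_sup => //; exists x0].
have ReA x : A x -> ((complex.Re x)%:C)%C = x by move=> /Ar; exact: RRe_real.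
(* Comparable numbers differ by a real, so an upper bound of a non-empty set of reals is itself
   real. *)
have Mr : M \is Num.real.
  have := AM _ Ax0; rewrite -subr_ge0 => /ger0_real Mx.
  by rewrite -(subrK x0 M) rpredD//; exact: Ar.
pose B := (@complex.Re R) @` A.
have hB : has_sup B.
  split; first by exists (complex.Re x0), x0.
  exists (complex.Re M) => _ [x Ax <-].
  by rewrite -lecR (ReA x)// RRe_real//; exact: AM.
exists ((sup B)%:C)%C; split=> [x Ax|y yA].
  by rewrite -(ReA _ Ax) lecR; apply: sup_upper_bound => //; exists x.
have yr : y \is Num.real.
  have := yA _ Ax0; rewrite -subr_ge0 => /ger0_real yx.
  by rewrite -(subrK x0 y) rpredD//; exact: Ar.
rewrite -(RRe_real yr) lecR; apply: ge_sup; first by case: hB.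
by move=> _ [x Ax <-]; rewrite -lecR (ReA x)// RRe_real//; exact: yA.
Qed.

(** All that the passage from real to complex functionals uses about the scalars; the last clause is
    |Re z| <= |z|. *)
Lemma scalars_real_or_imaginary (K : numFieldType) : real_or_complex K ->
  (forall x : K, x \is Num.real) \/
  exists i : K, [/\ i * i = -1,
    forall x, exists a b, [/\ a \is Num.real, b \is Num.real & x = a + i * b] &
    forall a b, a \is Num.real -> b \is Num.real -> `|a| <= `|a + i * b| ].
Proof.
case=> R; first by left=> x; exact: num_real.
right; exists 'i%C; split; first by rewrite -expr2 sqr_i.
  move=> x; exists ((complex.Re x)%:C)%C, ((complex.Im x)%:C)%C.
  split; last exact: complexE.
    by apply/complex_realP; exists (complex.Re x).
  by apply/complex_realP; exists (complex.Im x).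
move=> a b /complex_realP[s ->] /complex_realP[t ->].
apply: le_trans (normc_ge_Re _) => /=.
rewrite mul0r mul1r subr0 !addr0. by rewrite normc_def/= expr0n/= addr0 sqrtr_sqr.
Qed.

Lemma closed_disc_closed (K : numFieldType) (V : normedModType K) (r : K) :
  r \is Num.real -> closed [set x : V | `|x| <= r].
Proof.
move=> rr; rewrite -openC openE => x /= /negP.
rewrite -real_ltNge// => rx; apply/nbhs_ballP.
exists (`|x| - r) => /=; first by rewrite subr_gt0.
move=> y; rewrite -ball_normE /= => xy; apply/negP.
rewrite -real_ltNge//; rewrite ltrBrDl -ltrBrDr in xy.
by apply: lt_le_trans xy _; rewrite lerBlDr -{1}(subrK y x) addrC ler_normD.
Qed.

(** For complex scalars the disc is a closed subset of the continuous image of a square of real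
    pairs; a radius that is not real gives the empty disc. *)
Lemma closed_disc_compact (K : numFieldType) (r : K) : real_or_complex K ->
  compact [set x : K^o | `|x| <= r].
Proof.
move=> hK; case: hK r => R r.
  apply: (@subclosed_compact _ _ `[-r, r]%classic).
  - exact: closed_disc_closed (num_real r).
  - exact: segment_compact.
  - by move=> x /=; rewrite ler_norml in_itv.
have [rr|rr] := boolP (r \is Num.real); last first.
  suff -> : [set x : R[i]^o | `|x| <= r] = set0 by exact: compact0.
  rewrite -subset0 => x /= xr; move/negP: rr; apply.
  by rewrite ger0_real// (le_trans _ xr).
have /complex_realP[s rs] := rr.
pose f (z : R^o * R^o) : R[i]^o := (z.1 +i* z.2)%C.
apply: (@subclosed_compact _ _ (f @` (`[-s, s]%classic `*` `[-s, s]%classic))).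
- exact: closed_disc_closed.
- apply: continuous_compact; last by apply: compact_setX; exact: segment_compact.
  apply: continuous_subspaceT => -[a b].
  apply/cvgrPdist_lt => e e0.
  have /complex_realP[d ed] := gtr0_real e0.
  have d0 : 0 < d / 2 by rewrite divr_gt0// -ltcR -ed.
  exists (ball (a : R^o) (d / 2), ball (b : R^o) (d / 2)).
    by split=> /=; apply: nbhsx_ballx.
  move=> [u v] /= []; rewrite -!ball_normE /= => au bv.
  rewrite /f /= [X in `|X| < _]complexE /=.
  apply: le_lt_trans (ler_normD _ _) _; rewrite normrM !normc_def /= ed.
  rewrite !expr0n/= expr1n add0r !addr0 sqrtr1 mul1r !sqrtr_sqr -rmorphD ltcR.
  by rewrite (splitr d) ltrD.
- move=> [a b] /= xs; exists (a, b) => //=.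
  move: xs; rewrite normc_def/= rs lecR => xs.
  rewrite !in_itv /= -!ler_norml; split; apply: le_trans xs;
    by rewrite -sqrtr_sqr ler_sqrt ?addr_ge0 ?sqr_ge0// ?lerDl ?lerDr sqr_ge0.
Qed.

(** A Cauchy filter contains a disc, which is compact, and a cluster point of a Cauchy filter is its
    limit. *)
Lemma scalar_cauchy_cvg (K : numFieldType) (F : set_system K^o) :
  real_or_complex K -> ProperFilter F ->
  (forall e : K, 0 < e -> exists x, F [set y | `|y - x| <= e]) ->
  exists l : K, forall e : K, 0 < e -> F [set y | `|y - l| <= e].
Proof.
move=> hK FF hF; have [x0 Fx0] := hF 1 ltr01.
have [|l [_ Fl]] := @closed_disc_compact K (`|x0| + 1) hK F FF.
  apply: filterS Fx0 => y /= yx; rewrite -(subrK x0 y) (le_trans (ler_normD _ _))//.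
  by rewrite addrC lerD2l.
exists l => e e0; have e3 : 0 < e / 3 by rewrite divr_gt0.
have [x Fx] := hF _ e3.
have [y [/= yx]] := Fl _ _ Fx (@nbhsx_ballx _ K^o l _ e3).
rewrite -ball_normE /= => ly.
apply: filterS Fx => z /= zx.
have -> : z - l = (z - x) + (x - y) + (y - l) by ring.
apply: le_trans (ler_normD _ _) _.
have e3E : e = e / 3 + e / 3 + e / 3 by field.
rewrite [X in _ <= X]e3E.
rewrite lerD//; last by rewrite distrC ltW.
by apply: le_trans (ler_normD _ _) _; rewrite lerD// distrC.
Qed.

(** * The Hahn-Banach theorem *)

Section seminorm_theory.
Variables (K : numFieldType) (X : lmodType K) (p : X -> K).
Hypothesis sp : is_seminorm p.

Lemma seminorm_ge0 x : 0 <= p x. Proof. by case: sp. Qed.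

Lemma seminorm_real x : p x \is Num.real.
Proof. exact/ger0_real/seminorm_ge0. Qed.

Lemma seminormD x y : p (x + y) <= p x + p y. Proof. by case: sp. Qed.

Lemma seminormZ a x : p (a *: x) = `|a| * p x. Proof. by case: sp. Qed.

Lemma seminorm0 : p 0 = 0.
Proof. by rewrite -(scale0r (0 : X)) seminormZ normr0 mul0r. Qed.

Lemma seminormN x : p (- x) = p x.
Proof. by rewrite -scaleN1r seminormZ normrN1 mul1r. Qed.

Lemma seminormB x y : p (x - y) <= p x + p y.
Proof. by rewrite -(seminormN y) seminormD. Qed.

Lemma seminorm_distr x y : p (x - y) = p (y - x).
Proof. by rewrite -seminormN opprB. Qed.

Lemma seminorm_sum n (x : 'I_n -> X) : p (\sum_i x i) <= \sum_i p (x i).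
Proof.
elim/big_ind2 : _ => //; first by rewrite seminorm0.
by move=> x1 y1 x2 y2 h1 h2; apply: le_trans (seminormD _ _) (lerD h1 h2).
Qed.

End seminorm_theory.

Section hahn_banach.
Variables (K : numFieldType) (hK : real_or_complex K).
Variables (X : lmodType K) (p : X -> K).
Hypothesis sp : is_seminorm p.

(* Real-linear functionals below p, as graphs: domination makes such a
   subspace of X * K single-valued. *)
Definition dominated_graph (G : set (X * K)) :=
  [/\ G (0, 0), forall x r, G (x, r) -> r \is Num.real /\ r <= p x,
      forall x r y s, G (x, r) -> G (y, s) -> G (x + y, r + s) &
      forall t x r, t \is Num.real -> G (x, r) -> G (t *: x, t * r)].

(** An admissible value [c] at [x1] has to lie above all [r - p (x - x1)] and below all
    [p (x + x1) - r]. The triangle inequality separates the two families, so the supremum of the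
    first one works. *)
Lemma dominated_graph_step (G : set (X * K)) (x1 : X) : dominated_graph G ->
  exists c, dominated_graph [set z | exists x r t,
    [/\ G (x, r), t \is Num.real & z = (x + t *: x1, r + t * c)]].
Proof.
move=> [G0 Gp GD GZ].
pose A := [set z | exists x r, G (x, r) /\ z = r - p (x - x1)].
have AB x r x' r' : G (x, r) -> G (x', r') -> r - p (x - x1) <= p (x' + x1) - r'.
  move=> Gx Gx'; rewrite lerBlDr addrAC lerBrDr.
  have /Gp[_ /le_trans] := GD _ _ _ _ Gx Gx'; apply.
  have -> : x + x' = (x' + x1) + (x - x1) by rewrite addrACA subrr addr0 addrC.
  exact: seminormD.
have Ar : A `<=` [set z | z \is Num.real].
  by move=> _ [x [r [/Gp[rr _] ->]]]; rewrite /= rpredB//; exact: seminorm_real.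
have [||c [cub clb]] := @real_supremums K A (p (0 + x1) - 0) hK _ Ar.
- by exists (0 - p (0 - x1)), 0, 0.
- by move=> _ [x [r [Gx ->]]]; exact: AB.
have c1 x r : G (x, r) -> r - c <= p (x - x1).
  by move=> Gx; rewrite lerBlDr -lerBlDl; apply: cub; exists x, r.
have c2 x r : G (x, r) -> r + c <= p (x + x1).
  move=> Gx; rewrite -lerBrDl; apply: clb => _ [x' [r' [Gx' ->]]].
  exact: AB.
have cr : c \is Num.real.
  have := c2 _ _ G0; rewrite add0r => /ler_real ->.
  exact: seminorm_real.
exists c; split.
- by exists 0, 0, 0; rewrite rpred0 scale0r mul0r !addr0.
- move=> _ _ [x [r [t [Gx tr [-> ->]]]]].
  have [rr rp] := Gp _ _ Gx.
  split; first by rewrite rpredD// rpredM.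
  have [t0|t0|->] := real_ltgtP tr (real0 K).
  + have s0 : 0 < - t by rewrite oppr_gt0.
    have -> : x + t *: x1 = (- t) *: ((- t)^-1 *: x - x1).
      by rewrite scalerBr scalerA mulfV ?gt_eqF// scale1r scaleNr opprK.
    rewrite (seminormZ sp)// gtr0_norm// -ler_pdivrMl// mulrDr.
    rewrite mulrA invrN mulNr mulNr mulVf ?lt_eqF// mulN1r -mulNr -invrN.
    by apply: c1; apply: GZ => //; rewrite rpredV rpredN.
  + have -> : x + t *: x1 = t *: (t^-1 *: x + x1).
      by rewrite scalerDr scalerA mulfV ?gt_eqF// scale1r.
    rewrite (seminormZ sp)// gtr0_norm// -ler_pdivrMl// mulrDr mulrA mulVf ?gt_eqF//.
    by rewrite mul1r; apply: c2; apply: GZ => //; rewrite rpredV.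
  + by rewrite mul0r scale0r !addr0.
- move=> _ _ _ _ [x [r [t [Gx tr [-> ->]]]]] [y [s [u [Gy ur [-> ->]]]]].
  exists (x + y), (r + s), (t + u); split; [exact: GD|exact: rpredD|].
  by rewrite scalerDl mulrDl; congr (_, _); rewrite addrACA.
- move=> u _ _ ur [x [r [t [Gx tr [-> ->]]]]].
  exists (u *: x), (u * r), (u * t); split; [exact: GZ|exact: rpredM|].
  by rewrite scalerDr mulrDr scalerA mulrA.
Qed.

Lemma dominated_graph_extension (G : set (X * K)) : dominated_graph G ->
  exists f : X -> K, [/\ forall x, f x \is Num.real, forall x, f x <= p x,
    forall x y, f (x + y) = f x + f y,
    forall t x, t \is Num.real -> f (t *: x) = t * f x &
    forall x r, G (x, r) -> f x = r].
Proof.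
move=> dG; have [G0 Gp GD GZ] := dG.
(* Zorn is applied to the sets [H] whose union with [G] is dominated: then the empty chain is
   admissible too, and [G] stays inside. *)
have [|A [dA maxA]] := @Zorn_bigcup _ (fun H => dominated_graph (G `|` H)).
  move=> F FP tF.
  have sub H : F H -> G `|` H `<=` G `|` \bigcup_(X in F) X.
    by move=> FH; apply: setUS; exact: bigcup_sup.
  have joint z w : (G `|` \bigcup_(X in F) X) z -> (G `|` \bigcup_(X in F) X) w ->
      exists H, [/\ dominated_graph H, H `<=` G `|` \bigcup_(X in F) X, H z & H w].
    move=> [Gz|[H1 FH1 Hz]] [Gw|[H2 FH2 Hw]].
    - by exists G; split=> //; exact: subsetUl.
    - by exists (G `|` H2); split; [exact: FP|exact: sub|left|right].
    - by exists (G `|` H1); split; [exact: FP|exact: sub|right|left].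
    - have [H12|H21] := tF _ _ FH1 FH2.
        by exists (G `|` H2); split; [exact: FP|exact: sub|right; exact: H12|right].
      by exists (G `|` H1); split; [exact: FP|exact: sub|right|right; exact: H21].
  split.
  - by left.
  - by move=> x r Hx; have [H [[_ + _ _] _ + _]] := joint _ _ Hx Hx; apply.
  - move=> x r y s Hx Hy; have [H [[_ _ + _] + Hx' Hy']] := joint _ _ Hx Hy.
    by move=> HD; apply; exact: HD.
  - move=> t x r tr Hx; have [H [[_ _ _ +] + Hx' _]] := joint _ _ Hx Hx.
    by move=> HZ; apply; exact: HZ.
have tot x : exists r, (G `|` A) (x, r).
  apply: contrapT => nx.
  have [c dH] := dominated_graph_step x dA.
  set H := (X in dominated_graph X) in dH.
  have sH : G `|` A `<=` H.
    by move=> [y r] Hy; exists y, r, 0; rewrite scale0r mul0r !addr0; split.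
  apply: (maxA H).
    split; first by move=> z Az; apply: sH; right.
    move=> /(_ (0 + 1 *: x, 0 + 1 * c)) HA; apply: nx; exists c.
    rewrite add0r scale1r add0r mul1r in HA; right; apply: HA.
    exists 0, 0, 1; rewrite rpred1 scale1r mul1r !add0r; split=> //.
    by case: dA.
  suff -> : G `|` H = H by [].
  by apply/seteqP; split=> [z [Gz|//]|z]; [apply: sH; left|right].
have [f hf] := choice tot.
have [B0 Bp BD BZ] := dA.
have uniq x r : (G `|` A) (x, r) -> f x = r.
  move=> Bx; have h s s' : (G `|` A) (x, s) -> (G `|` A) (x, s') -> s <= s'.
    move=> Bs Bs'; rewrite -subr_le0 -(seminorm0 sp) -(subrr x).
    have [] // := Bp (x - x) (s - s') _.
    apply: BD => //; rewrite -[- x]scaleN1r -[- s']mulN1r; apply: BZ => //.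
  by apply: le_anti; rewrite !h.
exists f; split.
- by move=> x; have [] := Bp _ _ (hf x).
- by move=> x; have [] := Bp _ _ (hf x).
- by move=> x y; apply: uniq; exact: BD.
- by move=> t x tr; apply: uniq; exact: BZ.
- by move=> x r Gx; apply: uniq; left.
Qed.

(** Here [r] bounds the [p]-distance from [x0] to [N] from below. With [N] zero this gives norming
    functionals, with a common kernel Helly's theorem, with a span the density of that span. *)
Lemma hahn_banach (N : set X) (x0 : X) (r : K) :
  N 0 -> (forall a x y, N x -> N y -> N (a *: x + y)) -> 0 <= r ->
  (forall y, N y -> r <= p (x0 + y)) ->
  exists f : X -> K^o, [/\ linear f, forall x, `|f x| <= p x,
    forall y, N y -> f y = 0 & r <= `|f x0| ].
Proof.
move=> N0 NP r0 hr.
have NZ a x : N x -> N (a *: x) by move=> Nx; rewrite -[_ *: _]addr0; exact: NP.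
(* The functional [y + t *: x0 |-> t * r]. For [t > 0] its domination is the distance bound at
   [t^-1 *: y]; for [t < 0] its value is at most 0. *)
pose G := [set z | exists y t, [/\ N y, t \is Num.real &
   z = (y + t *: x0, t * r)]].
have dG : dominated_graph G.
  split.
  - by exists 0, 0; rewrite rpred0 scale0r mul0r addr0.
  - move=> _ _ [y [t [Ny tr [-> ->]]]]; split.
      by rewrite rpredM// ger0_real.
    have [t0|t0|->] := real_ltgtP tr (real0 K).
    + by rewrite (le_trans _ (seminorm_ge0 sp _))// nmulr_rle0.
    + have -> : y + t *: x0 = t *: (x0 + t^-1 *: y).
        by rewrite scalerDr scalerA mulfV ?gt_eqF// scale1r addrC.
      by rewrite (seminormZ sp)// gtr0_norm// ler_pM2l// hr//; exact: NZ.
    + by rewrite mul0r (seminorm_ge0 sp).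
  - move=> _ _ _ _ [y [t [Ny tr [-> ->]]]] [z [u [Nz ur [-> ->]]]].
    exists (y + z), (t + u); split; [|exact: rpredD|].
      by rewrite -[y]scale1r; exact: NP.
    by rewrite addrACA scalerDl mulrDl.
  - move=> u _ _ ur [y [t [Ny tr [-> ->]]]].
    exists (u *: y), (u * t); split; [exact: NZ|exact: rpredM|].
    by rewrite scalerDr scalerA mulrA.
have [f [fr fp fD fZ fG]] := dominated_graph_extension dG.
have fN y : N y -> f y = 0.
  move=> Ny; apply: fG; exists y, 0; rewrite rpred0 scale0r mul0r addr0.
  by split.
have fx0 : f x0 = r.
  by apply: fG; exists 0, 1; rewrite rpred1 scale1r mul1r add0r; split.
have f0 : f 0 = 0 by exact: fN.
have fNN x : f (- x) = - f x.
  by rewrite -scaleN1r fZ ?realN ?real1// mulN1r.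
have [Kr|[i [ii Ki Kn]]] := scalars_real_or_imaginary hK.
  exists f; split=> //.
  - by move=> a x y; rewrite fD fZ.
  - move=> x; rewrite real_ler_norml; last exact: fr.
    by rewrite fp lerNl -fNN -(seminormN sp x) fp.
  - by rewrite fx0 ger0_norm.
(* The complex-linear functional with real part [f]. *)
pose g x : K^o := f x - i * f (i *: x).
have gl : linear g.
  have fii z : f (i *: (i *: z)) = - f z by rewrite scalerA ii scaleN1r fNN.
  move=> c x y; have [a [b [ar br ->]]] := Ki c.
  have -> : (a + i * b) *: x = a *: x + b *: (i *: x).
    by rewrite scalerDl mulrC scalerA.
  have fi : i *: (a *: x + b *: (i *: x) + y) =
      a *: (i *: x) + b *: (i *: (i *: x)) + i *: y.
    by rewrite !scalerDr !scalerA (mulrC i a) mulrA (mulrC i b).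
  rewrite /g fi !fD !(fZ a)// !(fZ b)// fii.
  rewrite /GRing.scale/=; apply/eqP; rewrite -subr_eq0; apply/eqP.
  transitivity (b * (i * i + 1) * f (i *: x)); last by rewrite ii addNr mulr0 mul0r.
  by ring.
have gN y : N y -> g y = 0.
  by move=> Ny; rewrite /g !fN ?mulr0 ?subr0//; exact: NZ.
have gp x : `|g x| <= p x.
  have [->|gx0] := eqVneq (g x) 0; first by rewrite normr0 (seminorm_ge0 sp).
  (* Rotating [x] by [u] makes the value of [g] real, so that it equals the value of [f], which is
     dominated by [p]. *)
  pose u := `|g x| / g x.
  have u1 : `|u| = 1 by rewrite /u normrM normfV normr_id mulfV// normr_eq0.
  have gu : g (u *: x) = `|g x|.
    have := gl u x 0; rewrite !addr0.
    have -> : g 0 = 0 by exact: gN.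
    by rewrite addr0 => ->; rewrite /GRing.scale/= /u divfK.
  have : `|f (u *: x)| <= p x.
    rewrite real_ler_norml; last exact: fr.
    rewrite -(mul1r (p x)) -u1 -(seminormZ sp)// fp lerNl -fNN -(seminormN sp) fp.
    by [].
  apply: le_trans.
  have gur : g (u *: x) \is Num.real by rewrite gu normr_real.
  have : i * f (i *: (u *: x)) \is Num.real.
    have -> : i * f (i *: (u *: x)) = f (u *: x) - g (u *: x) by rewrite /g; ring.
    exact: rpredB.
  set b := f (i *: (u *: x)) => ibr.
  have b0 : b = 0.
    have br : b \is Num.real by exact: fr.
    (* Since [i * b] is real it may serve as the real part; with imaginary part [- b] the sum is 0,
       which forces [b = 0]. *)
    have := Kn (i * b) (- b) ibr; rewrite rpredN => /(_ br).
    rewrite mulrN subrr normr0 normr_le0 mulf_eq0 => /orP[/eqP i0|/eqP//].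
    by move: ii; rewrite i0 mul0r => /eqP; rewrite eq_sym oppr_eq0 oner_eq0.
  rewrite -gu /g -/b b0 mulr0 subr0 real_ler_norm//.
exists g; split=> //.
rewrite -[X in X <= _](ger0_norm r0) -fx0 /g -mulrN.
by apply: Kn => //; rewrite rpredN.
Qed.

End hahn_banach.

Lemma linear_combination_of_functionals (K : numFieldType) (X : lmodType K) n :
  forall (v : 'I_n -> X -> K^o) (f : X -> K^o),
  (forall i, linear (v i)) -> linear f ->
  (forall x, (forall i, v i x = 0) -> f x = 0) ->
  exists a : 'I_n -> K, forall x, f x = \sum_i a i * v i x.
Proof.
have linB (g : X -> K^o) : linear g -> forall a x y, g (x - a *: y) = g x - a * g y.
  by move=> lg a x y; rewrite addrC -scaleNr lg /GRing.scale/= mulNr addrC.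
have lin0 (g : X -> K^o) : linear g -> g 0 = 0.
  by move=> lg; have := linB _ lg 1 0 0; rewrite scale1r mul1r !subrr.
elim: n => [|n IH] v f lv lf vf.
  by exists (fun=> 0) => x; rewrite big_ord0 vf// => -[].
have [h|/existsNP[y /not_implyP[ky vy]]] :=
    pselect (forall x, (forall i, v (lift ord0 i) x = 0) -> v ord0 x = 0).
  have [|x kx|a fa] := IH (fun i => v (lift ord0 i)) f _ lf _.
  - by move=> i; exact: lv.
  - by apply: vf => i; case: (unliftP ord0 i) => [j|] ->; [exact: kx|exact: h].
  exists (fun i => if unlift ord0 i is Some j then a j else 0) => x.
  rewrite big_ord_recl unlift_none mul0r add0r fa.
  by apply: eq_bigr => i _; rewrite liftK.
pose b := f y / v ord0 y.
have [||x kx|a fa] := IH (fun i => v (lift ord0 i))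
  (fun x => f x - b * v ord0 x) _ _ _.
- by move=> i; exact: lv.
- move=> c x z; rewrite lf lv /GRing.scale/=; ring.
- have := vf (x - (v ord0 x / v ord0 y) *: y).
  rewrite linB// => <-; first by rewrite /b; field; exact/eqP.
  move=> i; rewrite linB//; case: (unliftP ord0 i) => [j|] ->.
    by rewrite kx ky mulr0 subrr.
  by rewrite divfK ?subrr//; exact/eqP.
exists (fun i => if unlift ord0 i is Some j then a j else b) => x.
rewrite big_ord_recl unlift_none; apply/eqP; rewrite addrC -subr_eq; apply/eqP.
by rewrite fa; apply: eq_bigr => i _; rewrite liftK.
Qed.

(** * Suprema of non-negative scalars *)

Section supremum_theory.
Variables (K : numFieldType) (hK : real_or_complex K).

Lemma le_supremum (A : set K) (M x : K) : (forall y, A y -> 0 <= y) ->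
  ubound A M -> A x -> x <= supremum 0 A.
Proof.
move=> A0 AM Ax; have [||s sA] := @real_supremums K A M hK _ _ AM.
- by exists x.
- by move=> y /A0 /ger0_real.
rewrite /supremum ifF; last by apply/eqP => A00; rewrite A00 in Ax.
by have [+ _] := xgetPex 0 (ex_intro _ s sA); apply.
Qed.

Lemma supremum_le (A : set K) (M : K) : (forall y, A y -> 0 <= y) -> 0 <= M ->
  ubound A M -> supremum 0 A <= M.
Proof.
move=> A0 M0 AM; have [->|/set0P Ane] := eqVneq A set0.
  by rewrite supremum0.
have [|s sA] := @real_supremums K A M hK Ane _ AM.
  by move=> y /A0 /ger0_real.
rewrite /supremum ifF; last by apply/eqP => A00; move: Ane; rewrite A00 => -[].
by have [_ +] := xgetPex 0 (ex_intro _ s sA); apply.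
Qed.

Lemma supremum_ge0 (A : set K) : (forall y, A y -> 0 <= y) ->
  0 <= supremum 0 A.
Proof.
move=> A0; have [->|/set0P[x Ax]] := eqVneq A set0; first by rewrite supremum0.
(* For unbounded [A] the supremum is the default value 0. *)
have [[_ [M AM]]|] := pselect (has_sup A); last by move=> /supremum_out ->.
exact: le_trans (A0 _ Ax) (le_supremum A0 AM Ax).
Qed.

Lemma archimedean_scalars (x : K) : x \is Num.real -> exists n, x < n.+1%:R.
Proof.
case: hK x => R x xr.
  by exists (Num.trunc x); exact: truncnS_gt.
have /complex_realP[s ->] := xr; exists (Num.trunc s).
by rewrite -(rmorph_nat (real_complex R)) ltcR truncnS_gt.
Qed.

Lemma natSr_inv_cvg0 (e : K) : 0 < e ->
  exists N, forall n, (N <= n)%N -> n.+1%:R^-1 < e.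
Proof.
move=> e0; have [|N eN] := archimedean_scalars (x := e^-1).
  by rewrite gtr0_real// invr_gt0.
exists N => n Nn; rewrite invf_plt ?posrE//; apply: lt_le_trans eN _.
by rewrite ler_nat ltnS.
Qed.

End supremum_theory.

(** * Compactness by finite intersections *)

(** The finite intersections generate a filter; its cluster point in [A] belongs to each [C i]
    because these sets are closed. *)
Lemma compact_fip (T : topologicalType) (A : set T) (I : eqType) (D : set I)
    (C : I -> set T) : compact A -> (forall i, D i -> closed (C i)) ->
  (forall s : seq I, (forall i, i \in s -> D i) ->
    exists2 x, A x & forall i, i \in s -> C i x) ->
  exists2 x, A x & forall i, D i -> C i x.
Proof.
move=> cA cC fip.
pose F := filter_from [set s : seq I | forall i, i \in s -> D i]
  (fun s => A `&` [set x | forall i, i \in s -> C i x]).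
have FF : ProperFilter F.
  apply: filter_from_proper; last first.
    by move=> s sD; have [x Ax Cx] := fip s sD; exists x.
  apply: filter_from_filter; first by exists [::].
  move=> s t sD tD; exists (s ++ t).
    by move=> i; rewrite mem_cat => /orP[/sD|/tD].
  by move=> x [Ax Cx]; split; split=> // i is_; apply: Cx;
    rewrite mem_cat is_ ?orbT.
have [|x [Ax Fx]] := cA F FF; first by exists [::] => // x [].
exists x => // i Di; rewrite (closure_id (C i)).1; last exact: cC.
move=> B Bx; apply: Fx => //; exists [:: i] => [j|y [_]].
  by rewrite inE => /eqP ->.
by apply; rewrite inE.
Qed.

Lemma compact_bounded_exhaustion (T : topologicalType) (A : set T)
    (O : nat -> set T) : compact A -> (forall n, open (O n)) ->
  (forall n, O n `<=` O n.+1) -> A `<=` \bigcup_n O n ->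
  exists n, A `<=` O n.
Proof.
move=> cA oO incr AO; apply: contrapT => nA.
have mono m n : (m <= n)%N -> O m `<=` O n.
  move=> /subnKC <-; elim: (n - m)%N => [|k IH]; first by rewrite addn0.
  by rewrite addnS; apply: subset_trans IH _; exact: incr.
have [||x Ax Cx] := @compact_fip T A nat setT (fun n => ~` O n) cA.
- by move=> n _; rewrite closedC.
- move=> s _; have := nA; rewrite -forallNE.
  move=> /(_ (\max_(i <- s) i)%N) /existsNP[x /not_implyP[Ax nx]].
  exists x => // i si; apply: contra_not nx; apply: mono.
  exact: leq_bigmax_seq.
- by have [n _ Onx] := AO _ Ax; exact: (Cx n I).
Qed.

(** * Topologies generated by seminorms *)

Section topologized_choice.
Variable X : choiceType.

Lemma topologized_nbhsP (t : topology X) (x : X) (U : set X) :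
  nbhs (x : topologized t) U <-> exists O, [/\ opens t O, O x & O `<=` U].
Proof.
rewrite (@nbhsE (topologized t)); split.
  by move=> [ O [oO Ox] OU]; exists O.
by move=> [ O [oO Ox OU]]; exists O.
Qed.

Lemma coarser_nbhs (t1 t2 : topology X) (x : X) (U : set X) : coarser t1 t2 ->
  nbhs (x : topologized t1) U -> nbhs (x : topologized t2) U.
Proof.
move=> t12 /topologized_nbhsP[ O [oO Ox OU]].
by apply/topologized_nbhsP; exists O; split=> //; exact: t12.
Qed.

End topologized_choice.

Section topologized_theory.
Variables (K : numFieldType) (X : lmodType K).

Lemma seminorm_topologyE (Q : set (X -> K)) (U : set X) :
  opens (seminorm_topology Q) U = seminorm_open Q U.
Proof. by []. Qed.

Section seminorm_topology_theory.
Variable Q : set (X -> K).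
Hypothesis Qs : forall q, Q q -> is_seminorm q.

Lemma finite_set_lower_bound (T : eqType) (A : set T) (f : T -> K) :
  finite_set A -> (forall q, A q -> 0 < f q) ->
  exists2 d, 0 < d & forall q, A q -> d <= f q.
Proof.
move=> /finite_seqP[s ->]; elim: s => [|q s IH] h; first by exists 1.
have [|d d0 hd] := IH; first by move=> r rs; apply: h; rewrite /= inE rs orbT.
have q0 : 0 < f q by apply: h; rewrite /= inE eqxx.
have dq : d >=< f q by apply: real_comparable; exact: gtr0_real.
exists (Num.min d (f q)); first by rewrite comparable_lt_min// d0.
move=> r /=; rewrite inE comparable_ge_min// => /orP[/eqP ->|rs].
  by rewrite lexx orbT.
by rewrite hd.
Qed.

Lemma seminorm_ball_open (Q0 : set (X -> K)) (x : X) (e : K) :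
  finite_set Q0 -> Q0 `<=` Q ->
  opens (seminorm_topology Q) [set y | forall q, Q0 q -> q (y - x) < e].
Proof.
move=> fQ sQ; rewrite seminorm_topologyE => y /= yx.
have [|d d0 hd] := @finite_set_lower_bound _ Q0 (fun q => e - q (y - x)) fQ.
  by move=> q /yx; rewrite subr_gt0.
exists Q0, d; split=> // z /= zy q Qq.
rewrite -(subrK y z) -addrA; apply: le_lt_trans (seminormD (Qs (sQ _ Qq)) _ _) _.
by rewrite -ltrBrDr (lt_le_trans (zy _ Qq))// hd.
Qed.

Lemma seminorm_nbhsP (x : X) (U : set X) :
  nbhs (x : topologized (seminorm_topology Q)) U <->
  exists Q0 e, [/\ finite_set Q0, Q0 `<=` Q, 0 < e &
    [set y | forall q, Q0 q -> q (y - x) < e] `<=` U].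
Proof.
rewrite topologized_nbhsP; split.
  move=> [ O [oO Ox OU]]; have [Q0 [e [? ? ? QO]]] := oO _ Ox.
  by exists Q0, e; split=> //; exact: subset_trans OU.
move=> [Q0 [e [fQ sQ e0 QU]]]; exists [set y | forall q, Q0 q -> q (y - x) < e].
split=> //; first exact: seminorm_ball_open.
by move=> q Qq /=; rewrite subrr seminorm0//; exact/Qs/sQ.
Qed.

Lemma seminorm_ball_nbhs (q : X -> K) (x : X) (e : K) : Q q -> 0 < e ->
  nbhs (x : topologized (seminorm_topology Q)) [set y | q (y - x) < e].
Proof.
move=> Qq e0; apply/seminorm_nbhsP; exists [set q], e; split=> //.
- by move=> _ ->.
- by move=> y; apply.
Qed.

Lemma linear_seminorm_topology : linear_topology (topologized (seminorm_topology Q)).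
Proof.
have e2 (e : K) : 0 < e -> 0 < e / 2 by move=> ?; rewrite divr_gt0.
split.
  move=> -[x y] U /= /seminorm_nbhsP[Q0 [e [fQ sQ /e2 e0 QU]]].
  exists ([set z | forall q, Q0 q -> q (z - x) < e / 2],
          [set z | forall q, Q0 q -> q (z - y) < e / 2]).
    by split; apply/seminorm_nbhsP; exists Q0, (e / 2); split.
  move=> [u v] /= [ux vy]; apply: QU => q Qq /=; rewrite opprD addrACA.
  apply: le_lt_trans (seminormD (Qs (sQ _ Qq)) _ _) _.
  by rewrite (splitr e) ltrD ?ux ?vy.
move=> -[a x] U /= /seminorm_nbhsP[Q0 [e [fQ sQ /e2 e0 QU]]].
have [|d d0 hd] := @finite_set_lower_bound _ Q0 (fun q => e / 2 / (q x + 1)) fQ.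
  by move=> q /sQ /Qs sq; rewrite divr_gt0// ltr_wpDl// seminorm_ge0.
pose d1 := Num.min d 1.
have d1r : d >=< 1 by apply: real_comparable; exact: gtr0_real.
have d10 : 0 < d1 by rewrite comparable_lt_min// d0 ltr01.
have a1 : 0 < `|a| + 1 by rewrite ltr_wpDl.
exists (ball (a : K^o) d1,
  [set z | forall q, Q0 q -> q (z - x) < e / 2 / (`|a| + 1)]).
  split; first exact: nbhsx_ballx.
  apply/seminorm_nbhsP; exists Q0, (e / 2 / (`|a| + 1)).
  by split=> //; rewrite divr_gt0.
move=> [b z] /= []; rewrite -ball_normE /= => ab zx; apply: QU => q Qq /=.
have sq := Qs (sQ _ Qq).
have -> : b *: z - a *: x = b *: (z - x) + (b - a) *: x.
  by rewrite scalerBr scalerBl addrA subrK.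
apply: le_lt_trans (seminormD sq _ _) _; rewrite !(seminormZ sq).
have b1 : `|b| <= `|a| + 1.
  rewrite -(subrK a b) addrC (le_trans (ler_normD _ _))// lerD2l distrC ltW//.
  by apply: lt_le_trans ab _; rewrite comparable_ge_min// lexx orbT.
rewrite (splitr e) ltr_leD//.
  apply: le_lt_trans (ler_wpM2r (seminorm_ge0 sq _) b1) _.
  by rewrite mulrC -ltr_pdivlMr// zx.
rewrite distrC.
apply: (@le_trans _ _ (d * (q x + 1))); last first.
  by rewrite -ler_pdivlMr ?hd// ltr_wpDl// seminorm_ge0.
rewrite ler_pM// ?seminorm_ge0// ?lerDl//.
by rewrite ltW// (lt_le_trans ab)// comparable_ge_min// lexx.
Qed.

End seminorm_topology_theory.
End topologized_theory.

Section linear_topology_theory.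
Variables (K : numFieldType) (Y : preTopologicalLmodType K).
Hypothesis lY : linear_topology Y.

Lemma linear_topology_affine (a : K) (x y : Y) (U : set Y) :
  nbhs (a *: x + y) U -> nbhs x [set z | U (a *: z + y)].
Proof.
move=> axU; have [addc scalec] := lY.
suff : (fun z => a *: z + y) @ x --> a *: x + y by apply.
apply: (@continuous_comp _ _ _ (fun z => (a *: z, y)) (fun z : Y * Y => z.1 + z.2));
  last exact: addc.
apply: cvg_pair; last exact: cvg_cst.
apply: (@continuous_comp Y (K^o * Y)%type Y (fun z => (a, z))
  (fun z => z.1 *: z.2)); last exact: scalec.
by apply: (@cvg_pair _ _ _ _ (nbhs (a : K^o))); [exact: cvg_cst|exact: cvg_id].
Qed.

Lemma linear_topology_shift (a : K) (x : Y) (U : set Y) :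
  nbhs 0 U -> nbhs x [set z | U (a *: (z - x))].
Proof.
move=> U0; have := @linear_topology_affine a x (- (a *: x)) U.
rewrite subrr => /(_ U0); apply: filterS => z /=.
by rewrite scalerBr.
Qed.

Lemma linear_topology_seminorm_ball (p : Y -> K) (x : Y) (e : K) :
  is_seminorm p -> nbhs 0 [set z | p z < 1] -> 0 < e ->
  nbhs x [set z | p (z - x) < e].
Proof.
move=> sp p1 e0; have := @linear_topology_shift e^-1 x _ p1.
apply: filterS => z /=; rewrite (seminormZ sp) gtr0_norm ?invr_gt0//.
by rewrite ltr_pdivrMl// mulr1.
Qed.

End linear_topology_theory.

Lemma seminorm_topology_subset (K : numFieldType) (X : lmodType K)
    (Q1 Q2 : set (X -> K)) : Q1 `<=` Q2 ->
  coarser (seminorm_topology Q1) (seminorm_topology Q2).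
Proof.
move=> Q12 U oU; rewrite seminorm_topologyE => x Ux.
have [Q0 [e [f0 s0 e0 QU]]] := oU x Ux.
by exists Q0, e; split=> //; exact: subset_trans Q12.
Qed.

(** In a linear topology the second condition amounts to continuity of [p] everywhere. *)
Definition continuous_seminorm (K : numFieldType) (X : lmodType K)
    (t : topology X) (p : X -> K) :=
  is_seminorm p /\ nbhs (0 : topologized t) [set x | p x < 1].

(** * Mixed topologies *)

Section null_sequences.
Variable K : numFieldType.

Lemma cvg0P (a : nat -> K) : a @ \oo --> (0 : K^o) <->
  forall e, 0 < e -> exists N, forall n, (N <= n)%N -> `|a n| < e.
Proof.
split.
  move=> /(@cvgr0Pnorm_lt _ K^o) a0 e /a0[N _ aN]; exists N => n Nn; exact: aN.
move=> h; apply/(@cvgr0Pnorm_lt _ K^o) => e /h[N aN].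
by exists N.
Qed.

Lemma null_sequence_bounded (a : nat -> K) : (forall n, 0 <= a n) ->
  a @ \oo --> (0 : K^o) -> exists2 A, 0 < A & forall n, a n <= A.
Proof.
move=> a0 /cvg0P /(_ 1 ltr01)[N aN].
exists (1 + \sum_(i < N) a i); first by rewrite ltr_pwDl// sumr_ge0.
move=> n; have [Nn|nN] := leqP N n.
  rewrite (@le_trans _ _ 1)//; last by rewrite lerDl sumr_ge0.
  by rewrite -[a n]ger0_norm// ltW// aN.
rewrite (@le_trans _ _ (\sum_(i < N) a i))//; last by rewrite lerDr.
by rewrite (bigD1 (Ordinal nN))//= lerDl sumr_ge0.
Qed.

(* A null-sequence may be constant on finite blocks: the blocks [L i] are
   enumerated through the pairing of naturals. *)
Lemma null_sequence_of_blocks (T : eqType) (Q : set T) (t0 : T)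
    (L : nat -> seq T) (alpha : nat -> K) :
  Q t0 -> (forall i t, t \in L i -> Q t) -> (forall i, 0 <= alpha i) ->
  alpha @ \oo --> (0 : K^o) ->
  exists (q : nat -> T) (a : nat -> K),
    [/\ forall n, Q (q n), forall n, 0 <= a n, a @ \oo --> (0 : K^o) &
        forall i t, t \in L i -> exists n, q n = t /\ a n = alpha i].
Proof.
move=> Qt0 LQ al0 /cvg0P al.
pose f (k : nat) : T * K :=
  if @pickle_inv (nat * nat)%type k is Some (i, j) then
    if (j < size (L i))%N then (nth t0 (L i) j, alpha i) else (t0, 0) else (t0, 0).
exists (fun k => (f k).1), (fun k => (f k).2); split.
- move=> k; rewrite /f; case: pickle_inv => [[i j]|//]; case: ifP => //= h.
  by apply: (LQ i); exact: mem_nth.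
- by move=> k; rewrite /f; case: pickle_inv => [[i j]|//]; case: ifP => //=.
- apply/cvg0P => e e0; have [N alN] := al _ e0.
  exists (\max_(i < N) \max_(j < size (L i))
    (@pickle (nat * nat)%type (i : nat, j : nat))).+1 => k Nk.
  rewrite /f; have := @pickle_invK (nat * nat)%type k.
  case: pickle_inv => [[i j]|] /= kE; last by rewrite normr0.
  case: ifP => /= [js|]; last by rewrite normr0.
  have [Ni|iN] := leqP N i; first exact: alN.
  exfalso; move: Nk; rewrite ltnNge => /negP; apply.
  rewrite -kE; apply: (leq_trans _ (leq_bigmax (Ordinal iN))).
  exact: (leq_bigmax (Ordinal js)).
- move=> i t /[dup] tL; rewrite -index_mem => ti.
  by exists (pickle (i, index t (L i))); rewrite /f pickleK_inv ti/= nth_index.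
Qed.

End null_sequences.

Lemma filter_forall_ltn (T : Type) (F : set_system T) (P : nat -> set T) N :
  Filter F -> (forall i, F (P i)) -> F [set x | forall i, (i < N)%N -> P i x].
Proof.
move=> FF FP; elim: N => [|N IH]; first by apply: filterS filterT => x _ i.
apply: filterS (filterI IH (FP N)) => x [xP xN] i.
by rewrite ltnS leq_eqVlt => /orP[/eqP ->//|]; exact: xP.
Qed.

Definition weighted_sup (K : numFieldType) (X : Type) (q : nat -> X -> K)
    (a : nat -> K) (x : X) : K :=
  supremum 0 [set q n x * a n | n in setT].

Definition null_weights (K : numFieldType) (X : Type) (Q : set (X -> K))
    (q : nat -> X -> K) (a : nat -> K) :=
  [/\ forall n, Q (q n), forall n, 0 <= a n & a @ \oo --> (0 : K^o)].

Section mixed_topology.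
Variables (K : numFieldType) (hK : real_or_complex K) (X : lmodType K).
Variables (nrm : X -> K) (tau : topology X) (Gamma_tau : set (X -> K)).
Hypothesis hsaks : saks_space nrm tau Gamma_tau.
Variables (gamma : topology X) (hgamma : is_mixed_topology nrm tau gamma).

Lemma saks_nrm_seminorm : is_seminorm nrm.
Proof. by have [] := saks_norm hsaks. Qed.
Let sn := saks_nrm_seminorm.

Lemma saks_seminorm q : Gamma_tau q -> is_seminorm q.
Proof. by have [_ h _] := saks_directed hsaks; exact: h. Qed.

Lemma saks_le_nrm q x : Gamma_tau q -> q x <= nrm x.
Proof. by move=> Gq; have [+ _] := saks_sup hsaks x; apply; exists q. Qed.

Lemma saks_nrm_le x c : (forall q, Gamma_tau q -> q x <= c) -> nrm x <= c.
Proof.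
move=> h; have [_ +] := saks_sup hsaks x; apply.
by move=> _ [q Gq <-]; exact: h.
Qed.

Lemma mixed_linear : linear_topology (topologized gamma).
Proof. by case: hgamma => -[]. Qed.

Lemma mixed_finer : coarser tau gamma.
Proof. by case: hgamma => -[]. Qed.

Lemma mixed_coarser_norm : coarser gamma (norm_topology nrm).
Proof. by case: hgamma => -[]. Qed.

(** [gamma] and [tau] have the same trace on the ball of radius [M], and [tau] is given by
    seminorms. *)
Lemma mixed_nbhs0 (U : set X) (M : K) : nbhs (0 : topologized gamma) U ->
  0 <= M ->
  exists Q0 e, [/\ finite_set Q0, Q0 `<=` Gamma_tau, 0 < e &
    forall x, (forall q, Q0 q -> q x < e) -> nrm x <= M -> U x].
Proof.
move=> /topologized_nbhsP[ O [oO O0 OU]] M0.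
have [[_ tr _ _] _] := hgamma.
have hB : norm_bounded nrm [set x | nrm x <= M] by exists M.
have : trace_topology gamma [set x | nrm x <= M] (O `&` [set x | nrm x <= M]).
  by exists O.
rewrite (tr _ hB) => -[W tW /seteqP[WO OW]].
move: tW; rewrite (saks_generates hsaks) seminorm_topologyE => tW.
have [|W0 _] := OW 0; first by split=> //=; rewrite (seminorm0 sn).
have [Q0 [e [f0 s0 e0 QW]]] := tW _ W0.
exists Q0, e; split=> // x Qx xM; apply: OU.
have [] // : (O `&` [set x | nrm x <= M]) x.
by apply: WO; split=> //; apply: QW => q Qq /=; rewrite subr0 Qx.
Qed.

Lemma mixed_nbhs0_seminorm q e : Gamma_tau q -> 0 < e ->
  nbhs (0 : topologized gamma) [set x | q x < e].
Proof.
move=> Gq e0; apply: (coarser_nbhs mixed_finer).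
apply/topologized_nbhsP; exists [set x | q x < e]; split=> //.
  rewrite (saks_generates hsaks).
  rewrite (_ : [set x | _] = [set x | forall r, [set q] r -> r (x - 0) < e]).
    by apply: (seminorm_ball_open saks_seminorm); [exact: finite_set1|move=> _ ->].
  apply/seteqP; split=> x /=; first by move=> qx _ ->; rewrite subr0.
  by move=> /(_ q erefl); rewrite subr0.
by rewrite /= (seminorm0 (saks_seminorm Gq)).
Qed.

(* Adding [p] to the seminorms generating [tau] does not change the topology on
   norm-bounded sets, so this topology is a candidate and [gamma] is finer. *)
Lemma continuous_seminorm_of_bounded_sets (p : X -> K) (C : K) :
  is_seminorm p -> 0 <= C -> (forall x, p x <= C * nrm x) ->
  (forall M e, 0 <= M -> 0 < e -> exists2 U, nbhs (0 : topologized gamma) U &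
     forall x, U x -> nrm x <= M -> p x < e) ->
  continuous_seminorm gamma p.
Proof.
move=> sp C0 pC hp; split=> //.
pose Q2 := Gamma_tau `|` [set p].
have Q2s q : Q2 q -> is_seminorm q by move=> [/saks_seminorm//|->].
have C1 : 0 < C + 1 by rewrite ltr_wpDl.
have Q2C q x : Q2 q -> q x <= (C + 1) * nrm x.
  have n0 := seminorm_ge0 sn x.
  move=> [/(saks_le_nrm x) qx|->]; rewrite mulrDl mul1r.
    by rewrite (le_trans qx)// lerDr mulr_ge0.
  by rewrite (le_trans (pC x))// lerDl.
suff cand : mixed_candidate nrm tau (seminorm_topology Q2).
  have [_ /(_ _ cand) t2g] := hgamma; apply: (coarser_nbhs t2g).
  have := @seminorm_ball_nbhs K X Q2 Q2s p 0 1 (or_intror erefl) ltr01.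
  by congr (nbhs _ _); apply/seteqP; split=> x /=; rewrite subr0.
split.
- exact: linear_seminorm_topology.
- move=> B [M BM]; apply/seteqP; split; last first.
    move=> _ [U oU <-]; exists U => //; move: oU; rewrite (saks_generates hsaks).
    by apply: seminorm_topology_subset; exact: subsetUl.
  move=> _ [U + <-]; rewrite seminorm_topologyE => oU.
  (* The union of all [tau]-open sets whose trace on [B] lies in [U]; it remains to catch each point
     of [U] in [B] by one of them. *)
  pose I := {O : set X | opens tau O /\ O `&` B `<=` U}.
  exists (\bigcup_(i : I) sval i).
    by apply: opens_bigcup; case=> W [].
  apply/seteqP; split=> [x [[[ O [tO OU]] _ /= Ox] Bx]|x [Ux Bx]].
    by split=> //; exact: OU.
  split=> //.
  have [Q0 [e [f0 s0 e0 QU]]] := oU _ Ux.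
  (* Two points of [B] differ by a vector of norm at most [M + M], so the smallness of [p] is needed
     on that ball. *)
  have M0 : 0 <= M + M.
    by rewrite addr_ge0// (le_trans _ (BM _ Bx))// (seminorm_ge0 sn).
  have [V V0 pV] := hp _ _ M0 e0.
  have [Q1 [e1 [f1 s1 e10 QV]]] := mixed_nbhs0 V0 M0.
  pose O := [set y | forall q, (Q0 `&` Gamma_tau) q -> q (y - x) < e] `&`
            [set y | forall q, Q1 q -> q (y - x) < e1].
  have tO : opens tau O.
    rewrite (saks_generates hsaks); apply: opens_setI.
    - apply: (seminorm_ball_open saks_seminorm); last by move=> q [].
      exact: finite_setIl.
    - exact: (seminorm_ball_open saks_seminorm).
  have OU : O `&` B `<=` U.
    move=> y [[y0 y1] By]; apply: QU => q Qq /=.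
    have [Gq|->] := s0 _ Qq; first exact: y0.
    apply: pV; last by rewrite (le_trans (seminormB sn _ _))// lerD ?BM.
    by apply: QV => //; rewrite (le_trans (seminormB sn _ _))// lerD ?BM.
  exists (exist _ O (conj tO OU)) => //=.
  by split=> q /=; [move=> [_ /saks_seminorm sq]|move=> /s1 /saks_seminorm sq];
    rewrite subrr (seminorm0 sq).
- rewrite /coarser (saks_generates hsaks).
  by apply: seminorm_topology_subset; exact: subsetUl.
- move=> U oU; rewrite seminorm_topologyE => x Ux.
  have [Q0 [e [f0 s0 e0 QU]]] := oU _ Ux.
  exists [set nrm], (e / (C + 1)); split=> //; first by rewrite divr_gt0.
  move=> y /= /(_ _ erefl) yx; apply: QU => q Qq /=.
  by apply: le_lt_trans (Q2C _ _ (s0 _ Qq)) _; rewrite mulrC -ltr_pdivlMr.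
Qed.

Section weighted.
Variables (q : nat -> X -> K) (a : nat -> K).
Hypothesis qa : null_weights Gamma_tau q a.

Lemma weighted_bounded : exists2 A, 0 < A & forall n x, q n x * a n <= A * nrm x.
Proof.
have [Gq a0 ac] := qa; have [A A0 aA] := null_sequence_bounded a0 ac.
exists A => // n x; rewrite mulrC ler_pM ?saks_le_nrm//.
exact: (seminorm_ge0 (saks_seminorm (Gq n))).
Qed.

Let qa_ge0 n x : 0 <= q n x * a n.
Proof.
have [Gq a0 _] := qa.
by rewrite mulr_ge0// (seminorm_ge0 (saks_seminorm (Gq n))).
Qed.

Let im_ge0 x y : [set q n x * a n | n in setT] y -> 0 <= y.
Proof. by move=> [n _ <-]. Qed.

Lemma le_weighted_sup n x : q n x * a n <= weighted_sup q a x.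
Proof.
have [A A0 qA] := weighted_bounded.
apply: (@le_supremum _ hK _ (A * nrm x)); last by exists n.
  exact: im_ge0.
by move=> _ [m _ <-].
Qed.

Lemma weighted_sup_le x c : 0 <= c -> (forall n, q n x * a n <= c) ->
  weighted_sup q a x <= c.
Proof.
move=> c0 h; apply: supremum_le => //; first exact: im_ge0.
by move=> _ [m _ <-].
Qed.

Lemma weighted_sup_seminorm : is_seminorm (weighted_sup q a).
Proof.
have [Gq a0 ac] := qa; have sq n := saks_seminorm (Gq n).
have w0 x : 0 <= weighted_sup q a x by apply: supremum_ge0 => //; exact: im_ge0.
have wZ c x : weighted_sup q a (c *: x) <= `|c| * weighted_sup q a x.
  apply: weighted_sup_le => [|n]; first by rewrite mulr_ge0.
  by rewrite (seminormZ (sq n)) -mulrA ler_wpM2l// le_weighted_sup.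
split=> // [x y|c x].
  apply: weighted_sup_le => [|n]; first by rewrite addr_ge0.
  rewrite (le_trans (ler_wpM2r (a0 n) (seminormD (sq n) _ _)))// mulrDl.
  by rewrite lerD// le_weighted_sup.
apply: le_anti; rewrite wZ/=.
have [->|c0] := eqVneq c 0; first by rewrite normr0 mul0r w0.
have := wZ c^-1 (c *: x); rewrite scalerA mulVf// scale1r normfV.
by rewrite ler_pdivlMl// normr_gt0.
Qed.

(** On a norm-bounded set the terms with large index are small because [a] is a null-sequence and
    [q n] is below the norm; the finitely many remaining terms are small on a [tau]-neighbourhood of
    0. *)
Lemma weighted_sup_continuous : continuous_seminorm gamma (weighted_sup q a).
Proof.
have [Gq a0 ac] := qa; have sq n := saks_seminorm (Gq n).
have [A A0 qA] := weighted_bounded.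
apply: (@continuous_seminorm_of_bounded_sets _ A).
- exact: weighted_sup_seminorm.
- exact: ltW.
- move=> x; apply: weighted_sup_le => //; rewrite mulr_ge0 ?(seminorm_ge0 sn)//.
  exact: ltW.
move=> M e M0 e0; have e2 : 0 < e / 2 by rewrite divr_gt0.
have M1 : 0 < M + 1 by rewrite ltr_wpDl.
have [B B0 aB] := null_sequence_bounded a0 ac.
have /cvg0P /(_ (e / 2 / (M + 1)))[|N aN] := ac; first by rewrite divr_gt0.
exists [set x | forall i, (i < N)%N -> q i x < e / 2 / B].
  by apply: filter_forall_ltn => i; apply: mixed_nbhs0_seminorm; rewrite ?divr_gt0.
move=> x Ux xM; apply: (@le_lt_trans _ _ (e / 2)); last first.
  by rewrite [X in _ < X](splitr e) ltrDl.
apply: weighted_sup_le => [|n]; first exact: ltW.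
have [Nn|nN] := leqP N n.
  rewrite (@le_trans _ _ ((M + 1) * (e / 2 / (M + 1))))//; last first.
    by rewrite mulrC divfK// gt_eqF.
  rewrite ler_pM// ?(seminorm_ge0 (sq n))//.
    by rewrite (le_trans (saks_le_nrm x (Gq n)))// (le_trans xM)// lerDl.
  by rewrite -[a n]ger0_norm// ltW// aN.
rewrite (@le_trans _ _ (e / 2 / B * B))//; last by rewrite divfK// gt_eqF.
by rewrite ler_pM// ?(seminorm_ge0 (sq n))// ltW// Ux.
Qed.

End weighted.

Lemma mixed_closed_ball_at (p : X -> K) (x0 : X) (c : K) :
  continuous_seminorm gamma p -> c \is Num.real ->
  closed ([set x | p (x - x0) <= c] : set (topologized gamma)).
Proof.
move=> [sp p1] cr; rewrite -openC openE => x /= /negP.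
rewrite -real_ltNge ?(seminorm_real sp)// => cx.
have xc : 0 < p (x - x0) - c by rewrite subr_gt0.
have := linear_topology_seminorm_ball mixed_linear x sp p1 xc.
apply: filterS => z /= zx; apply/negP; rewrite -real_ltNge ?(seminorm_real sp)//.
rewrite ltrBrDl -ltrBrDr in zx; apply: lt_le_trans zx _.
rewrite lerBlDr [X in _ <= X]addrC (seminorm_distr sp z x).
have -> : x - x0 = (x - z) + (z - x0) by rewrite addrA subrK.
exact: seminormD.
Qed.

Lemma mixed_closed_ball (p : X -> K) (c : K) : continuous_seminorm gamma p ->
  c \is Num.real -> closed ([set x | p x <= c] : set (topologized gamma)).
Proof.
move=> cp cr; have := mixed_closed_ball_at (x0 := 0) cp cr.
by under eq_set do rewrite subr0.
Qed.

Lemma saks_continuous_seminorm q : Gamma_tau q -> continuous_seminorm gamma q.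
Proof.
by move=> Gq; split; [exact: saks_seminorm|exact: mixed_nbhs0_seminorm].
Qed.

Lemma norm_ball_closed (c : K) : c \is Num.real ->
  closed ([set x | nrm x <= c] : set (topologized gamma)).
Proof.
move=> cr; rewrite (_ : [set x | _] = \bigcap_(q in Gamma_tau) [set x | q x <= c]).
  apply: closed_bigI => q Gq; apply: mixed_closed_ball => //.
  exact: saks_continuous_seminorm.
apply/seteqP; split=> x /= h; last exact: saks_nrm_le.
by move=> q Gq /=; rewrite (le_trans (saks_le_nrm x Gq)).
Qed.

Hypothesis hmontel : semi_montel (topologized gamma).

(** The ball is bounded for the norm topology, hence for the coarser [gamma], and it is
    [gamma]-closed because the norm is a supremum of continuous seminorms. *)
Lemma norm_ball_compact (c : K) : c \is Num.real ->
  compact ([set x | nrm x <= c] : set (topologized gamma)).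
Proof.
move=> cr; rewrite ((@closure_id (topologized gamma) [set x | nrm x <= c]).1 _);
  last exact: norm_ball_closed.
apply: hmontel => U /(coarser_nbhs mixed_coarser_norm).
have sQ q : [set nrm] q -> is_seminorm q by move=> ->.
move=> /(seminorm_nbhsP sQ)[Q0 [e [f0 s0 e0 QU]]].
have r0 : 0 < (`|c| + 1) / e by rewrite divr_gt0// ltr_wpDl.
exists ((`|c| + 1) / e) => // x /= xc.
exists (((`|c| + 1) / e)^-1 *: x); last by rewrite scalerA mulfV ?scale1r// gt_eqF.
apply: QU => q /s0 -> /=; rewrite subr0 (seminormZ sn) gtr0_norm ?invr_gt0//.
rewrite ltr_pdivrMl// divfK ?gt_eqF//.
by rewrite (le_lt_trans xc)// (le_lt_trans (real_ler_norm cr))// ltrDl.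
Qed.

(* Banach-Dieudonne type argument: once finitely many constraints cut the ball
   of radius [n + 1] down to a subset of [U], compactness of the ball of radius
   [n + 2] yields finitely many seminorms [q] such that the constraints
   [q <= n + 1] do the same for it. *)
Lemma mixed_nbhs0_weighted (U : set X) : nbhs (0 : topologized gamma) U ->
  exists q a, null_weights Gamma_tau q a /\
    forall x, (forall n, q n x * a n <= 1) -> U x.
Proof.
move=> /topologized_nbhsP[W [gW W0 WU]].
have nS (n : nat) : (n.+1%:R : K) \is Num.real by exact: realn.
pose ball n := [set x | nrm x <= n.+1%:R] : set (topologized gamma).
pose cut (l : seq (X -> K)) (b : K) :=
  [set x | forall q, q \in l -> q x <= b] : set (topologized gamma).
have cutC l b : (forall q, q \in l -> Gamma_tau q) -> b \is Num.real -> closed (cut l b).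
  move=> lG br; rewrite (_ : cut l b = \bigcap_(q in [set` l]) [set x | q x <= b]).
    apply: closed_bigI => q /lG Gq; apply: mixed_closed_ball => //.
    exact: saks_continuous_seminorm.
  by apply/seteqP; split.
have [l0 [d [l0G d0 l0W]]] : exists l d, [/\ forall q, q \in l -> Gamma_tau q,
    0 < d & ball 0%N `&` cut l d `<=` W].
  have W0n : nbhs (0 : topologized gamma) W.
    by apply/topologized_nbhsP; exists W; split.
  have [Q0 [e [/finite_seqP[l ->] s0 e0 QW]]] := mixed_nbhs0 W0n ler01.
  exists l, (e / 2); split=> //; first by rewrite divr_gt0.
  move=> x [xB xl]; apply: QW => // q /xl; move/le_lt_trans; apply.
  by rewrite [X in _ < X](splitr e) ltrDl divr_gt0.
(* The hypotheses on the pair sit inside the conclusion, so that [choice] yields a function on all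
   pairs and the recursion [C] can be written without proofs. *)
have step (nC : nat * set (topologized gamma)) : exists l : seq (X -> K),
    (forall q, q \in l -> Gamma_tau q) /\
    (closed nC.2 -> ball nC.1 `&` nC.2 `<=` W ->
     ball nC.1.+1 `&` (nC.2 `&` cut l nC.1.+1%:R) `<=` W).
  case: nC => n C /=.
  have [cC|] := pselect (closed C); last by exists [::].
  have [CW|] := pselect (ball n `&` C `<=` W); last by exists [::].
  (* Otherwise compactness gives a point of [ball n.+1] in [C], outside [W], at which every [q] is
     at most [n + 1]. Its norm is then at most [n + 1], the radius of [ball n], so it lies in
     [W]. *)
  apply: contrapT => /forallNP nl.
  have cA : compact (ball n.+1 `&` (C `&` ~` W)).
    apply: compact_closedI; first exact: norm_ball_compact.
    by apply: closedI => //; rewrite closedC.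
  have [| |x [xB [Cx nWx]] xq] := @compact_fip (topologized gamma) _ _ Gamma_tau
      (fun q => [set x | q x <= n.+1%:R]) cA.
  - move=> q Gq; apply: mixed_closed_ball => //; exact: saks_continuous_seminorm.
  - move=> l lG; have /not_andP[//|/not_implyP[_ /not_implyP[_ /existsNP[x]]]] := nl l.
    move=> /not_implyP[[xB [Cx xl]] nWx].
    by exists x.
  - by apply: nWx; apply: CW; split=> //; exact: saks_nrm_le.
have [f hf] := choice step.
pose fix C n := if n is m.+1 then C m `&` cut (f (m, C m)) m.+1%:R else cut l0 d.
pose L n := if n is m.+1 then f (m, C m) else l0.
(* With these weights [q x * alpha n <= 1] is the constraint added at level [n]. *)
pose alpha n : K := if n is m.+1 then m.+1%:R^-1 else d^-1.
have LG i q : q \in L i -> Gamma_tau q.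
  by case: i => [|i] /=; [exact: l0G|have [+ _] := hf (i, C i); exact].
have CC n : closed (C n).
  elim: n => [|n IH] /=; first by apply: cutC => //; exact: gtr0_real.
  by apply: closedI => //; apply: cutC => //; exact: (LG n.+1).
have CW n : ball n `&` C n `<=` W.
  elim: n => [|n IH] /=; first exact: l0W.
  by have [_ +] := hf (n, C n); apply => //; exact: CC.
have [q0 Gq0] : Gamma_tau !=set0 by have [] := saks_directed hsaks.
have al0 i : 0 <= alpha i by case: i => [|i] /=; rewrite invr_ge0// ltW.
have alc : alpha @ \oo --> (0 : K^o).
  apply/cvg0P => e e0; have [N hN] := natSr_inv_cvg0 hK e0.
  exists N.+1 => -[//|n]; rewrite ltnS => Nn.
  by rewrite ger0_norm// hN.
have [q [a [Gq a0 ac qaL]]] := null_sequence_of_blocks Gq0 LG al0 alc.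
exists q, a; split=> // x qx; apply: WU.
have xC n : C n x.
  elim: n => [|n IH] /=; [|split=> //]; move=> r rL.
    have [m [qm am]] := qaL 0%N r rL; have := qx m.
    by rewrite qm am /= ler_pdivrMr// mul1r.
  have [m [qm am]] := qaL n.+1 r rL; have := qx m.
  by rewrite qm am /= ler_pdivrMr// mul1r.
have [n /ltW xn] := archimedean_scalars hK (seminorm_real sn x).
exact: (CW n).
Qed.

Lemma mixed_nbhs0_continuous_seminorm (U : set X) :
  nbhs (0 : topologized gamma) U -> exists p,
    continuous_seminorm gamma p /\ forall x, p x <= 1 -> U x.
Proof.
move=> /mixed_nbhs0_weighted[q [a [qa qU]]]; exists (weighted_sup q a).
split; first exact: weighted_sup_continuous.
by move=> x x1; apply: qU => n; apply: le_trans x1; exact: le_weighted_sup.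
Qed.

(** Otherwise there are points [x_n] of [A] and [q_n] in [Gamma_tau] with [q_n x_n > (n + 1)^2].
    With the weights [1 / (n + 1)] the weighted supremum still exceeds [n + 1] at [x_n], although a
    continuous seminorm is bounded on a compact set. *)
Lemma mixed_compact_bounded (A : set (topologized gamma)) : compact A ->
  exists2 M, 0 <= M & forall x, A x -> nrm x <= M.
Proof.
move=> cA.
have bounded (p : X -> K) : continuous_seminorm gamma p ->
    exists n : nat, forall x, A x -> p x <= n%:R.
  move=> cp; have [sp p1] := cp.
  have [| | |n AO] := @compact_bounded_exhaustion (topologized gamma) A
    (fun n => [set x | p x < n.+1%:R]) cA.
  - move=> n; rewrite openE => x /= xn.
    have xn0 : 0 < n.+1%:R - p x by rewrite subr_gt0.
    have := linear_topology_seminorm_ball mixed_linear x sp p1 xn0.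
    apply: filterS => z /= zx; rewrite ltrBrDr in zx; apply: le_lt_trans zx.
    by rewrite -{1}(subrK x z) seminormD.
  - by move=> n x /= /lt_trans; apply; rewrite ltr_nat.
  - move=> x _; have [n xn] := archimedean_scalars hK (seminorm_real sp x).
    by exists n.
  - by exists n.+1 => x /AO /ltW.
apply: contrapT => nb.
have : forall n : nat, exists xq : X * (X -> K), [/\ A xq.1, Gamma_tau xq.2 &
    (n.+1%:R * n.+1%:R) < xq.2 xq.1].
  move=> n; apply: contrapT => /forallNP nx; apply: nb.
  exists (n.+1%:R * n.+1%:R) => // x Ax; apply: saks_nrm_le => q Gq.
  have := nx (x, q); rewrite /= => hx.
  rewrite real_leNgt ?(seminorm_real (saks_seminorm Gq)) -?natrM ?realn//.
  by apply/negP => xq; apply: hx; rewrite -natrM.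
move=> /choice[f hf].
pose a n : K := n.+1%:R^-1.
have qa : null_weights Gamma_tau (fun n => (f n).2) a.
  split=> [n|n|]; first by have [] := hf n.
  - by rewrite invr_ge0.
  - apply/cvg0P => e e0; have [N hN] := natSr_inv_cvg0 hK e0.
    by exists N => n Nn; rewrite ger0_norm ?invr_ge0// hN.
have [n /(_ (f n).1)] := bounded _ (weighted_sup_continuous qa).
have [Af _ fn] := hf n => /(_ Af) h.
have := le_trans (le_weighted_sup qa n (f n).1) h.
have [_ Gf _] := hf n.
rewrite /a ler_pdivrMr// -natrM real_leNgt ?realn ?(seminorm_real (saks_seminorm Gf))//.
by move/negP; apply; apply: le_lt_trans fn; rewrite natrM ler_wpM2r// ler_nat.
Qed.

End mixed_topology.

(** * Banach spaces normed by evaluations *)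

Section linear_operations.
Variables (K : numFieldType) (Y E : lmodType K) (f : Y -> E).
Hypothesis lf : linear f.

Lemma linear_fun0 : f 0 = 0.
Proof. by have := lf (-1) 0 0; rewrite !scaleN1r !addNr. Qed.

Lemma linear_funD x y : f (x + y) = f x + f y.
Proof. by have := lf 1 x y; rewrite !scale1r. Qed.

Lemma linear_funZ a x : f (a *: x) = a *: f x.
Proof. by have := lf a x 0; rewrite !addr0 linear_fun0 addr0. Qed.

Lemma linear_funB x y : f (x - y) = f x - f y.
Proof. by rewrite linear_funD -scaleN1r linear_funZ scaleN1r. Qed.

Lemma linear_fun_sum n (a : 'I_n -> K) (y : 'I_n -> Y) :
  f (\sum_i a i *: y i) = \sum_i a i *: f (y i).
Proof.
elim/big_rec2 : _ => [|i z1 z2 _ <-]; first exact: linear_fun0.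
by rewrite linear_funD linear_funZ.
Qed.

End linear_operations.

Lemma linear_norm_seminorm (K : numFieldType) (Y : lmodType K)
    (E : normedModType K) (f : Y -> E) : linear f -> is_seminorm (fun y => `|f y|).
Proof.
move=> lf; split=> [//|x y|a x]; first by rewrite (linear_funD lf) ler_normD.
by rewrite (linear_funZ lf) normrZ.
Qed.

Section real_scalars.
Variable K : numFieldType.

Lemma eq0_of_le_eps (x C : K) : 0 <= x -> 0 <= C ->
  (forall e, 0 < e -> x <= e * C) -> x = 0.
Proof.
move=> x0 C0 h; apply: le_anti; rewrite x0 andbT.
apply/ler_addgt0Pr => e e0; rewrite add0r.
have C1 : 0 < C + 1 by rewrite ltr_wpDl.
apply: le_trans (h (e / (C + 1)) _) _; first by rewrite divr_gt0.
rewrite -mulrA; apply: ler_piMr; first exact: ltW.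
by rewrite mulrC ler_pdivrMr// mul1r lerDl.
Qed.

Lemma linear_functionalZ (Y : lmodType K) (f : Y -> K^o) : linear f ->
  forall a x, f (a *: x) = a * f x.
Proof. by move=> lf a x; rewrite (linear_funZ lf). Qed.

Lemma linear_functional_sum (Y : lmodType K) (f : Y -> K^o) n (x : 'I_n -> Y) :
  linear f -> f (\sum_i x i) = \sum_i f (x i).
Proof.
move=> lf; elim/big_ind2 : _ => //; first exact: linear_fun0.
by move=> a b c d; rewrite linear_funD// => -> ->.
Qed.

End real_scalars.

(* A norm given as a weighted supremum of evaluations; such a space is complete
   as soon as it is closed under uniform limits. *)
Record evaluation_norm (K : numFieldType) (Y : lmodType K) (I : Type)
    (ev : I -> Y -> K^o) (w : I -> K) (n : Y -> K) : Prop := EvaluationNorm {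
  evaluation_linear : forall i, linear (ev i) ;
  evaluation_weight : forall i, 0 <= w i ;
  evaluation_ge0 : forall y, 0 <= n y ;
  evaluation_le : forall y c, 0 <= c ->
    (n y <= c <-> forall i, `|ev i y| <= c * w i) ;
  evaluation_separated : forall y, (forall i, ev i y = 0) -> y = 0 ;
  evaluation_closed : forall g : I -> K,
    (forall e, 0 < e -> exists y, forall i, `|g i - ev i y| <= e * w i) ->
    exists y, forall i, ev i y = g i }.

Section evaluation_norm_theory.
Variables (K : numFieldType) (Y : lmodType K) (I : Type).
Variables (ev : I -> Y -> K^o) (w : I -> K) (n : Y -> K).
Hypothesis h : evaluation_norm ev w n.

Lemma evaluation_bound i y : `|ev i y| <= n y * w i.
Proof. by have [+ _] := evaluation_le h y (evaluation_ge0 h y); apply. Qed.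

Lemma evaluation_norm_le y c : 0 <= c -> (forall i, `|ev i y| <= c * w i) ->
  n y <= c.
Proof. by move=> c0; have [_] := evaluation_le h y c0. Qed.

Lemma evaluation_normD x y : n (x + y) <= n x + n y.
Proof.
apply: evaluation_norm_le => [|i]; first by rewrite addr_ge0 ?(evaluation_ge0 h).
rewrite (linear_funD (evaluation_linear h i)) mulrDl.
by rewrite (le_trans (ler_normD _ _))// lerD// evaluation_bound.
Qed.

Lemma evaluation_normZ a x : n (a *: x) = `|a| * n x.
Proof.
have le b y : n (b *: y) <= `|b| * n y.
  apply: evaluation_norm_le => [|i]; first by rewrite mulr_ge0 ?(evaluation_ge0 h).
  rewrite (linear_functionalZ (evaluation_linear h i)) normrM -mulrA ler_wpM2l//.
  exact: evaluation_bound.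
apply: le_anti; rewrite le/=.
have [->|a0] := eqVneq a 0; first by rewrite normr0 mul0r (evaluation_ge0 h).
have := le a^-1 (a *: x); rewrite scalerA mulVf// scale1r normfV.
by rewrite ler_pdivlMl// normr_gt0.
Qed.

Lemma evaluation_norm_eq0 x : n x = 0 -> x = 0.
Proof.
move=> x0; apply: (evaluation_separated h) => i; apply/eqP.
by rewrite -normr_le0 (le_trans (evaluation_bound i x))// x0 mul0r.
Qed.

Lemma evaluation_is_norm : is_norm n.
Proof.
split; last exact: evaluation_norm_eq0.
by split; [exact: (evaluation_ge0 h)|exact: evaluation_normD|exact: evaluation_normZ].
Qed.

End evaluation_norm_theory.

(** A copy of [Y] indexed by the proof [h], to which the norm and its completeness can be attached
    as instances. *)
Definition evaluation_space (K : numFieldType) (hK : real_or_complex K)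
  (Y : lmodType K) (I : Type) (ev : I -> Y -> K^o) (w : I -> K) (n : Y -> K)
  (h : evaluation_norm ev w n) : Type := Y.

Section evaluation_space.
Variables (K : numFieldType) (hK : real_or_complex K).
Variables (Y : lmodType K) (I : Type).
Variables (ev : I -> Y -> K^o) (w : I -> K) (n : Y -> K).
Hypothesis h : evaluation_norm ev w n.
Local Notation E := (evaluation_space hK h).

HB.instance Definition _ := GRing.Lmodule.on E.
HB.instance Definition _ := @Lmodule_isNormed.Build K E n
  (evaluation_normD h) (evaluation_normZ h) (@evaluation_norm_eq0 _ _ _ _ _ _ h).

Lemma evaluation_space_normE (y : E) : `|y| = n y.
Proof. by []. Qed.

Lemma evaluation_space_complete (F : set_system E) : ProperFilter F ->
  cauchy F -> cvg F.
Proof.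
move=> FF /cauchyP Fc.
have Fb (e : K) : 0 < e -> exists x : Y, F [set y : E | n (x - y) < e].
  move=> /Fc[x Fx]; exists x; move: Fx; rewrite -ball_normE.
  exact.
have evB i x y : `|ev i x - ev i y| <= n (x - y) * w i.
  by rewrite -(linear_funB (evaluation_linear h i)) evaluation_bound.
have w1 i : 0 < w i + 1 by rewrite ltr_wpDl// (evaluation_weight h).
have lim i : exists l : K, forall e, 0 < e -> F [set y : E | `|ev i y - l| <= e].
  have FiF : ProperFilter ((ev i : E -> K^o) @ F) by exact: fmap_proper_filter.
  have [|l Fl] := @scalar_cauchy_cvg K ((ev i : E -> K^o) @ F) hK FiF.
    move=> e e0; have [|x Fx] := Fb (e / (w i + 1)); first by rewrite divr_gt0.
    exists (ev i x).
    suff : F [set y : E | `|ev i y - ev i x| <= e] by [].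
    apply: filterS Fx => y /= xy; rewrite distrC.
    apply: le_trans (evB _ _ _) _.
    rewrite (@le_trans _ _ (e / (w i + 1) * (w i + 1)))//.
      by rewrite ler_pM ?(evaluation_ge0 h) ?(evaluation_weight h)// ?lerDl// ltW.
    by rewrite divfK// gt_eqF.
  by exists l.
have [g hg] := choice lim.
(* The Cauchy estimate passes to the pointwise limit [g] with its weights, which is what
   [evaluation_closed] asks for. *)
have near e x : 0 < e -> F [set y : E | n (x - y) < e] ->
    forall i, `|g i - ev i x| <= e * w i.
  move=> e0 Fx i; apply/ler_addgt0Pr => d d0.
  have [y [/= xy yg]] := filter_ex (filterI Fx (hg i d d0)).
  rewrite -(subrK (ev i y) (g i)) -addrA addrC (le_trans (ler_normD _ _))//.
  rewrite lerD//; last by rewrite distrC.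
  rewrite distrC; apply: le_trans (evB _ _ _) _.
  by rewrite ler_wpM2r ?(evaluation_weight h)// ltW.
have [e e0|y0 hy0] := evaluation_closed h (g := g).
  by have [x Fx] := Fb _ e0; exists x; exact: near.
apply/cvg_ex; exists y0; apply/cvg_ballP => e e0.
have e2 : 0 < e / 2 by rewrite divr_gt0.
have [x Fx] := Fb _ e2.
rewrite near_simpl; apply: filterS (Fx) => y /= xy.
rewrite -ball_normE /= evaluation_space_normE.
have -> : y0 - y = (y0 - x) + (x - y) by rewrite addrA subrK.
rewrite (le_lt_trans (evaluation_normD h _ _))// (splitr e) ler_ltD//.
apply: (evaluation_norm_le h) => [|i]; first exact: ltW.
rewrite (linear_funB (evaluation_linear h i)) hy0.
exact: (near _ _ e2 Fx).
Qed.

HB.instance Definition _ := Uniform_isComplete.Build E evaluation_space_complete.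

Definition evaluation_banach : completeNormedModType K := E.

End evaluation_space.

(** * The dual of a mixed topology *)

Lemma seminorm_le_of_unit_ball (K : numFieldType) (X : lmodType K) (s p : X -> K) :
  is_seminorm s -> is_seminorm p -> (forall x, p x < 1 -> s x <= 1) ->
  forall x, s x <= p x.
Proof.
move=> ss sp h x; apply/ler_addgt0Pr => e e0.
have c0 : 0 < p x + e by rewrite ltr_wpDl// (seminorm_ge0 sp).
have := h ((p x + e)^-1 *: x); rewrite (seminormZ ss) (seminormZ sp).
rewrite gtr0_norm ?invr_gt0// ltr_pdivrMl// ler_pdivrMl// mulr1; apply.
by rewrite ltrDl.
Qed.

Lemma scaled_seminorm (K : numFieldType) (X : lmodType K) (p : X -> K) (c : K) :
  0 <= c -> is_seminorm p -> is_seminorm (fun x => c * p x).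
Proof.
move=> c0 sp; split=> [x|x y|a x]; first by rewrite mulr_ge0 ?(seminorm_ge0 sp).
  by rewrite -mulrDr ler_wpM2l ?(seminormD sp).
by rewrite (seminormZ sp) mulrCA.
Qed.

Lemma seminorm_le_of_ball (K : numFieldType) (X : lmodType K) (s p : X -> K) (e : K) :
  is_seminorm s -> is_seminorm p -> 0 < e -> (forall x, p x < e -> s x <= 1) ->
  forall x, s x <= 2 / e * p x.
Proof.
move=> ss sp e0 h; have c0 : 0 < 2 / e by rewrite divr_gt0.
apply: (seminorm_le_of_unit_ball ss (scaled_seminorm (ltW c0) sp)) => x x1.
apply: h; rewrite (@lt_trans _ _ (e / 2))//; last first.
  by rewrite [X in _ < X](splitr e) ltrDl divr_gt0.
by rewrite -[e / 2]mulr1 -ltr_pdivrMl ?divr_gt0// invf_div.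
Qed.

Section continuous_linear_theory.
Variables (K : numFieldType) (Y : preTopologicalLmodType K).

Lemma continuous_linear_linear (E : topologicalLmodType K)
  (u : continuous_linear Y E) : linear u.
Proof. by have := cl_funP u; rewrite unfold_in => /asboolP[]. Qed.

Lemma continuous_linear_continuous (E : topologicalLmodType K)
  (u : continuous_linear Y E) : continuous u.
Proof. by have := cl_funP u; rewrite unfold_in => /asboolP[]. Qed.

Lemma continuous_linear_eq (E : topologicalLmodType K)
  (u v : continuous_linear Y E) : (forall x, u x = v x) -> u = v.
Proof. by move=> uv; apply: val_inj; apply/funext. Qed.

Lemma continuous_linear_opE (E : topologicalLmodType K)
  (a : K) (u v : continuous_linear Y E) x : (a *: u + v) x = a *: u x + v x.
Proof. by []. Qed.

Lemma continuous_linear_nbhs0 (E : normedModType K)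
    (u : continuous_linear Y E) : nbhs (0 : Y) [set x | `|u x| < 1].
Proof.
have u0 : u 0 = 0.
  by have := continuous_linear_linear u (-1) 0 0; rewrite !scaleN1r !addNr.
have := @continuous_linear_continuous E u 0 (ball (0 : E) 1).
rewrite u0 => /(_ (nbhsx_ballx _ _ ltr01)).
suff -> : [set x | `|u x| < 1] = u @^-1` ball (0 : E) 1 by [].
by apply/seteqP; split=> x /=; rewrite -ball_normE /= sub0r normrN.
Qed.

Hypothesis lY : linear_topology Y.

Lemma continuous_linear_of_seminorm (E : normedModType K) (f : Y -> E)
    (p : Y -> K) : linear f -> is_seminorm p ->
  nbhs (0 : Y) [set x | p x < 1] -> (forall x, `|f x| <= p x) ->
  exists u : continuous_linear Y E, forall x, u x = f x.
Proof.
move=> lf sp p1 fp.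
have fP : f \in @continuous_linear_pred K Y E.
  rewrite unfold_in; apply/asboolP; split=> // x.
  apply/(@cvgrPdist_lt _ E) => e e0.
  have := linear_topology_seminorm_ball lY x sp p1 e0.
  apply: filterS => y /= yx; apply: le_lt_trans yx.
  rewrite -normrN opprB.
  have -> : f y - f x = f (y - x).
    by have := lf (-1) x y; rewrite !scaleN1r addrC => <-; rewrite addrC.
  exact: fp.
by exists (ContinuousLinear fP).
Qed.

End continuous_linear_theory.

Section mixed_dual.
Variables (K : numFieldType) (hK : real_or_complex K) (X : lmodType K).
Variables (nrm : X -> K) (tau : topology X) (Gamma_tau : set (X -> K)).
Hypothesis hsaks : saks_space nrm tau Gamma_tau.
Variables (gamma : topology X) (hgamma : is_mixed_topology nrm tau gamma).
Hypothesis hmontel : semi_montel (topologized gamma).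

Local Notation G := (topologized gamma).
Local Notation V := (topdual G).
Local Notation dn := (@dual_norm K X gamma nrm).
Let sn : is_seminorm nrm := saks_nrm_seminorm hsaks.

Lemma mixed_dual_le (v : V) : exists p, continuous_seminorm gamma p /\
  forall x, `|v x| <= p x.
Proof.
have [p [cp pv]] := mixed_nbhs0_continuous_seminorm hK hsaks hgamma hmontel
  (continuous_linear_nbhs0 v).
exists p; split=> // x.
apply: (@seminorm_le_of_unit_ball _ _ (fun x => `|v x|)).
- exact/linear_norm_seminorm/continuous_linear_linear.
- by case: cp.
- by move=> y /ltW /pv /ltW.
Qed.

Lemma mixed_dual_exists (f : X -> K^o) (p : X -> K) : linear f ->
  continuous_seminorm gamma p -> (forall x, `|f x| <= p x) ->
  exists v : V, forall x, v x = f x.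
Proof.
move=> lf [sp p1] fp.
exact: (@continuous_linear_of_seminorm _ _ (mixed_linear hgamma) _ f p).
Qed.

Lemma mixed_hahn_banach (p : X -> K) (x0 : X) : continuous_seminorm gamma p ->
  exists2 v : V, forall x, `|v x| <= p x & p x0 <= `|v x0|.
Proof.
move=> cp; have [sp p1] := cp.
have [| | | |f [lf fp _ f0]] := @hahn_banach _ hK _ _ sp [set 0] x0 (p x0) => //.
- by move=> a x y -> ->; rewrite scaler0 addr0.
- exact: seminorm_ge0.
- by move=> _ ->; rewrite addr0.
by have [v vf] := mixed_dual_exists lf cp fp; exists v => [x|]; rewrite vf.
Qed.

Lemma mixed_seminorm_bounded (p : X -> K) : continuous_seminorm gamma p ->
  exists2 C, 0 < C & forall x, p x <= C * nrm x.
Proof.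
move=> [sp /(coarser_nbhs (mixed_coarser_norm hgamma))].
have sQ q : [set nrm] q -> is_seminorm q by move=> ->.
move=> /(seminorm_nbhsP sQ)[Q0 [e [_ s0 e0 QU]]].
have C0 : 0 < 2 / e by rewrite divr_gt0.
exists (2 / e) => // x; apply: seminorm_le_of_ball => // y y1.
by apply/ltW/QU => q /s0 -> /=; rewrite subr0.
Qed.

Let dn_set (v : V) (y : K) :
  [set `|v x| | x in [set x : G | nrm x <= 1]] y -> 0 <= y.
Proof. by move=> [x _ <-]. Qed.

Lemma dual_norm_bound (v : V) x : `|v x| <= dn v * nrm x.
Proof.
have lv := continuous_linear_linear v.
(* Continuity for [gamma] implies boundedness on the unit ball, so the supremum in [dual_norm] is
   not the default value. *)
have [p [cp vp]] := mixed_dual_le v.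
have [C C0 pC] := mixed_seminorm_bounded cp.
have [x0|x0] := eqVneq (nrm x) 0.
  have [_ /(_ _ x0) ->] := saks_norm hsaks.
  by rewrite linear_fun0// normr0 (seminorm0 sn) mulr0.
have xp : 0 < nrm x by rewrite lt_def x0 (seminorm_ge0 sn).
rewrite -ler_pdivrMr// mulrC.
have -> : (nrm x)^-1 * `|v x| = `|v ((nrm x)^-1 *: x)|.
  by rewrite linear_functionalZ// normrM gtr0_norm// invr_gt0.
apply: (@le_supremum _ hK _ C); first exact: dn_set.
  move=> _ [y /= y1 <-]; rewrite (le_trans (vp y))// (le_trans (pC y))//.
  by rewrite ler_piMr// ltW.
exists ((nrm x)^-1 *: x) => //=; rewrite (seminormZ sn) gtr0_norm ?invr_gt0//.
by rewrite mulVf// gt_eqF.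
Qed.

Lemma dual_norm_le (v : V) c : 0 <= c -> (forall x, `|v x| <= c * nrm x) ->
  dn v <= c.
Proof.
move=> c0 h; apply: supremum_le => //; first exact: dn_set.
move=> _ [x /= x1 <-]; rewrite (le_trans (h x))//.
by rewrite ler_piMr.
Qed.

(** The substance is closedness, that is, completeness of V: a limit of functionals that is uniform
    on balls is [gamma]-continuous, because continuity may be tested on norm-bounded sets. *)
Lemma dual_evaluation_norm :
  evaluation_norm (fun (x : X) (v : V) => (v x : K^o)) nrm dn.
Proof.
have dn0 v : 0 <= dn v by apply: supremum_ge0 => //; exact: dn_set.
split.
- by [].
- exact: seminorm_ge0.
- by [].
- move=> v c c0; split=> [vc x|]; last exact: dual_norm_le.
  by rewrite (le_trans (dual_norm_bound v x))// ler_wpM2r// (seminorm_ge0 sn).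
- by move=> v v0; apply: continuous_linear_eq => x; rewrite v0.
move=> g hg.
have lg : linear (g : X -> K^o).
  move=> a x y; apply/eqP; rewrite -subr_eq0 -normr_eq0; apply/eqP.
  apply: (@eq0_of_le_eps _ _ (nrm (a *: x + y) + (`|a| * nrm x + nrm y))) => //.
    by rewrite !addr_ge0 ?mulr_ge0 ?(seminorm_ge0 sn).
  move=> e /hg[v vg]; have lv := continuous_linear_linear v.
  have -> : (g (a *: x + y) : K^o) - (a *: (g x : K^o) + g y) =
      (g (a *: x + y) - v (a *: x + y)) - (a * (g x - v x) + (g y - v y)).
    by rewrite lv /GRing.scale/=; ring.
  rewrite [X in _ <= X]mulrDr; apply: le_trans (ler_normB _ _) _.
  apply: lerD; first exact: vg.
  apply: le_trans (ler_normD _ _) _.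
  rewrite [X in _ <= X]mulrDr normrM [X in _ <= X + _]mulrCA.
  by apply: lerD; [apply: ler_wpM2l => //; exact: vg|exact: vg].
have sg := linear_norm_seminorm lg.
have [v vg] := hg 1 ltr01.
have C0 : 0 <= dn v + 1 by rewrite addr_ge0.
have cg : continuous_seminorm gamma (fun x => `|g x|).
  apply: (continuous_seminorm_of_bounded_sets hsaks hgamma sg C0).
    move=> x; rewrite -(subrK (v x) (g x)) addrC (le_trans (ler_normD _ _))//.
    by rewrite mulrDl; apply: lerD; [exact: dual_norm_bound|exact: vg].
  move=> M e M0 e0; have e2 : 0 < e / 2 by rewrite divr_gt0.
  have M1 : 0 < M + 1 by rewrite ltr_wpDl.
  have [|u ug] := hg (e / 2 / (M + 1)); first by rewrite divr_gt0.
  have [p [cp up]] := mixed_dual_le u.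
  have := linear_topology_seminorm_ball (mixed_linear hgamma) 0 cp.1 cp.2 e2.
  set U := (U in nbhs _ U) => U0; exists U => // x Ux xM.
  rewrite -(subrK (u x) (g x)) (le_lt_trans (ler_normD _ _))// (splitr e).
  rewrite ler_ltD//; last first.
    by apply: le_lt_trans (up x) _; move: Ux; rewrite /U/= subr0.
  apply: le_trans (ug x) _; rewrite -mulrA; apply: ler_piMr; first exact: ltW.
  by rewrite mulrC ler_pdivrMr// mul1r (le_trans xM)// lerDl.
by have [u ug] := mixed_dual_exists lg cg (fun x => lexx _); exists u.
Qed.

Definition dual_banach : completeNormedModType K :=
  evaluation_banach hK dual_evaluation_norm.

Lemma dual_norm_seminorm : is_seminorm dn.
Proof. by have [] := evaluation_is_norm dual_evaluation_norm. Qed.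

(** A solution for the other functionals also fits [v ord0] if this depends on them; if not, it is
    corrected along a [y] that they annihilate. *)
Lemma helly_interpolation (e' : V -> K^o) (n : nat) : linear e' ->
  forall v : 'I_n -> V, exists x : X, forall i, v i x = e' (v i).
Proof.
move=> le; elim: n => [|n IH] v; first by exists 0 => -[].
have [x0 hx0] := IH (fun i => v (lift ord0 i)).
have lv i : linear (v i) by exact: continuous_linear_linear.
have [h|/existsNP[y /not_implyP[ky vy]]] :=
    pselect (forall x, (forall i, v (lift ord0 i) x = 0) -> v ord0 x = 0).
  have [i| | |a va] := @linear_combination_of_functionals K X n
    (fun i => v (lift ord0 i)) (v ord0); [exact: lv|exact: lv|exact: h|].
  exists x0 => i; case: (unliftP ord0 i) => [j|] ->; first exact: hx0.
  have -> : v ord0 = \sum_i a i *: v (lift ord0 i).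
    apply: continuous_linear_eq => x; rewrite va.
    elim/big_rec2 : _ => // k y1 y2 _ ->.
    by rewrite continuous_linear_opE.
  rewrite linear_functional_sum//.
  transitivity (\sum_i a i * v (lift ord0 i) x0).
    elim/big_rec2 : _ => // k y1 y2 _ <-.
    by rewrite continuous_linear_opE.
  by apply: eq_bigr => j _; rewrite linear_functionalZ// hx0.
exists (x0 + ((e' (v ord0) - v ord0 x0) / v ord0 y) *: y) => i.
rewrite linear_funD// linear_functionalZ//.
case: (unliftP ord0 i) => [j|] ->; first by rewrite ky mulr0 addr0.
by rewrite divfK; [ring|exact/eqP].
Qed.

(** If no solution has norm at most [M + 1], then [x0] has distance at least [M + 1] from the common
    kernel. Hahn-Banach gives a combination [w] of the [v i] of dual norm at most 1 with
    [|w x0| >= M + 1], whereas [w x0 = e' w] has modulus at most [M]. The added 1 makes the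
    contradiction strict. *)
Lemma helly (e' : V -> K^o) (M : K) (n : nat) : linear e' -> 0 <= M ->
  (forall v, `|e' v| <= M * dn v) -> forall v : 'I_n -> V,
  exists2 x : X, nrm x <= M + 1 & forall i, v i x = e' (v i).
Proof.
move=> le M0 eM v; have [x0 hx0] := helly_interpolation le v.
have lv i : linear (v i) by exact: continuous_linear_linear.
have Mr : M + 1 \is Num.real by rewrite ger0_real// addr_ge0.
pose N := [set y | forall i, v i y = 0].
apply: contrapT => nx.
have [| | | |f [lf fn fN f0]] := @hahn_banach _ hK _ _ sn N x0 (M + 1).
- by move=> i; exact: linear_fun0.
- move=> a x y Nx Ny i.
  by rewrite linear_funD// linear_functionalZ// Nx Ny mulr0 addr0.
- by rewrite addr_ge0.
- move=> y Ny; rewrite real_leNgt ?(seminorm_real sn)//; apply/negP => /ltW xy.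
  apply: nx; exists (x0 + y) => // i.
  by rewrite linear_funD// Ny addr0.
have [|||a fa] := @linear_combination_of_functionals K X n v f => //.
pose w : V := \sum_i a i *: v i.
have wE x : w x = f x.
  rewrite fa /w; elim/big_rec2 : _ => // k y1 y2 _ <-.
  by rewrite continuous_linear_opE.
have : `|f x0| <= M.
  have -> : f x0 = e' w.
    rewrite fa linear_functional_sum//; apply: eq_bigr => i _.
    by rewrite linear_functionalZ// hx0.
  apply: le_trans (eM w) _; apply: ler_piMr => //.
  by apply: dual_norm_le => // x; rewrite wE mul1r.
move=> /(le_trans f0); rewrite gerDl => /le_lt_trans /(_ ltr01).
by rewrite ltxx.
Qed.

(* Compactness of the balls lifts Helly's theorem from finitely many
   functionals to all of them. *)
Lemma dixmier_ng (e' : V -> K^o) (M : K) : linear e' -> 0 <= M ->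
  (forall v, `|e' v| <= M * dn v) ->
  exists2 x : X, nrm x <= M + 1 & forall v : V, e' v = v x.
Proof.
move=> le M0 eM.
have Mr : M + 1 \is Num.real by rewrite ger0_real// addr_ge0.
have [| |x xM hx] := @compact_fip G [set x | nrm x <= M + 1] V setT
   (fun v => [set x | v x = e' v]) (norm_ball_compact hsaks hgamma hmontel Mr).
- move=> v _; apply: (@closed_comp _ _ (v : G -> K^o) [set e' v]).
    by move=> x _; exact: continuous_linear_continuous.
  by apply: accessible_closed_set1; apply: hausdorff_accessible; exact: norm_hausdorff.
- move=> s _; have [x xM hx] := helly le M0 eM (fun i : 'I_(size s) => nth 0 s i).
  exists x => // v vs.
  have vi : (index v s < size s)%N by rewrite index_mem.
  by have := hx (Ordinal vi); rewrite /= nth_index.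
- by exists x => // v; rewrite (hx v I).
Qed.

(** The condition (AP). *)
Definition finite_rank_approximation :=
  forall p, continuous_seminorm gamma p ->
  exists (n : nat) (x : 'I_n -> X) (v : 'I_n -> V), forall y, nrm y <= 1 ->
    p (y - \sum_i v i y *: x i) <= 1.

End mixed_dual.

Lemma ptws_evaluation_continuous (Omega : Type) (T : topologicalType) (w : Omega) :
  continuous (fun f : {ptws Omega -> T} => f w).
Proof. exact: (@proj_continuous {classic Omega} (fun=> T) w). Qed.

(** * Point evaluations in the dual *)

Section point_evaluations.
Variables (K : numFieldType) (hK : real_or_complex K) (Omega : Type).
Variables (S : {pred Omega -> K^o}) (X : subLmodType S).
Variables (nrm : X -> K) (tau : topology X) (Gamma_tau : set (X -> K)).
Hypothesis hsaks : saks_space nrm tau Gamma_tau.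
Variables (gamma : topology X) (hgamma : is_mixed_topology nrm tau gamma).
Hypothesis hmontel : semi_montel (topologized gamma).
Hypothesis hpointwise : coarser (pointwise_topology X) tau.

Local Notation G := (topologized gamma).
Local Notation V := (topdual G).
Local Notation dn := (@dual_norm K X gamma nrm).
Local Notation value x w := ((\val (x : X) : Omega -> K^o) w).
Let sn : is_seminorm nrm := saks_nrm_seminorm hsaks.

Lemma evaluation_at_linear w : linear (fun x : X => value x w : K^o).
Proof. by move=> a x y; rewrite linearP. Qed.

Lemma evaluation_at_continuous w : continuous_seminorm gamma (fun x => `|value x w|).
Proof.
split; first exact: linear_norm_seminorm (@evaluation_at_linear w).
apply/topologized_nbhsP; exists [set x | `|value x w| < 1]; split=> //; last first.
  by rewrite /= raddf0 normr0 ltr01.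
apply: (mixed_finer hgamma); apply: hpointwise.
pose T := initial_topology (\val : X -> {ptws Omega -> K^o}).
suff : open ([set x | `|value x w| < 1] : set T) by [].
apply: (@open_comp _ _ (\val : T -> {ptws Omega -> K^o})
  [set f | `|f w| < 1]); first by move=> x _; exact: initial_continuous.
apply: (@open_comp _ _ (fun f : {ptws Omega -> K^o} => f w)
  [set z : K^o | `|z| < 1]).
  by move=> x _; exact: ptws_evaluation_continuous.
suff -> : [set z : K^o | `|z| < 1] = ball (0 : K^o) 1 by exact: ball_open.
by apply/seteqP; split=> z /=; rewrite -ball_normE /= sub0r normrN.
Qed.

Lemma exists_evaluation_at w : exists v : V, forall x, v x = value x w.
Proof.
exact: (mixed_dual_exists hgamma (@evaluation_at_linear w)
  (evaluation_at_continuous w) (fun=> lexx _)).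
Qed.

Lemma evaluations_separate (x : X) : (forall w, value x w = 0) -> x = 0.
Proof. by move=> h; apply: val_inj; rewrite raddf0; apply/funext. Qed.

(** A functional on V that separates [v] from the span of the point evaluations is evaluation at
    some [x] of X. It kills every point evaluation, so the function [x] is 0 and the functional
    vanishes at [v] as well. *)
Lemma point_evaluations_dense (v : V) e : 0 < e ->
  exists m (c : 'I_m -> K) (w : 'I_m -> Omega),
    forall x, `|v x - \sum_j c j * value x (w j)| <= e * nrm x.
Proof.
move=> e0.
pose N : set V := [set u | exists m (c : 'I_m -> K) (w : 'I_m -> Omega),
  forall x, u x = \sum_j c j * value x (w j) ].
apply: contrapT => nv.
have sdn := dual_norm_seminorm hK hsaks hgamma hmontel.
have [| | | |f [lf fd fN f0]] := @hahn_banach _ hK _ _ sdn N v e.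
- exists 0%N, (fun=> 0), (fun i : 'I_0 => False_rect _ (notF (ltn_ord i))) => x.
  by rewrite big_ord0.
- move=> a u1 u2 [m1 [c1 [w1 h1]]] [m2 [c2 [w2 h2]]].
  exists (m1 + m2)%N,
    (fun j => match fintype.split j with inl i => a * c1 i | inr i => c2 i end),
    (fun j => match fintype.split j with inl i => w1 i | inr i => w2 i end) => x.
  rewrite continuous_linear_opE h1 h2 big_split_ord /=; congr (_ + _).
    rewrite scaler_sumr; apply: eq_bigr => i _.
    by rewrite (unsplitK (inl i)) /GRing.scale/= mulrA.
  by apply: eq_bigr => i _; rewrite (unsplitK (inr i)).
- exact: ltW.
- move=> u [m [c [w hu]]]; rewrite real_leNgt ?(seminorm_real sdn) ?gtr0_real//.
  apply/negP => /ltW uv; apply: nv; exists m, (fun j => - c j), w => x.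
  have -> : v x - \sum_j - c j * value x (w j) = (1 *: v + u) x.
    rewrite continuous_linear_opE scale1r hu -sumrN; congr (_ + _).
    by apply: eq_bigr => j _; rewrite mulNr opprK.
  rewrite scale1r; apply: le_trans (dual_norm_bound hK hsaks hgamma hmontel _ _) _.
  by rewrite ler_wpM2r ?(seminorm_ge0 sn).
have [|x _ fx] := dixmier_ng hK hsaks hgamma hmontel lf ler01.
  by move=> u; rewrite mul1r.
have x0 : x = 0.
  apply: evaluations_separate => w; have [d hd] := exists_evaluation_at w.
  rewrite -hd -fx fN//; exists 1%N, (fun=> 1), (fun=> w) => y.
  by rewrite big_ord_recl big_ord0 addr0 mul1r.
move: f0; rewrite fx x0 (linear_fun0 (continuous_linear_linear v)) normr0.
by move=> /(lt_le_trans e0); rewrite ltxx.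
Qed.

End point_evaluations.

(** * Approximation properties *)

Lemma dense_nbhs (T : topologicalType) (A : set T) (x : T) (U : set T) :
  dense A -> nbhs x U -> exists2 y, A y & U y.
Proof.
move=> dA; rewrite nbhsE => -[W [oW Wx] WU].
have [|y [Wy Ay]] := dA W _ oW; first by exists x.
by exists y => //; exact: WU.
Qed.

Lemma dense_of_nbhs (T : topologicalType) (A : set T) :
  (forall (x : T) (U : set T), nbhs x U -> exists2 y, A y & U y) -> dense A.
Proof.
move=> h W [x Wx] oW; have [|y Ay Wy] := h x W; last by exists y.
exact: open_nbhs_nbhs.
Qed.

(** * Neighbourhoods for uniform convergence on families of sets *)

Section init_topology_theory.
Variables (X : choiceType) (T : topologicalType) (f : X -> T).

Lemma init_topology_nbhsP (x : X) (U : set X) :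
  nbhs (x : topologized (init_topology f)) U <->
  exists2 W, nbhs (f x) W & f @^-1` W `<=` U.
Proof.
rewrite topologized_nbhsP; split.
  move=> [_ [[W oW <-] Wx WU]]; exists W => //.
  exact: open_nbhs_nbhs.
rewrite nbhsE => -[W [W' [oW' W'x] W'W] WU].
exists (f @^-1` W'); split=> //; first by exists W'.
by apply: subset_trans WU; exact: preimage_subset.
Qed.

End init_topology_theory.

Section uniform_family.
Variables (K : numFieldType) (U : choiceType) (E : normedModType K).

Lemma entourage_norm_lt (e : K) : 0 < e ->
  entourage [set xy : E * E | `|xy.1 - xy.2| < e].
Proof.
move=> e0; rewrite -entourage_ballE; exists e => //= -[x y] /=.
by rewrite -ball_normE.
Qed.

Lemma entourage_normP (A : set (E * E)) : entourage A ->
  exists2 e : K, 0 < e & [set xy : E * E | `|xy.1 - xy.2| < e] `<=` A.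
Proof.
rewrite -entourage_ballE => -[e /= e0 eA]; exists e => // -[x y] /= xy.
by apply: eA => /=; rewrite -ball_normE.
Qed.

Lemma uniform_family_nbhs (fam : set (set U)) (A : set U) (f : U -> E) (e : K) :
  fam A -> 0 < e ->
  nbhs (f : {family fam, U -> E}) [set g | forall y, A y -> `|f y - g y| < e].
Proof. by move=> fA e0; exact: fam_nbhs (entourage_norm_lt e0) fA. Qed.

(* The family is enlarged to a directed one, so that a single set suffices. *)
Lemma uniform_family_nbhsP (fam fam' : set (set U)) (f : U -> E)
    (P : set (U -> E)) : fam `<=` fam' -> fam' !=set0 ->
  (forall A B, fam' A -> fam' B -> fam' (A `|` B)) ->
  nbhs (f : {family fam, U -> E}) P -> exists A e, [/\ fam' A, 0 < e &
    [set g | forall y, A y -> `|f y - g y| < e] `<=` P].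
Proof.
move=> sub [A0 fA0] fU nP.
pose F := filter_from [set Ae : set U * K | fam' Ae.1 /\ 0 < Ae.2]
  (fun Ae => [set g : U -> E | forall y, Ae.1 y -> `|f y - g y| < Ae.2]).
have FF : Filter F.
  apply: filter_from_filter; first by exists (A0, 1); split=> //=; exact: ltr01.
  move=> [A d] [B e] /= [fA d0] [fB e0].
  have re : d >=< e by apply: real_comparable; exact: gtr0_real.
  exists (A `|` B, Num.min d e).
    by split; [exact: fU|rewrite comparable_lt_min// d0].
  move=> g /= h; split=> y Ay.
    by have := h y (or_introl Ay); rewrite comparable_lt_min// => /andP[].
  by have := h y (or_intror Ay); rewrite comparable_lt_min// => /andP[].
suff /(_ _ nP)[[A e] /= [fA e0] AP] : {family fam, F --> f} by exists A, e.
apply/fam_cvgP => A fA Q /uniform_nbhs[W [/entourage_normP[e e0 eW] WQ]].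
exists (A, e) => /=; first by split=> //; exact: sub.
by move=> g hg; apply: WQ => y Ay; apply: eW; exact: hg.
Qed.

End uniform_family.

Section compact_net.
Variables (K : numFieldType) (Y : preTopologicalLmodType K) (p : Y -> K).
Hypotheses (lY : linear_topology Y) (sp : is_seminorm p).
Hypothesis p1 : nbhs (0 : Y) [set x | p x < 1].

Lemma compact_net (A : set Y) (d : K) : compact A -> 0 < d ->
  exists s : seq Y, forall a, A a -> exists2 x, x \in s & p (a - x) < d.
Proof.
move=> cA d0; apply: contrapT => /forallNP ns.
have [| |x Ax hx] := @compact_fip Y A Y setT (fun x => [set a | ~ p (a - x) < d]) cA.
- move=> x _; rewrite -openC openE => a /contrapT ax.
  have ax0 : 0 < d - p (a - x) by rewrite subr_gt0.
  have := linear_topology_seminorm_ball lY a sp p1 ax0.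
  apply: filterS => b /= ba; apply: contra_not; apply.
  rewrite -(subrK a b) -addrA (le_lt_trans (seminormD sp _ _))//.
  by rewrite -ltrBrDr.
- move=> s _; have /existsNP[a /not_implyP[Aa na]] := ns s.
  by exists a => // x xs /= ax; apply: na; exists x.
- by apply: (hx x I); rewrite subrr (seminorm0 sp).
Qed.

End compact_net.

Section continuous_linear_operations.
Variables (K : numFieldType) (Y : preTopologicalLmodType K).
Variable E : topologicalLmodType K.

Lemma continuous_linear_subE (u v : continuous_linear Y E) y :
  (u - v) y = u y - v y.
Proof. by []. Qed.

Lemma continuous_linear_sumE n (a : 'I_n -> K) (v : 'I_n -> continuous_linear Y E) y :
  (\sum_i a i *: v i) y = \sum_i a i *: v i y.
Proof. by elim/big_rec2 : _ => // i z1 z2 _ <-; rewrite continuous_linear_opE. Qed.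

End continuous_linear_operations.

Section eps_product_theory.
Variables (K : numFieldType) (Y : preTopologicalLmodType K) (E : normedModType K).

(** One absolutely convex compact set already gives a neighbourhood for the kappa topology. The
    quantified [c] replaces the supremum of [|h|] over [A]. *)
Lemma eps_product_exists (A : set Y) (f : topdual Y -> E) (M : K) :
  absolutely_convex_compact A -> linear f -> 0 <= M ->
  (forall (h : topdual Y) c, 0 <= c -> (forall y, A y -> `|h y| <= c) ->
    `|f h| <= M * c) ->
  exists u : eps_product Y E, forall h, u h = f h.
Proof.
move=> cA lf M0 fM.
have fP : (f : dual_kappa Y -> E) \in @continuous_linear_pred K (dual_kappa Y) E.
  rewrite unfold_in; apply/asboolP; split=> // h.
  apply: (@cvgrPdist_lt _ E _ _ (nbhs_filter (h : dual_kappa Y)) f (f h)).2.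
  move=> e e0; apply: (init_topology_nbhsP _ _ _).2.
  have M1 : 0 < M + 1 by rewrite ltr_wpDl.
  have d0 : 0 < e / (M + 1) by rewrite divr_gt0.
  exists [set g | forall y, A y -> `|(h : topdual Y) y - g y| < e / (M + 1)].
    refine (uniform_family_nbhs (E := K^o) (h : Y -> K^o) cA d0).
  move=> g /= hg; rewrite -(linear_funB lf).
  apply: (@le_lt_trans _ _ (M * (e / (M + 1)))).
    by apply: fM; [exact: ltW|move=> y /hg /ltW].
  by rewrite mulrCA gtr_pMr// ltr_pdivrMr// mul1r ltrDl.
by exists (ContinuousLinear fP).
Qed.

Hypotheses (hK : real_or_complex K) (lY : linear_topology Y).

Lemma segment_absolutely_convex_compact (y : Y) :
  absolutely_convex_compact [set c *: y | c in [set c : K | `|c| <= 1]].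
Proof.
split.
  move=> a b _ _ ab [c /= c1 <-] [d /= d1 <-].
  exists (a * c + b * d); last by rewrite scalerDl !scalerA.
  rewrite /= (le_trans (ler_normD _ _))// !normrM (le_trans _ ab)//.
  by rewrite lerD// ler_piMr.
apply: (@continuous_compact K^o Y (fun c => c *: y)); last first.
  exact: closed_disc_compact.
apply: continuous_subspaceT => c.
apply: (@continuous_comp K^o (K^o * Y)%type Y (fun c => (c, y)) (fun z => z.1 *: z.2)).
  apply: (@cvg_pair _ _ _ (nbhs (c : K^o)) (nbhs (c : K^o)) (nbhs y)).
    exact: cvg_id.
  exact: cvg_cst.
by have [_ /(_ (c, y))] := lY.
Qed.

Lemma rank_one_eps_product (y : Y) (e : E) :
  exists u : eps_product Y E, forall h : topdual Y, u h = h y *: e.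
Proof.
apply: (eps_product_exists (f := fun h => h y *: e)
  (segment_absolutely_convex_compact y) _ (normr_ge0 e)).
  move=> a h1 h2.
  transitivity ((a * h1 y + h2 y) *: e); first by [].
  by rewrite scalerDl scalerA.
move=> h c c0 hc; rewrite normrZ mulrC ler_wpM2l//; apply: hc.
by exists 1; rewrite /= ?normr1// scale1r.
Qed.

Lemma finite_rank_eps_product n (y : 'I_n -> Y) (e : 'I_n -> E) :
  exists u : eps_product Y E, forall h : topdual Y, u h = \sum_i h (y i) *: e i.
Proof.
have /choice[u hu] := fun i => rank_one_eps_product (y i) (e i).
exists (\sum_i 1 *: u i) => h; rewrite continuous_linear_sumE.
by apply: eq_bigr => i _; rewrite scale1r hu.
Qed.

End eps_product_theory.

(** * The kappa-dual of (X, gamma) *)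

Section compact_eps_product.
Variables (K : numFieldType) (hK : real_or_complex K) (X : lmodType K).
Variables (nrm : X -> K) (tau : topology X) (Gamma_tau : set (X -> K)).
Hypothesis hsaks : saks_space nrm tau Gamma_tau.
Variables (gamma : topology X) (hgamma : is_mixed_topology nrm tau gamma).
Hypothesis hmontel : semi_montel (topologized gamma).

Local Notation G := (topologized gamma).
Local Notation V := (topdual G).
Local Notation dn := (@dual_norm K X gamma nrm).
Local Notation rank_remainder x v y := (y - \sum_i v i y *: x i).
Let sn : is_seminorm nrm := saks_nrm_seminorm hsaks.
Let sdn : is_seminorm dn := dual_norm_seminorm hK hsaks hgamma hmontel.

Lemma norm_ball_absolutely_convex_compact :
  absolutely_convex_compact ([set x | nrm x <= 1] : set G).
Proof.
split; last exact: (norm_ball_compact hsaks hgamma hmontel (real1 K)).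
move=> a b x y ab xB yB /=.
rewrite (le_trans (seminormD sn _ _))// !(seminormZ sn) (le_trans _ ab)//.
by rewrite lerD// ler_piMr.
Qed.

Lemma dual_norm_le_ball (v : V) c : 0 <= c ->
  (forall y, nrm y <= 1 -> `|v y| <= c) -> dn v <= c.
Proof.
move=> c0 h; apply: supremum_le => // [_ [x _ <-]//|].
by move=> _ [x /= x1 <-]; exact: h.
Qed.

Lemma dual_kappa_exists (E : normedModType K) (f : V -> E) (C : K) :
  linear f -> 0 <= C -> (forall v, `|f v| <= C * dn v) ->
  exists u : eps_product G E, forall v, u v = f v.
Proof.
move=> lf C0 fC.
apply: (eps_product_exists norm_ball_absolutely_convex_compact lf C0) => v c c0 h.
apply: le_trans (fC v) _; apply: ler_wpM2l => //.
exact: dual_norm_le_ball.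
Qed.

(** Compact sets are norm-bounded, so a kappa-neighbourhood contains a ball of the dual norm. With
    [dual_kappa_exists], where the unit ball is the compact set, this identifies the kappa-dual with
    the normed space V. *)
Lemma dual_kappa_bounded (E : normedModType K) (u : eps_product G E) :
  exists2 C, 0 < C & forall v : V, `|u v| <= C * dn v.
Proof.
have /(init_topology_nbhsP _ _ _).1[W + Wu] := continuous_linear_nbhs0 u.
pose fam' : set (set G) := [set A | exists2 M, 0 <= M & forall x, A x -> nrm x <= M].
move=> /(@uniform_family_nbhsP K G K^o _ fam')[].
- by move=> A [_ /(mixed_compact_bounded hK hsaks hgamma)].
- by exists set0; exists 0.
- move=> A B [M M0 AM] [N N0 BN]; exists (M + N); first exact: addr_ge0.
  by move=> x [/AM xM|/BN xN];
    [rewrite (le_trans xM)// lerDl|rewrite (le_trans xN)// lerDr].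
move=> A [d [[M M0 AM] d0 AW]].
have M1 : 0 < M + 1 by rewrite ltr_wpDl.
have dM0 : 0 < d / (M + 1) by rewrite divr_gt0.
exists (2 / (d / (M + 1))); first by rewrite divr_gt0.
have lu : linear (u : V -> E) := continuous_linear_linear u.
apply: (seminorm_le_of_ball (linear_norm_seminorm lu) sdn dM0) => v vd.
apply/ltW/Wu/AW => x Ax /=.
rewrite [X in `|X - _|](_ : _ = 0) // sub0r normrN.
apply: le_lt_trans (dual_norm_bound hK hsaks hgamma hmontel v x) _.
apply: (@le_lt_trans _ _ (dn v * (M + 1))); last by rewrite -ltr_pdivlMr.
by rewrite ler_wpM2l ?(seminorm_ge0 sdn)// (le_trans (AM _ Ax))// lerDl.
Qed.

Lemma continuous_seminormZ (p : X -> K) (c : K) : 0 < c ->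
  continuous_seminorm gamma p -> continuous_seminorm gamma (fun x => c * p x).
Proof.
move=> c0 [sp p1]; split; first exact: scaled_seminorm (ltW c0) sp.
have c10 : 0 < c^-1 by rewrite invr_gt0.
have := linear_topology_seminorm_ball (mixed_linear hgamma) 0 sp p1 c10.
by apply: filterS => x /=; rewrite subr0 -ltr_pdivlMl// mulr1.
Qed.

Lemma mixed_equicontinuous (p : X -> K) : continuous_seminorm gamma p ->
  equicontinuous_sets [set v : V | forall x, `|v x| <= p x].
Proof.
move=> [sp p1] x W /entourage_normP[e e0 eW].
have := linear_topology_seminorm_ball (mixed_linear hgamma) x sp p1 e0.
apply: filterS => y /= yx v vp; apply: eW => /=.
rewrite -(linear_funB (continuous_linear_linear v)).
by apply: le_lt_trans (vp _) _; rewrite (seminorm_distr sp).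
Qed.

(** Turns approximations of the identity of V into approximations of the identity of X, and back. *)
Lemma rank_remainder_transpose n (x : 'I_n -> X) (v : 'I_n -> V) (w : V) y :
  (w - \sum_i w (x i) *: v i) y = w (rank_remainder x v y).
Proof.
have lw := continuous_linear_linear w.
rewrite continuous_linear_subE continuous_linear_sumE.
rewrite (linear_funB lw) (linear_functional_sum _ lw); congr (_ - _).
by apply: eq_bigr => i _; rewrite (linear_functionalZ lw) /GRing.scale/= mulrC.
Qed.

(** The identity of V is approximated on the polar of [p]. For each [y] of the ball, Hahn-Banach
    selects in that polar a [w] norming the remainder at [y], and transposition moves the remainder
    to [w]. *)
Lemma approximation_property_finite_rank :
  approximation_property G ->
  finite_rank_approximation nrm gamma.
Proof.
move=> hG p cp; have [sp p1] := cp.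
pose E := dual_banach hK hsaks hgamma hmontel.
have [| | |u uE] := @dual_kappa_exists E (fun v : V => (v : E)) 1.
- by [].
- exact: ler01.
- by move=> v; rewrite mul1r.
have := @dense_nbhs (topologized (eps_topology G E)) _ u _ (hG E).
set H := [set v : V | forall x, `|v x| <= p x].
move=> /(_ [set g : eps_product G E | forall v, H v -> `|u v - g v| < 1])[].
  apply: (init_topology_nbhsP _ _ _).2.
  exists [set g : topdual G -> E | forall v, H v -> `|u v - g v| < 1]; last by [].
  refine (uniform_family_nbhs (E := E) (u : V -> E) (mixed_equicontinuous cp) ltr01).
move=> g [n [x [v gE]]] ug; exists n, x, (v : 'I_n -> V) => y y1.
have [w wp py] := mixed_hahn_banach hK hgamma (rank_remainder x v y) cp.
rewrite (le_trans py)// -rank_remainder_transpose.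
apply: le_trans (dual_norm_bound hK hsaks hgamma hmontel _ _) _.
rewrite -[1]mulr1; apply: ler_pM => //; try exact: (seminorm_ge0 sn).
  exact: (seminorm_ge0 sdn).
by have := ug w wp; rewrite uE gE => /ltW.
Qed.

Lemma finite_rank_approximation_property :
  finite_rank_approximation nrm gamma ->
  approximation_property G.
Proof.
move=> hap E; apply: dense_of_nbhs => u P.
move=> /(init_topology_nbhsP _ _ _).1[W + WP].
move=> /(@uniform_family_nbhsP K (topdual G) E _ (@equicontinuous_sets K G))[].
- by [].
- by exists set0 => x A eA; apply: filterE => y i [].
- move=> A B eA eB x Z eZ; apply: filterS2 (eA x Z eZ) (eB x Z eZ) => y yA yB i.
  by case=> [/yA|/yB].
move=> H [e [eH e0 HW]].
have [C C0 uC] := dual_kappa_bounded u.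
(* Equicontinuity at 0 puts [H] inside the polar of one continuous seminorm. *)
have [p [cp pH]] : exists p, continuous_seminorm gamma p /\
    forall w : V, H w -> forall y, `|w y| <= p y.
  have h1 := eH 0 _ (entourage_norm_lt K^o ltr01).
  have [p [cp pH]] := mixed_nbhs0_continuous_seminorm hK hsaks hgamma hmontel h1.
  exists p; split=> // w Hw; have lw := continuous_linear_linear w.
  apply: (@seminorm_le_of_unit_ball _ _ (fun y => `|w y|)); last 1 first.
  - move=> y /ltW /pH /(_ w Hw) /=.
    by rewrite (linear_fun0 lw) sub0r normrN => /ltW.
  - exact: linear_norm_seminorm.
  - by case: cp.
(* (AP) for this multiple of [p] makes the transposed remainder of each [w] in [H] at most
   [e / (2 * C)] in dual norm; [u] then maps it to norm at most [e / 2]. *)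
have t0 : 0 < 2 * C / e by rewrite divr_gt0// mulr_gt0.
have [n [x [v hv]]] := hap _ (continuous_seminormZ t0 cp).
have lu : linear (u : V -> E) := continuous_linear_linear u.
have [g gE] := finite_rank_eps_product hK (mixed_linear hgamma) x (fun i => u (v i)).
exists g; first by exists n, x, (fun i => u (v i)) => w; rewrite gE.
apply: WP; apply: HW => w Hw; rewrite gE.
have -> : (u w : E) - \sum_i w (x i) *: u (v i) = u (w - \sum_i w (x i) *: v i).
  by rewrite (linear_funB lu) (linear_fun_sum lu).
apply: le_lt_trans (uC _) _.
apply: (@le_lt_trans _ _ (C * (e / (2 * C)))); last first.
  have -> : C * (e / (2 * C)) = e / 2 by field; rewrite gt_eqF.
  by rewrite [X in _ < X](splitr e) ltrDl divr_gt0.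
apply: ler_wpM2l; first exact: ltW.
apply: dual_norm_le_ball => [|y y1]; first by rewrite ltW// divr_gt0// mulr_gt0.
rewrite rank_remainder_transpose; apply: le_trans (pH w Hw _) _.
have := hv y y1; rewrite -ler_pdivlMl//; rewrite mulr1 invf_div.
exact.
Qed.


End compact_eps_product.

Lemma filter_forall_seq (T : Type) (I : eqType) (F : set_system T) (s : seq I)
    (P : I -> set T) : Filter F -> (forall i, i \in s -> F (P i)) ->
  F [set x | forall i, i \in s -> P i x].
Proof.
move=> FF; elim: s => [|i s IH] FP; first by apply: filterS filterT => x _ i.
have Fi := FP i (mem_head _ _).
have Fs : F [set x | forall i, i \in s -> P i x].
  by apply: IH => j js; apply: FP; rewrite inE js orbT.
apply: filterS2 Fi Fs => x Pi Ps j; rewrite inE => /orP[/eqP ->//|].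
exact: Ps.
Qed.

Section norm_topology_theory.
Variables (K : numFieldType) (X : lmodType K) (q : X -> K).
Hypothesis sq : is_seminorm q.

Let sQ r : [set q] r -> is_seminorm r. Proof. by move=> ->. Qed.

Lemma norm_topology_linear : linear_topology (topologized (norm_topology q)).
Proof. exact: linear_seminorm_topology. Qed.

Lemma norm_topology_nbhsP (x : X) (U : set X) :
  nbhs (x : topologized (norm_topology q)) U <->
  exists2 e, 0 < e & [set y | q (y - x) < e] `<=` U.
Proof.
rewrite (seminorm_nbhsP sQ); split.
  move=> [Q0 [e [_ s0 e0 QU]]]; exists e => // y yx; apply: QU => r /s0 ->.
  exact: yx.
move=> [e e0 eU]; exists [set q], e; split=> //.
by move=> y /= /(_ _ erefl); exact: eU.
Qed.

Lemma norm_topology_unit_ball :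
  nbhs (0 : topologized (norm_topology q)) [set x | q x < 1].
Proof.
by apply/norm_topology_nbhsP; exists 1 => // y /=; rewrite subr0.
Qed.

End norm_topology_theory.

(** * The kappa-dual of V *)

Section dual_eps_product.
Variables (K : numFieldType) (hK : real_or_complex K) (X : lmodType K).
Variables (nrm : X -> K) (tau : topology X) (Gamma_tau : set (X -> K)).
Hypothesis hsaks : saks_space nrm tau Gamma_tau.
Variables (gamma : topology X) (hgamma : is_mixed_topology nrm tau gamma).
Hypothesis hmontel : semi_montel (topologized gamma).

Local Notation G := (topologized gamma).
Local Notation V := (topdual G).
Local Notation dn := (@dual_norm K X gamma nrm).
Local Notation W := (topologized (norm_topology dn)).
Local Notation rank_remainder x v y := (y - \sum_i v i y *: x i).
Let sn : is_seminorm nrm := saks_nrm_seminorm hsaks.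
Let sdn : is_seminorm dn := dual_norm_seminorm hK hsaks hgamma hmontel.
Let lW : linear_topology W := norm_topology_linear sdn.
Let dnb := dual_norm_bound hK hsaks hgamma hmontel.

Lemma exists_bidual_embedding : exists J : X -> topdual W, forall x (v : V), J x v = v x.
Proof.
suff /choice[J hJ] : forall x : X, exists h : topdual W, forall v : V, h v = v x.
  by exists J.
move=> x; apply: (continuous_linear_of_seminorm lW (E := K^o)
  (f := fun v : V => v x : K^o) (p := fun v => nrm x * dn v)).
- by [].
- exact: scaled_seminorm (seminorm_ge0 sn x) sdn.
- apply/(norm_topology_nbhsP sdn).
  have x1 : 0 < nrm x + 1 by rewrite ltr_wpDl// (seminorm_ge0 sn).
  exists (nrm x + 1)^-1; first by rewrite invr_gt0.
  move=> v /=; rewrite subr0 => vx.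
  apply: (@le_lt_trans _ _ ((nrm x + 1) * dn v)); last by rewrite -ltr_pdivlMl// mulr1.
  by rewrite ler_wpM2r ?(seminorm_ge0 sdn)// lerDl.
- by move=> v; rewrite mulrC; exact: dnb.
Qed.

Lemma bidual_bounded (h : topdual W) :
  exists2 C, 0 < C & forall v : V, `|h v| <= C * dn v.
Proof.
have /(norm_topology_nbhsP sdn)[e e0 eU] := continuous_linear_nbhs0 h.
exists (2 / e); first by rewrite divr_gt0.
have lh : linear (h : V -> K^o) := continuous_linear_linear h.
apply: (seminorm_le_of_ball (linear_norm_seminorm lh) sdn e0) => v ve.
by apply/ltW/eU; rewrite /= subr0.
Qed.

Lemma bidual_representation (h : topdual W) (C : K) : 0 <= C ->
  (forall v : V, `|h v| <= C * dn v) ->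
  exists2 x : X, nrm x <= C + 1 & forall v : V, h v = v x.
Proof.
move=> C0 hC; have lh : linear (h : V -> K^o) := continuous_linear_linear h.
exact: (dixmier_ng hK hsaks hgamma hmontel lh C0 hC).
Qed.

(* A directed family of subsets of [V] containing the norm-compact ones. *)
Definition small_on_bounded_sets (A : set V) :=
  (exists2 C, 0 <= C & forall v, A v -> dn v <= C) /\
  forall M e, 0 <= M -> 0 < e -> exists2 U, nbhs (0 : G) U &
    forall x, U x -> nrm x <= M -> forall v : V, A v -> `|v x| < e.

Lemma mixed_dual_nbhs0 (v : V) e : 0 < e -> nbhs (0 : G) [set x | `|v x| < e].
Proof.
move=> e0; have [p [[sp p1] vp]] := mixed_dual_le hK hsaks hgamma hmontel v.
have := linear_topology_seminorm_ball (mixed_linear hgamma) 0 sp p1 e0.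
by apply: filterS => x /=; rewrite subr0; apply: le_lt_trans.
Qed.

(** A finite norm-net of [A] leaves finitely many functionals, each small near 0, and an error of at
    most its mesh times [M]. *)
Lemma compact_small_on_bounded_sets (A : set W) : compact A ->
  small_on_bounded_sets A.
Proof.
move=> cA; have net d := @compact_net K W dn lW sdn (norm_topology_unit_ball sdn) A d cA.
split.
  have [s hs] := net 1 ltr01; exists (1 + \sum_(v <- s) dn v).
    by rewrite addr_ge0// sumr_ge0// => v _; exact: (seminorm_ge0 sdn).
  move=> a /hs[v vs av]; have -> : a = (a - v) + v by rewrite subrK.
  apply: le_trans (seminormD sdn _ _) _; apply: lerD; first exact: ltW.
  by rewrite (big_rem v)//= lerDl sumr_ge0// => w _; exact: (seminorm_ge0 sdn).
move=> M e M0 e0; have M1 : 0 < M + 1 by rewrite ltr_wpDl.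
have [|s hs] := net (e / 2 / (M + 1)); first by rewrite !divr_gt0.
exists [set x | forall v, v \in s -> `|(v : V) x| < e / 2].
  by apply: filter_forall_seq => v _; apply: mixed_dual_nbhs0; rewrite divr_gt0.
move=> x Ux xM a /hs[v vs av].
have -> : a x = v x + (a - v) x.
  by rewrite continuous_linear_subE addrC subrK.
apply: le_lt_trans (ler_normD _ _) _; rewrite (splitr e) ltr_leD//; first exact: Ux.
apply: le_trans (dnb _ _) _.
apply: (@le_trans _ _ (e / 2 / (M + 1) * (M + 1))); last by rewrite divfK// gt_eqF.
apply: ler_pM; [exact: (seminorm_ge0 sdn)|exact: (seminorm_ge0 sn)|exact: ltW|].
by rewrite (le_trans xM)// lerDl.
Qed.

(** A kappa-neighbourhood of 0 is governed by a norm-compact subset of V, which is small on bounded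
    sets; this smallness passes to [u] composed with [J] and is the test for [gamma]-continuity. *)
Lemma eps_product_continuous_seminorm (E : normedModType K)
    (u : eps_product W E) (J : X -> topdual W) :
  (forall x (v : V), J x v = v x) ->
  continuous_seminorm gamma (fun x => `|u (J x)|).
Proof.
move=> hJ.
have lJ : linear J.
  move=> a x y; apply: continuous_linear_eq => v.
  have lv := continuous_linear_linear (v : V).
  transitivity (a * J x v + J y v); last by [].
  by rewrite !hJ lv.
have luJ : linear (fun x => u (J x)).
  move=> a x y; rewrite lJ.
  exact: (continuous_linear_linear u).
have su := linear_norm_seminorm luJ.
have /(init_topology_nbhsP _ _ _).1[N + Nu] := continuous_linear_nbhs0 u.
move=> /(@uniform_family_nbhsP K W K^o _ small_on_bounded_sets)[].
- by move=> A [_ /compact_small_on_bounded_sets].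
- exists set0; split; first by exists 0.
  by move=> M e _ _; exists setT => //; exact: filterT.
- move=> A B [[C C0 AC] As] [[D D0 BD] Bs]; split.
    exists (C + D); first exact: addr_ge0.
    by move=> v [/AC vC|/BD vD];
      [rewrite (le_trans vC)// lerDl|rewrite (le_trans vD)// lerDr].
  move=> M e M0 e0.
  have [U1 U10 h1] := As M e M0 e0; have [U2 U20 h2] := Bs M e M0 e0.
  exists (U1 `&` U2); first exact: filterI.
  by move=> x [x1 x2] xM v [Av|Bv]; [exact: h1|exact: h2].
move=> A [d [[[C C0 AC] As] d0 AN]].
have small x : (forall v : V, A v -> `|v x| < d) -> `|u (J x)| < 1.
  move=> hx; apply/Nu/AN => v Av /=.
  by rewrite [X in `|X - _|](_ : _ = 0) // sub0r normrN hJ hx.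
have C1 : 0 < C + 1 by rewrite ltr_wpDl.
have dC : 0 < d / (C + 1) by rewrite divr_gt0.
have b0 : 0 < 2 / (d / (C + 1)) by rewrite divr_gt0.
apply: (continuous_seminorm_of_bounded_sets hsaks hgamma su (ltW b0)).
  apply: (seminorm_le_of_ball su sn dC) => x xd; apply/ltW/small => v Av.
  apply: le_lt_trans (dnb v x) _.
  apply: (@le_lt_trans _ _ ((C + 1) * nrm x)); last by rewrite mulrC -ltr_pdivlMr.
  by rewrite ler_wpM2r ?(seminorm_ge0 sn)// (le_trans (AC _ Av))// lerDl.
move=> M e M0 e0; have [|U U0 hU] := As M (d * e) M0; first by rewrite mulr_gt0.
exists U => // x Ux xM.
(* [U] was chosen for the bound [d * e], so on [A] the vector [e^-1 *: x] is below [d]. *)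
have : `|u (J (e^-1 *: x))| < 1.
  apply: small => v Av.
  rewrite (linear_functionalZ (continuous_linear_linear v)) normrM.
  by rewrite gtr0_norm ?invr_gt0// ltr_pdivrMl// mulrC hU.
by rewrite (seminormZ su) gtr0_norm ?invr_gt0// ltr_pdivrMl// mulr1.
Qed.

Lemma finite_rank_dual_approximation_property :
  finite_rank_approximation nrm gamma -> approximation_property W.
Proof.
move=> hap E; apply: dense_of_nbhs => u P.
move=> /(init_topology_nbhsP _ _ _).1[N + NP].
move=> /(@uniform_family_nbhsP K (topdual W) E _ (@equicontinuous_sets K W))[].
- by [].
- by exists set0 => x A eA; apply: filterE => y i [].
- move=> A B eA eB x Z eZ; apply: filterS2 (eA x Z eZ) (eB x Z eZ) => y yA yB i.
  by case=> [/yA|/yB].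
move=> H [e [eH e0 HN]].
have [J hJ] := exists_bidual_embedding.
have cu := eps_product_continuous_seminorm u hJ.
have [M M0 HM] : exists2 M, 0 < M &
    forall h, H h -> exists2 x : X, nrm x <= M & h = J x.
  have /(norm_topology_nbhsP sdn)[d d0 hd] := eH 0 _ (entourage_norm_lt K^o ltr01).
  have c0 : 0 < 2 / d by rewrite divr_gt0.
  (* [2 / d] bounds the functionals in [H], and the representation by a point of X adds 1 to the
     norm. *)
  exists (2 / d + 1); first by rewrite addr_gt0.
  move=> h Hh; have lh : linear (h : V -> K^o) := continuous_linear_linear h.
  have [|x xM hx] := bidual_representation (ltW c0) (h := h).
    apply: (seminorm_le_of_ball (linear_norm_seminorm lh) sdn d0) => v vd.
    have := hd v; rewrite /= subr0 => /(_ vd h Hh).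
    by rewrite (linear_fun0 lh) sub0r normrN => /ltW.
  by exists x => //; apply: continuous_linear_eq => v; rewrite hx hJ.
(* This scaling gives an error [e / (2 * M)] on the unit ball, hence [e / 2] on the ball of radius
   [M] that represents [H]. *)
have t0 : 0 < 2 * M / e by rewrite divr_gt0// mulr_gt0.
have [n [x [v hv]]] := hap _ (continuous_seminormZ hgamma t0 cu).
have [g gE] := finite_rank_eps_product hK lW (v : 'I_n -> W) (fun i => u (J (x i))).
exists g; first by exists n, (v : 'I_n -> W), (fun i => u (J (x i))) => h; rewrite gE.
apply: NP; apply: HN => h /HM[y yM ->]; rewrite gE.
have luJ : linear (fun x => u (J x)).
  move=> a y1 y2.
  have -> : J (a *: y1 + y2) = a *: J y1 + J y2.
    apply: continuous_linear_eq => w; have lw := continuous_linear_linear (w : V).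
    transitivity (a * J y1 w + J y2 w); last by [].
    by rewrite !hJ lw.
  exact: (continuous_linear_linear u).
have -> : u (J y) - \sum_i J y (v i : W) *: u (J (x i)) = u (J (rank_remainder x v y)).
  rewrite (linear_funB luJ) (linear_fun_sum luJ); congr (_ - _).
  by apply: eq_bigr => i _; rewrite hJ.
have := hv (M^-1 *: y).
rewrite (seminormZ sn) gtr0_norm ?invr_gt0// ler_pdivrMl// mulr1.
move=> /(_ yM).
have -> : rank_remainder x v (M^-1 *: y) = M^-1 *: rank_remainder x v y.
  rewrite scalerBr scaler_sumr; congr (_ - _); apply: eq_bigr => i _.
  by rewrite (linear_functionalZ (continuous_linear_linear (v i))) scalerA.
rewrite (seminormZ (linear_norm_seminorm luJ)) gtr0_norm ?invr_gt0//.
rewrite -ler_pdivlMl// mulr1 ler_pdivrMl// => /le_lt_trans; apply.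
have -> : M * (2 * M / e)^-1 = e / 2 by field; rewrite !gt_eqF.
by rewrite [X in _ < X](splitr e) ltrDl divr_gt0.
Qed.

End dual_eps_product.

(** * Uniform closures as Banach spaces *)

Section uniform_closure.
Variables (K : numFieldType) (X : lmodType K) (I : Type) (ev : I -> X -> K^o).
Hypothesis lev : forall i, linear (ev i).

(** The proof [lev] is an argument so that the vector space structure, which depends on it, can be
    inferred from the type. *)
Definition uniform_closure_pred (lev : forall i, linear (ev i)) : {pred I -> K^o} :=
  fun f => `[< forall e, 0 < e -> exists x, forall i, `|f i - ev i x| <= e >].

Lemma uniform_closure_closed : submod_closed (uniform_closure_pred lev).
Proof.
split.
  rewrite unfold_in; apply/asboolP => e e0; exists 0 => i.
  by rewrite linear_fun0// subrr normr0 ltW.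
move=> a f g; rewrite !unfold_in => /asboolP hf /asboolP hg.
apply/asboolP => e e0; have a1 : 0 < `|a| + 1 by rewrite ltr_wpDl.
have [|x fx] := hf (e / 2 / (`|a| + 1)); first by rewrite !divr_gt0.
have [|y gy] := hg (e / 2); first by rewrite divr_gt0.
exists (a *: x + y) => i.
have -> : (a *: f + g) i - ev i (a *: x + y) = a * (f i - ev i x) + (g i - ev i y).
  rewrite lev !fctE /GRing.scale/=; ring.
apply: le_trans (ler_normD _ _) _; rewrite normrM (splitr e); apply: lerD; last exact: gy.
apply: (@le_trans _ _ ((`|a| + 1) * (e / 2 / (`|a| + 1)))).
  by apply: ler_pM => //; rewrite lerDl.
by rewrite mulrC divfK// gt_eqF.
Qed.

Record uniform_closure (lev : forall i, linear (ev i)) := UniformClosure {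
  uniform_closure_val :> I -> K^o ;
  uniform_closure_valP : uniform_closure_val \in uniform_closure_pred lev }.

HB.instance Definition _ := [isSub for @uniform_closure_val lev].
HB.instance Definition _ := [Choice of uniform_closure lev by <:].
HB.instance Definition _ := GRing.isSubmodClosed.Build K (I -> K^o)
  (uniform_closure_pred lev) uniform_closure_closed.
HB.instance Definition _ :=
  [SubChoice_isSubLmodule of uniform_closure lev by <:].

Lemma uniform_closureP (f : uniform_closure lev) e : 0 < e ->
  exists x, forall i, `|f i - ev i x| <= e.
Proof. by have := uniform_closure_valP f; rewrite unfold_in => /asboolP; apply. Qed.

Lemma uniform_closure_exists (g : I -> K^o) :
  (forall e, 0 < e -> exists x, forall i, `|g i - ev i x| <= e) ->
  exists f : uniform_closure lev, forall i, f i = g i.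
Proof.
move=> hg; have gP : g \in uniform_closure_pred lev by rewrite unfold_in; apply/asboolP.
by exists (UniformClosure gP).
Qed.

Definition uniform_norm (f : I -> K^o) : K := supremum 0 [set `|f i| | i in setT].

Hypothesis hK : real_or_complex K.
Hypothesis evB : forall x, exists2 C, 0 <= C & forall i, `|ev i x| <= C.

Lemma uniform_closure_evaluation_norm :
  evaluation_norm (fun i (f : uniform_closure lev) => f i : K^o) (fun=> 1)
    (fun f => uniform_norm f).
Proof.
have n0 (f : I -> K^o) y : [set `|f i| | i in setT] y -> 0 <= y by move=> [i _ <-].
split.
- by move=> i a f g.
- by move=> _; exact: ler01.
- by move=> f; apply: supremum_ge0 => //; exact: n0.
- move=> f c c0; split=> [fc i|fc]; last first.
    apply: supremum_le => //; first exact: n0.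
    by move=> _ [i _ <-]; have := fc i; rewrite mulr1.
  rewrite mulr1; apply: le_trans fc.
  have [x fx] := uniform_closureP f ltr01; have [C C0 xC] := evB x.
  apply: (@le_supremum _ hK _ (1 + C)); first exact: n0.
    move=> _ [j _ <-]; rewrite -(subrK (ev j x) (f j)).
    by apply: le_trans (ler_normD _ _) _; apply: lerD; [exact: fx|exact: xC].
  by exists i.
- by move=> f f0; apply: val_inj; apply/funext.
- move=> g hg; apply: uniform_closure_exists => e e0.
  have e2 : 0 < e / 2 by rewrite divr_gt0.
  have [f gf] := hg _ e2; have [x fx] := uniform_closureP f e2.
  exists x => i; rewrite -(subrK (f i) (g i)) -addrA (splitr e).
  apply: le_trans (ler_normD _ _) _; apply: lerD; last exact: fx.
  by have := gf i; rewrite mulr1.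
Qed.

Definition uniform_closure_banach : completeNormedModType K :=
  evaluation_banach hK uniform_closure_evaluation_norm.

End uniform_closure.

Section dual_approximation.
Variables (K : numFieldType) (hK : real_or_complex K) (X : lmodType K).
Variables (nrm : X -> K) (tau : topology X) (Gamma_tau : set (X -> K)).
Hypothesis hsaks : saks_space nrm tau Gamma_tau.
Variables (gamma : topology X) (hgamma : is_mixed_topology nrm tau gamma).
Hypothesis hmontel : semi_montel (topologized gamma).

Local Notation G := (topologized gamma).
Local Notation V := (topdual G).
Local Notation dn := (@dual_norm K X gamma nrm).
Local Notation W := (topologized (norm_topology dn)).
Local Notation rank_remainder x v y := (y - \sum_i v i y *: x i).
Let sn : is_seminorm nrm := saks_nrm_seminorm hsaks.
Let sdn : is_seminorm dn := dual_norm_seminorm hK hsaks hgamma hmontel.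
Let lW : linear_topology W := norm_topology_linear sdn.
Let dnb := dual_norm_bound hK hsaks hgamma hmontel.

(* Arzela-Ascoli: on the compact unit ball, pointwise and uniform convergence
   agree on the equicontinuous set [C]. *)
Lemma polar_compact (p : X -> K) : continuous_seminorm gamma p ->
  absolutely_convex_compact ([set v : V | forall x, `|v x| <= p x] : set W).
Proof.
move=> cp; have [sp p1] := cp; set C := (C in absolutely_convex_compact C).
split.
  move=> a b u v ab uC vC x.
  have -> : (a *: (u : V) + b *: (v : V)) x = a * (u : V) x + b * (v : V) x by [].
  apply: le_trans (ler_normD _ _) _; rewrite !normrM.
  apply: (@le_trans _ _ (`|a| * p x + `|b| * p x)).
    by apply: lerD; apply: ler_wpM2l.
  by rewrite -mulrDl ler_piMl// (seminorm_ge0 sp).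
rewrite compact_ultra => F FU FC.
have FF : ProperFilter F by exact: ultra_proper.
(* On the polar the values at [x] stay in a compact disc, and a cluster point of an ultrafilter is a
   limit. *)
have lim x : exists l : K, forall e, 0 < e -> F [set v : V | `|v x - l| < e].
  have FxF : ProperFilter ((fun v : V => v x : K^o) @ F) by exact: fmap_proper_filter.
  have [|l [_ Fl]] := @closed_disc_compact K (p x) hK _ FxF.
    suff : F [set v : V | `|v x| <= p x] by [].
    by apply: filterS FC => v; exact.
  exists l => e e0.
  have [//|nF] := in_ultra_setVsetC [set v : V | `|v x - l| < e] FU.
  have [|y [/= yl]] := Fl [set y | ~ `|y - l| < e] _ _ (@nbhsx_ballx _ K^o l _ e0).
    exact: nF.
  by rewrite -ball_normE /= distrC.
have [l hl] := choice lim.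
have ll : linear (l : X -> K^o).
  move=> a x y; apply/eqP; rewrite -subr_eq0 -normr_eq0; apply/eqP.
  apply: (@eq0_of_le_eps _ _ (`|a| + 1 + 1)) => [//||e e0].
    by rewrite !addr_ge0.
  have [v [/= h1 [h2 h3]]] := filter_ex
    (filterI (hl (a *: x + y) e e0) (filterI (hl x e e0) (hl y e e0))).
  have lv := continuous_linear_linear v.
  have -> : (l (a *: x + y) : K^o) - (a *: (l x : K^o) + l y) =
      a * (v x - l x) + (v y - l y) - (v (a *: x + y) - l (a *: x + y)).
    by rewrite lv /GRing.scale/=; ring.
  apply: le_trans (ler_normB _ _) _; rewrite [X in _ <= X]mulrDr.
  apply: lerD; last by rewrite mulr1 ltW.
  apply: le_trans (ler_normD _ _) _; rewrite [X in _ <= X]mulrDr.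
  apply: lerD; last by rewrite mulr1 ltW.
  by rewrite normrM [X in _ <= X]mulrC; apply: ler_wpM2l => //; exact: ltW.
have lp x : `|l x| <= p x.
  apply/ler_addgt0Pr => e e0.
  have [v [/= h1 Cv]] := filter_ex (filterI (hl x e e0) FC).
  rewrite -(subrK (v x) (l x)) addrC; apply: le_trans (ler_normD _ _) _.
  by apply: lerD; [exact: Cv|rewrite distrC ltW].
have [w wl] := mixed_dual_exists hgamma ll cp lp.
exists w; split; first by move=> x; rewrite wl.
move=> U /(norm_topology_nbhsP sdn)[e e0 eU].
have e4 : 0 < e / 4 by rewrite divr_gt0.
(* Values on a finite [p]-net of the unit ball control all others, as [v] and [w] are both bounded
   by [p]. *)
have [s hs] := compact_net (mixed_linear hgamma) sp p1
  (norm_ball_compact hsaks hgamma hmontel (real1 K)) e4.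
have Fs : F [set v : V | forall x, x \in s -> `|v x - l x| < e / 4].
  by apply: filter_forall_seq => x _; exact: hl.
apply: filterS (filterI FC Fs) => v [Cv vs]; apply: eU.
apply: (@le_lt_trans _ _ (e / 4 + e / 4 + e / 4)); last first.
  by rewrite -subr_gt0; have -> : e - (e / 4 + e / 4 + e / 4) = e / 4 by field.
apply: dual_norm_le_ball; [exact: hK|by rewrite !addr_ge0// ltW|move=> y y1].
have [x xs yx] := hs y y1.
have lv := continuous_linear_linear (v : V); have lw := continuous_linear_linear w.
rewrite continuous_linear_subE.
have -> : (v : V) y - w y = (v : V) (y - x) + - w (y - x) + ((v : V) x - l x).
  by rewrite (linear_funB lv) (linear_funB lw) wl wl; ring.
apply: le_trans (ler_normD _ _) _; apply: lerD; last exact/ltW/vs.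
apply: le_trans (ler_normD _ _) _; rewrite normrN; apply: lerD.
  by apply: le_trans (Cv _) _; exact: ltW.
by rewrite wl; apply: le_trans (lp _) _; exact: ltW.
Qed.

(* The test space is the completion of [X] for [p], realized as the uniform
   closure of [X] among the functions on the polar of [p]: its elements are
   limits of elements of [X], so the vectors of the approximating tensor can be
   taken in [X]. *)
Lemma dual_approximation_property_finite_rank :
  approximation_property W -> finite_rank_approximation nrm gamma.
Proof.
move=> hW p cp; have [sp p1] := cp.
pose I := {v : V | forall x, `|v x| <= p x}.
pose ev (i : I) (x : X) : K^o := sval i x.
have lev i : linear (ev i) by exact: (continuous_linear_linear (sval i)).
have evB x : exists2 C, 0 <= C & forall i, `|ev i x| <= C.
  by exists (p x) => [|i]; [exact: (seminorm_ge0 sp)|exact: (svalP i)].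
pose E := uniform_closure_banach lev hK evB.
have Enorm (f : uniform_closure lev) c : 0 <= c ->
    ((`|f : E| <= c) <-> forall i, `|f i| <= c).
  move=> c0.
  have [h1 h2] := evaluation_le (uniform_closure_evaluation_norm lev hK evB) f c0.
  split=> [/h1 h i|h]; first by have := h i; rewrite mulr1.
  by apply: h2 => i; rewrite mulr1.
(* By Dixmier-Ng [h] is evaluation at a point of X, so its restriction to the polar of [p] lies in
   the closure, even without error. *)
have [T hT] : exists T : topdual W -> uniform_closure lev,
    forall h i, T h i = h (sval i).
  suff /choice[T hT] : forall h : topdual W, exists f : uniform_closure lev,
    forall i, f i = h (sval i) by exists T.
  move=> h; have [C C0 hC] := bidual_bounded hK hsaks hgamma hmontel h.
  have [x _ hx] := bidual_representation hK hsaks hgamma hmontel (ltW C0) hC.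
  apply: uniform_closure_exists => e e0; exists x => i.
  by rewrite /ev hx subrr normr0 ltW.
have lT : linear (fun h => (T h : E)).
  move=> a h1 h2; apply: val_inj; apply/funext => i.
  transitivity (a * T h1 i + T h2 i); last by [].
  by transitivity (T (a *: h1 + h2) i); [|rewrite !hT].
(* [E] carries the supremum norm over the polar of [p], and this polar is one of the compact sets
   defining the kappa topology. *)
have [| |u uE] := eps_product_exists (polar_compact cp) lT (M := 1).
- exact: ler01.
- move=> h c c0 hc; rewrite mul1r; apply/Enorm => // i; rewrite hT.
  exact: (hc (sval i) (svalP i)).
pose H : set (topdual W) := [set h | forall v : V, `|h v| <= dn v].
have eH : equicontinuous_sets H.
  move=> w Z /entourage_normP[e e0 eZ].
  have := linear_topology_seminorm_ball lW w sdn (norm_topology_unit_ball sdn) e0.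
  apply: filterS => v /= vw h hH; apply: eZ => /=.
  have lh : linear (h : V -> K^o) := continuous_linear_linear h.
  rewrite -(linear_funB lh); apply: le_lt_trans (hH _) _.
  by rewrite (seminorm_distr sdn).
have h2 : 0 < 2^-1 :> K by rewrite invr_gt0.
have := @dense_nbhs (topologized (eps_topology W E)) _ u _ (hW E).
move=> /(_ [set g : eps_product W E | forall h, H h -> `|u h - g h| < 2^-1])[].
  apply: (init_topology_nbhsP _ _ _).2.
  exists [set g : topdual W -> E | forall h, H h -> `|u h - g h| < 2^-1]; last by [].
  refine (uniform_family_nbhs (E := E) (u : topdual W -> E) eH h2).
move=> g [n [v [f gE]]] ug.
(* Half of the error is spent on approximating [u]. The other half pays for replacing each [f i] by
   some [x i] of X within [2^-1 / s], as [|v i y| <= dn (v i)] on the ball. *)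
pose s := \sum_i dn (v i) + 1.
have s0 : 0 < s.
  by rewrite ltr_wpDl// sumr_ge0// => i _; exact: (seminorm_ge0 sdn).
have fx i : exists x, forall j, `|(f i : uniform_closure lev) j - ev j x| <= 2^-1 / s.
  by apply: uniform_closureP; rewrite divr_gt0.
have [x hx] := choice fx.
exists n, x, (v : 'I_n -> V) => y y1.
have [w wp py] := mixed_hahn_banach hK hgamma (rank_remainder x (v : 'I_n -> V) y) cp.
rewrite (le_trans py)//.
pose j : I := exist _ w wp.
have [J hJ] := exists_bidual_embedding hK hsaks hgamma hmontel.
have Hy : H (J y).
  move=> z; rewrite hJ; apply: le_trans (dnb z y) _.
  by apply: ler_piMr => //; exact: (seminorm_ge0 sdn).
have := ltW (ug _ Hy); rewrite uE gE.
have -> : \sum_i J y (v i) *: f i = \sum_i (v i : V) y *: f i.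
  by apply: eq_bigr => i _; rewrite hJ.
move=> /(Enorm _ _ (ltW h2)) /(_ j).
have valE : ((T (J y) : E) - \sum_i (v i : V) y *: f i : uniform_closure lev) j =
    w y - \sum_i (v i : V) y * (f i : uniform_closure lev) j.
  transitivity (T (J y) j - (\sum_i (v i : V) y *: f i : uniform_closure lev) j).
    by [].
  rewrite hT hJ; congr (_ - _).
  by elim/big_rec2 : _ => // i z1 z2 _ <-.
rewrite valE => h.
have lw := continuous_linear_linear w.
have -> : w (rank_remainder x (v : 'I_n -> V) y) =
   (w y - \sum_i (v i : V) y * (f i : uniform_closure lev) j) +
   \sum_i (v i : V) y * ((f i : uniform_closure lev) j - ev j (x i)).
  rewrite (linear_funB lw) (linear_functional_sum _ lw) -addrA; congr (_ + _).
  rewrite -!sumrN -big_split /=; apply: eq_bigr => i _.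
  rewrite (linear_functionalZ lw) /ev /=; ring.
apply: le_trans (ler_normD _ _) _.
have -> : (1 : K) = 2^-1 + 2^-1 by field.
apply: lerD => //; apply: le_trans (ler_norm_sum _ _ _) _.
apply: (@le_trans _ _ (\sum_i dn (v i) * (2^-1 / s))).
  apply: ler_sum => i _; rewrite normrM; apply: ler_pM => //.
  apply: le_trans (dnb _ _) _.
  by apply: ler_piMr => //; exact: (seminorm_ge0 sdn).
rewrite -mulr_suml mulrCA; apply: ler_piMr; first exact: ltW.
by rewrite ler_pdivrMr// mul1r lerDl.
Qed.

End dual_approximation.

(** * Weak vector-valued functions *)

Lemma weak_comp_value (K : numFieldType) (Omega : Type) (S : {pred Omega -> K^o})
    (X : subLmodType S) (E : tvsType K) (f : weak_fun X E) (e' : topdual E) w :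
  (\val (weak_comp f e') : Omega -> K^o) w = e' (f w).
Proof. by rewrite /weak_comp SubK. Qed.

Lemma tvs_linear_topology (K : numFieldType) (E : tvsType K) : linear_topology E.
Proof. by split; [exact: add_continuous|exact: scale_continuous]. Qed.

(** * Uniform boundedness on polars *)

Section uniform_boundedness.
Variables (K : numFieldType) (hK : real_or_complex K) (Omega : Type).
Variables (S : {pred Omega -> K^o}) (X : subLmodType S).
Variables (nrm : X -> K) (tau : topology X) (Gamma_tau : set (X -> K)).
Hypothesis hsaks : saks_space nrm tau Gamma_tau.
Variables (gamma : topology X) (hgamma : is_mixed_topology nrm tau gamma).
Hypothesis hmontel : semi_montel (topologized gamma).
Hypothesis hpointwise : coarser (pointwise_topology X) tau.

Local Notation G := (topologized gamma).
Local Notation value x w := ((\val (x : X) : Omega -> K^o) w).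
Let sn : is_seminorm nrm := saks_nrm_seminorm hsaks.

(** If every finite set of points and every tolerance failed, compactness of the ball of radius [k]
    would give a [y] in it that agrees with [x] everywhere, so that [x] itself would have norm at
    most [k]. *)
Lemma nrm_lower_semicontinuous (x : X) (k : K) : k \is Num.real -> k < nrm x ->
  exists (s : seq {classic Omega}) (d : K), 0 < d /\
    forall y, (forall w, w \in s -> `|value y w - value x w| <= d) -> k < nrm y.
Proof.
move=> kr kx; apply: contrapT => /forallNP ns.
have cB := norm_ball_compact hsaks hgamma hmontel kr.
have [| |y yk hy] := @compact_fip G _ ({classic Omega} * nat)%type setT
    (fun i => [set y | `|value (y - x) i.1| <= i.2.+1%:R^-1]) cB.
- move=> [w m] _; apply: (mixed_closed_ball_at hgamma
    (evaluation_at_continuous hgamma hpointwise w)).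
  by rewrite ger0_real.
- move=> s _; pose M := \max_(i <- s) i.2.
  have /forallNP/(_ M.+1%:R^-1)/not_andP[/negP|] := ns [seq i.1 | i <- s].
    by rewrite invr_gt0 ltr0n.
  move=> /existsNP[y /not_implyP[hy ny]]; exists y => /=.
    by rewrite real_leNgt ?(seminorm_real sn)//; apply/negP.
  move=> [w m] ws; rewrite raddfB /=.
  apply: le_trans (hy w _) _; first by apply/mapP; exists (w, m).
  by rewrite lef_pV2 ?posrE// ler_nat ltnS; exact: (leq_bigmax_seq _ ws).
suff yx : y = x by move: kx; rewrite -yx => /(le_lt_trans yk); rewrite ltxx.
apply/eqP; rewrite -subr_eq0; apply/eqP; apply: evaluations_separate => w.
apply/eqP; rewrite -normr_eq0; apply/eqP.
apply: (@eq0_of_le_eps _ _ 1) => // e e0; rewrite mulr1.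
have [N hN] := natSr_inv_cvg0 hK e0.
by apply: le_trans (hy (w, N) I) _; rewrite ltW// hN.
Qed.

Variables (E : tvsType K) (f : weak_fun X E) (p : E -> K).
Hypotheses (sp : is_seminorm p) (p1 : nbhs (0 : E) [set x | p x < 1]).

Let lE : linear_topology E := tvs_linear_topology E.

Lemma polar_ball_le (e' : topdual E) : polar_ball p e' -> forall x, `|e' x| <= p x.
Proof.
move=> pe; apply: seminorm_le_of_unit_ball => //.
exact: (linear_norm_seminorm (continuous_linear_linear e')).
Qed.

Let weak_compD (s t : topdual E) :
  weak_comp f (s + t) = weak_comp f s + weak_comp f t.
Proof.
apply: val_inj; apply/funext => w; rewrite weak_comp_value raddfD.
by rewrite -[RHS]/(value _ w + value _ w) !weak_comp_value.
Qed.

Let weak_compZ a (t : topdual E) : weak_comp f (a *: t) = a *: weak_comp f t.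
Proof.
apply: val_inj; apply/funext => w; rewrite weak_comp_value linearZ.
by rewrite -[RHS]/(a * value _ w) weak_comp_value.
Qed.

(* Gliding hump: [n < nrm (weak_comp f e')] persists on a small [p]-ball around
   [e'], so an unbounded polar produces nested balls whose common point has
   infinite norm. *)
Let hump (n : nat) (s : topdual E) (r : K) :
  (forall M, exists2 u, polar_ball p u & ~ nrm (weak_comp f u) <= M) -> 0 < r ->
  exists (s' : topdual E) (r' : K), [/\ 0 < r', 4 * r' <= r,
    forall x, `|s' x - s x| <= r / 2 * p x &
    forall t : topdual E, (forall x, `|t x| <= r' * p x) ->
      n%:R < nrm (weak_comp f (s' + t))].
Proof.
move=> unb r0.
(* Chosen so that [r / 2 * M] is [n] plus the norm at [s]: adding [(r / 2) *: u] then lifts the norm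
   above [n]. *)
pose M := 2 / r * (n%:R + nrm (weak_comp f s)).
have M0 : 0 <= M by rewrite mulr_ge0 ?addr_ge0 ?(seminorm_ge0 sn)// ltW// divr_gt0.
have [u pu nu] := unb M; pose s' := s + (r / 2) *: u.
have r2 : 0 < r / 2 by rewrite divr_gt0.
have ns' : n%:R < nrm (weak_comp f s').
  have : M < nrm (weak_comp f u).
    by rewrite real_ltNge ?(seminorm_real sn) ?ger0_real//; exact/negP.
  rewrite /M -ltr_pdivlMl ?divr_gt0// invf_div => h.
  have e1 : (r / 2) *: weak_comp f u = weak_comp f s' - weak_comp f s.
    by rewrite weak_compD weak_compZ addrC addKr.
  have := seminormB sn (weak_comp f s') (weak_comp f s).
  rewrite -e1 (seminormZ sn) gtr0_norm// => /(lt_le_trans h).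
  by rewrite ltrD2r.
have [l [d [d0 hl]]] := nrm_lower_semicontinuous (realn K n) ns'.
pose D := \sum_(w <- l) p (f w).
have D0 : 0 <= D by rewrite sumr_ge0// => w _; exact: (seminorm_ge0 sp).
(* The inverse [r'] of this sum satisfies both [4 * r' <= r] and [r' * D <= d]; the latter keeps the
   values at the points of [l] within tolerance. *)
have pos : 0 < 4 / r + D / d.
  by rewrite ltr_wpDr ?divr_gt0// divr_ge0// ltW.
exists s', (4 / r + D / d)^-1; split.
- by rewrite invr_gt0.
- rewrite -ler_pdivlMr ?invr_gt0// invrK mulrDr.
  have -> : r * (4 / r) = 4 by field; rewrite gt_eqF.
  by rewrite lerDl mulr_ge0 ?divr_ge0// ltW.
- move=> x; rewrite /s'.
  have -> : (s + (r / 2) *: u) x - s x = (r / 2) * u x.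
    transitivity (s x + (r / 2) * u x - s x); first by [].
    by rewrite addrC addKr.
  rewrite normrM gtr0_norm// ler_wpM2l//; first exact: ltW.
  exact: polar_ball_le.
- move=> t tp; apply: hl => w wl.
  rewrite weak_compD raddfD /= addrC addKr weak_comp_value.
  apply: le_trans (tp _) _; rewrite ler_pdivrMl//.
  apply: (@le_trans _ _ (D / d * d)).
    rewrite divfK ?gt_eqF// /D (big_rem w)//= lerDl sumr_ge0// => v _.
    exact: (seminorm_ge0 sp).
  by apply: ler_wpM2r; [exact: ltW|rewrite lerDr divr_ge0// ltW].
Qed.

(** Makes the suprema in the weak seminorms finite and allows every [weak_comp f e'] to be scaled
    into the unit ball. *)
Lemma weak_comp_bounded : exists2 M, 0 < M &
  forall e', polar_ball p e' -> nrm (weak_comp f e') <= M.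
Proof.
apply: contrapT => nM.
have unb M : exists2 u, polar_ball p u & ~ nrm (weak_comp f u) <= M.
  apply: contrapT => nu; apply: nM; exists (`|M| + 1); first by rewrite ltr_wpDl.
  move=> u pu; apply: contrapT => h; apply: nu; exists u => //; apply: contra_not h.
  move=> uM; rewrite (le_trans uM)// (le_trans (real_ler_norm _)) ?lerDl//.
  by rewrite ger0_real// (le_trans _ uM)// (seminorm_ge0 sn).
have step (z : nat * (topdual E * K)) : exists z' : topdual E * K, 0 < z.2.2 ->
    [/\ 0 < z'.2, 4 * z'.2 <= z.2.2,
      forall x, `|z'.1 x - z.2.1 x| <= z.2.2 / 2 * p x &
      forall t : topdual E, (forall x, `|t x| <= z'.2 * p x) ->
        z.1%:R < nrm (weak_comp f (z'.1 + t))].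
  case: z => n [s r] /=; have [r0|] := pselect (0 < r); last by exists (s, r).
  by have [s' [r' h]] := hump n s unb r0; exists (s', r').
have [g hg] := choice step.
(* Centre 0 and radius 1 keep the limit in the polar of [p]; stage [m] forces norms above [m] around
   [s m.+1]. *)
pose fix sg n : topdual E * K := if n is m.+1 then g (m, sg m) else (0, 1).
pose s n := (sg n).1; pose r n := (sg n).2.
have r0 n : 0 < r n.
  elim: n => [|n IH]; first exact: ltr01.
  by have [] := hg (n, sg n) IH.
have r4 n : 4 * r n.+1 <= r n by have [] := hg (n, sg n) (r0 n).
have ss n x : `|s n.+1 x - s n x| <= r n / 2 * p x.
  by have [] := hg (n, sg n) (r0 n).
have sN n (t : topdual E) : (forall x, `|t x| <= r n.+1 * p x) ->
    n%:R < nrm (weak_comp f (s n.+1 + t)).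
  by have [_ _ _] := hg (n, sg n) (r0 n); apply.
have rn n : r n * n.+1%:R <= 1.
  elim: n => [|n IH]; first by rewrite mulr1.
  apply: le_trans IH; apply: (@le_trans _ _ (4 * r n.+1 * n.+1%:R)); last first.
    by rewrite ler_wpM2r.
  have -> : 4 * r n.+1 * n.+1%:R = r n.+1 * (4 * n.+1)%:R by rewrite natrM; ring.
  by apply: ler_wpM2l; [exact: ltW|rewrite ler_nat; lia].
have rsmall e : 0 < e -> exists N, r N < e.
  move=> /(natSr_inv_cvg0 hK)[N hN]; exists N; apply: le_lt_trans (hN N (leqnn N)).
  by rewrite -[X in _ <= X]mul1r ler_pdivlMr.
(* The balls are nested: the first step costs [r n / 2] and all later ones at most [r n.+1], which
   is at most [r n / 4]. *)
have far n k x : `|s (n + k)%N x - s n x| <= r n * p x.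
  elim: k n => [|k IH] n.
    by rewrite addn0 subrr normr0 mulr_ge0 ?(seminorm_ge0 sp)// ltW.
  rewrite addnS -addSn -(subrK (s n.+1 x) (s (n.+1 + k)%N x)) -addrA.
  apply: le_trans (ler_normD _ _) _.
  apply: (@le_trans _ _ (r n.+1 * p x + r n / 2 * p x)); first by apply: lerD.
  rewrite -mulrDl ler_wpM2r ?(seminorm_ge0 sp)//.
  rewrite (le_trans (lerD (_ : _ <= r n / 4) (lexx _)))//.
    by rewrite ler_pdivlMr// mulrC.
  have -> : r n = r n / 4 + r n / 2 + r n / 4 by field.
  have -> : (r n / 4 + r n / 2 + r n / 4) / 4 + (r n / 4 + r n / 2 + r n / 4) / 2 =
    r n / 4 + r n / 2 by field.
  by rewrite lerDl divr_ge0// ltW.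
have lim x : exists l : K, forall n, `|l - s n x| <= r n * p x.
  have FF : ProperFilter ((fun n => s n x : K^o) @ \oo) by exact: fmap_proper_filter.
  have [|l hl] := @scalar_cauchy_cvg K ((fun n => s n x : K^o) @ \oo) hK FF.
    move=> e e0; have px : 0 < p x + 1 by rewrite ltr_wpDl// (seminorm_ge0 sp).
    have [|N rN] := rsmall (e / (p x + 1)); first by rewrite divr_gt0.
    exists (s N x); exists N => // n /= Nn.
    rewrite -(subnKC Nn); apply: le_trans (far _ _ _) _.
    apply: (@le_trans _ _ (e / (p x + 1) * (p x + 1))); last by rewrite divfK// gt_eqF.
    by apply: ler_pM; rewrite ?(seminorm_ge0 sp)// ?lerDl// ltW.
  exists l => n; apply/ler_addgt0Pr => e e0.
  have [N _ hN] := hl e e0.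
  have := hN (n + N)%N (leq_addl _ _) => /= lN.
  have -> : l - s n x = (s (n + N)%N x - s n x) + (l - s (n + N)%N x) by ring.
  apply: le_trans (ler_normD _ _) _; apply: lerD; first exact: far.
  by rewrite distrC.
have [l hl] := choice lim.
have ll : linear (l : E -> K^o).
  move=> a x y; apply/eqP; rewrite -subr_eq0 -normr_eq0; apply/eqP.
  apply: (@eq0_of_le_eps _ _ (p (a *: x + y) + (`|a| * p x + p y))) => //.
    by rewrite !addr_ge0 ?mulr_ge0 ?(seminorm_ge0 sp).
  move=> e /rsmall[N rN]; have lv := continuous_linear_linear (s N).
  have -> : (l (a *: x + y) : K^o) - (a *: (l x : K^o) + l y) =
      (l (a *: x + y) - s N (a *: x + y)) - (a * (l x - s N x) + (l y - s N y)).
    by rewrite lv /GRing.scale/=; ring.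
  have lN z : `|l z - s N z| <= e * p z.
    by apply: le_trans (hl z N) _; rewrite ler_wpM2r ?(seminorm_ge0 sp)// ltW.
  rewrite [X in _ <= X]mulrDr; apply: le_trans (ler_normB _ _) _.
  apply: lerD; first exact: lN.
  apply: le_trans (ler_normD _ _) _.
  rewrite [X in _ <= X]mulrDr normrM [X in _ <= X + _]mulrCA.
  by apply: lerD; [apply: ler_wpM2l => //; exact: lN|exact: lN].
have lp x : `|l x| <= p x.
  have := hl x 0%N; rewrite /s /r /= mul1r.
  by rewrite [X in `|_ - X|](_ : _ = 0) // subr0.
have [e' eE] := continuous_linear_of_seminorm lE (E := K^o) ll sp p1 lp.
(* [n + 1] exceeds the norm of [weak_comp f e'], but [e'] lies in the ball around [s n.+2], where
   all norms are above [n + 1]. *)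
have [n] := archimedean_scalars hK (seminorm_real sn (weak_comp f e')).
have /lt_trans h : n.+1%:R < nrm (weak_comp f (s n.+2 + (e' - s n.+2))).
  by apply: sN => x; rewrite continuous_linear_subE eE.
by rewrite addrC subrK in h; move=> /h; rewrite ltxx.
Qed.

End uniform_boundedness.

Lemma generating_seminorms_nbhs0 (K : numFieldType) (E : tvsType K)
    (Gamma_E : set (E -> K)) (p : E -> K) : generating_seminorms Gamma_E ->
  Gamma_E p -> is_seminorm p /\ nbhs (0 : E) [set x | p x < 1].
Proof.
move=> [[_ sG _] oE] Gp; split; first exact: sG.
rewrite nbhsE; exists [set x | p x < 1] => //; split; last first.
  by rewrite /= (seminorm0 (sG _ Gp)).
rewrite oE.
rewrite (_ : [set x | _] = [set x | forall q, [set p] q -> q (x - 0) < 1]).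
  by apply: (seminorm_ball_open sG); [exact: finite_set1|move=> _ ->].
apply/seteqP; split=> x /=; first by move=> qx _ ->; rewrite subr0.
by move=> /(_ p erefl); rewrite subr0.
Qed.

Lemma norm_is_seminorm (K : numFieldType) (E : normedModType K) :
  is_seminorm (fun x : E => `|x|).
Proof. by split=> [//|x y|a x]; [exact: ler_normD|exact: normrZ]. Qed.

Lemma norm_generating_seminorms (K : numFieldType) (E : normedModType K) :
  generating_seminorms [set (fun x : E => `|x|)].
Proof.
split.
  split=> [|_ ->|_ _ -> ->]; [by exists (fun x => `|x|)|exact: norm_is_seminorm|].
  by exists (fun x => `|x|), 1; split=> // x; rewrite mul1r.
apply/seteqP; split=> U; rewrite seminorm_topologyE openE.
  move=> oU x /oU /nbhs_ballP[e /= e0 eU].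
  exists [set (fun x => `|x|)], e; split=> // y /= /(_ _ erefl) yx.
  by apply: eU; rewrite -ball_normE /= distrC.
move=> oU x /oU[Q0 [e [_ s0 e0 QU]]]; apply/nbhs_ballP; exists e => // y.
rewrite -ball_normE /= => xy; apply: QU => q /s0 -> /=.
by rewrite distrC.
Qed.

Lemma complete_normed_tvs_complete (K : numFieldType)
  (E : completeNormedModType K) : tvs_complete E.
Proof.
move=> F FF Fc; apply/cvg_ex; apply: cauchy_cvg; apply/cauchyP => e e0.
have [A FA hA] := Fc _ (@nbhsx_ballx _ E 0 _ e0).
have [x Ax] := filter_ex FA; exists x; apply: filterS FA => y Ay.
by have := hA x y Ax Ay; rewrite -!ball_normE /= sub0r normrN.
Qed.

(** * Density of tensors among weak functions *)

Section weak_functions_approximation.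
Variables (K : numFieldType) (hK : real_or_complex K) (Omega : Type).
Variables (S : {pred Omega -> K^o}) (X : subLmodType S).
Variables (nrm : X -> K) (tau : topology X) (Gamma_tau : set (X -> K)).
Hypothesis hsaks : saks_space nrm tau Gamma_tau.
Variables (gamma : topology X) (hgamma : is_mixed_topology nrm tau gamma).
Hypothesis hmontel : semi_montel (topologized gamma).
Hypothesis hpointwise : coarser (pointwise_topology X) tau.

Local Notation G := (topologized gamma).
Local Notation V := (topdual G).
Local Notation dn := (@dual_norm K X gamma nrm).
Local Notation value x w := ((\val (x : X) : Omega -> K^o) w).
Local Notation rank_remainder x v y := (y - \sum_i v i y *: x i).
Let sn : is_seminorm nrm := saks_nrm_seminorm hsaks.

(** Boundedness on the polar excludes the default value of the outer supremum. *)
Lemma le_weak_seminorm (E : tvsType K) (p : E -> K) q a (f : weak_fun X E)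
    (e' : topdual E) :
  is_seminorm p -> nbhs (0 : E) [set x | p x < 1] ->
  null_weights Gamma_tau q a -> polar_ball p e' ->
  weighted_sup q a (weak_comp f e') <= weak_seminorm p q a f.
Proof.
move=> sp p1 qa pe; have sw := weighted_sup_seminorm hK hsaks qa.
have [M M0 hM] := weak_comp_bounded hK hsaks hgamma hmontel hpointwise f sp p1.
have [A A0 qA] := weighted_bounded hsaks qa.
apply: (@le_supremum _ hK _ (A * M)); last by exists e'.
  by move=> _ [t _ <-]; exact: (seminorm_ge0 sw).
move=> _ [t pt <-]; apply: (weighted_sup_le hK hsaks qa); first by rewrite mulr_ge0// ltW.
move=> n; apply: le_trans (qA n _) _; apply: ler_wpM2l; first exact: ltW.
exact: hM.
Qed.

Lemma weak_seminorm_le (E : tvsType K) (p : E -> K) q a (f : weak_fun X E) c :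
  null_weights Gamma_tau q a -> 0 <= c ->
  (forall e', polar_ball p e' -> weighted_sup q a (weak_comp f e') <= c) ->
  weak_seminorm p q a f <= c.
Proof.
move=> qa c0 h; have sw := weighted_sup_seminorm hK hsaks qa.
apply: supremum_le => // [_ [t _ <-]|_ [t pt <-]]; last exact: h.
exact: (seminorm_ge0 sw).
Qed.

Lemma weak_seminorm_is_seminorm (E : tvsType K) (p : E -> K) q a :
  is_seminorm p -> nbhs (0 : E) [set x | p x < 1] ->
  null_weights Gamma_tau q a ->
  is_seminorm (fun f : weak_fun X E => weak_seminorm p q a f).
Proof.
move=> sp p1 qa; have sw := weighted_sup_seminorm hK hsaks qa.
have w0 (f : weak_fun X E) : 0 <= weak_seminorm p q a f.
  by apply: supremum_ge0 => // _ [t _ <-]; exact: (seminorm_ge0 sw).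
have wZ c (f : weak_fun X E) :
    weak_seminorm p q a (c *: f) <= `|c| * weak_seminorm p q a f.
  apply: (weak_seminorm_le qa) => [|e' pe]; first by rewrite mulr_ge0.
  have -> : weak_comp (c *: f) e' = c *: weak_comp f e'.
    apply: val_inj; apply/funext => w; rewrite weak_comp_value linearZ.
    rewrite -[RHS]/(c * value _ w) weak_comp_value.
    exact: (linear_functionalZ (continuous_linear_linear e')).
  by rewrite (seminormZ sw); apply: ler_wpM2l => //; exact: le_weak_seminorm.
split=> [//|f g|c f].
  apply: (weak_seminorm_le qa) => [|e' pe]; first by rewrite addr_ge0.
  have -> : weak_comp (f + g) e' = weak_comp f e' + weak_comp g e'.
    apply: val_inj; apply/funext => w; rewrite weak_comp_value raddfD.
    rewrite -[RHS]/(value _ w + value _ w) !weak_comp_value.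
    exact: (linear_funD (continuous_linear_linear e')).
  apply: le_trans (seminormD sw _ _) _.
  by apply: lerD; exact: le_weak_seminorm.
apply: le_anti; rewrite wZ/=.
have [->|c0] := eqVneq c 0; first by rewrite normr0 mul0r w0.
have := wZ c^-1 (c *: f); rewrite scalerA mulVf// scale1r normfV.
by rewrite ler_pdivlMl// normr_gt0.
Qed.

Lemma weak_tensor_exists (E : tvsType K) n (x : 'I_n -> X) (e : 'I_n -> E) :
  exists g : weak_fun X E, forall w, g w = \sum_i value (x i) w *: e i.
Proof.
pose h w := \sum_i value (x i) w *: e i.
have hP : h \in @weak_fun_pred K Omega S X E.
  rewrite unfold_in; apply/asboolP => e'.
  suff -> : (e' \o h) = \val (\sum_i e' (e i) *: x i) by exact: valP.
  apply/funext => w /=; rewrite /h.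
  have le := continuous_linear_linear e'.
  rewrite (linear_fun_sum le).
  rewrite (linear_functional_sum _ (evaluation_at_linear (X := X) w)).
  apply: eq_bigr => i _; rewrite (linear_functionalZ (evaluation_at_linear (X := X) w)).
  by rewrite /GRing.scale/= mulrC.
by exists (WeakFun hP).
Qed.

(* Unlike general elements of the dual, combinations of point evaluations act on
   vector-valued functions. *)
Lemma point_evaluation_approximation (U : set X) :
  finite_rank_approximation nrm gamma -> nbhs (0 : G) U ->
  exists n (x : 'I_n -> X) (m : 'I_n -> nat)
    (c : forall i, 'I_(m i) -> K) (w : forall i, 'I_(m i) -> Omega),
    forall y, nrm y <= 1 ->
      U (y - \sum_i (\sum_j c i j * value y (w i j)) *: x i).
Proof.
move=> hap /(mixed_nbhs0_continuous_seminorm hK hsaks hgamma hmontel)[p [cp pU]].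
have [sp _] := cp; have t2 : 0 < 2 :> K by [].
have [n [x [v hv]]] := hap _ (continuous_seminormZ hgamma t2 cp).
(* (AP) was used for [2 * p], which leaves one half for replacing each [v i]; accuracy [2^-1 / s]
   spreads it over the [x i]. *)
pose s := \sum_i p (x i) + 1.
have s0 : 0 < s by rewrite ltr_wpDl// sumr_ge0// => i _; exact: (seminorm_ge0 sp).
have d0 : 0 < 2^-1 / s by rewrite divr_gt0// invr_gt0.
pose T := {m : nat & (('I_m -> K) * ('I_m -> Omega))%type}.
have /choice[F hF] : forall i, exists t : T, forall y, `|v i y -
    \sum_j (tagged t).1 j * value y ((tagged t).2 j)| <= 2^-1 / s * nrm y.
  move=> i; have [m [c [w h]]] :=
    point_evaluations_dense hK hsaks hgamma hmontel hpointwise (v i) d0.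
  by exists (existT _ m (c, w)).
exists n, x, (fun i => tag (F i)),
  (fun i => (tagged (F i)).1), (fun i => (tagged (F i)).2).
move=> y y1; apply: pU.
pose b i := \sum_j (tagged (F i)).1 j * value y ((tagged (F i)).2 j).
suff : p (y - \sum_i b i *: x i) <= 1 by [].
have -> : y - \sum_i b i *: x i = rank_remainder x v y + \sum_i (v i y - b i) *: x i.
  rewrite -addrA; congr (_ + _); rewrite -!sumrN -big_split /=; apply: eq_bigr => i _.
  by rewrite scalerBl addrA addNr add0r.
apply: le_trans (seminormD sp _ _) _.
have -> : (1 : K) = 2^-1 + 2^-1 by field.
apply: lerD; first by have := hv y y1; rewrite -ler_pdivlMl// mulr1.
apply: le_trans (seminorm_sum sp _) _.
apply: (@le_trans _ _ (\sum_i 2^-1 / s * p (x i))).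
  apply: ler_sum => i _; rewrite (seminormZ sp); apply: ler_wpM2r.
    exact: (seminorm_ge0 sp).
  apply: le_trans (hF i y) _; apply: ler_piMr => //; exact: ltW.
rewrite -mulr_sumr -mulrA; apply: ler_piMr; first by rewrite invr_ge0.
by rewrite mulrC ler_pdivrMr// mul1r lerDl.
Qed.

Lemma finite_rank_weak_tensor_dense (E : tvsType K) :
  finite_rank_approximation nrm gamma -> @weak_tensor_dense K Omega S X Gamma_tau E.
Proof.
move=> hap Gamma_E hE O [f Of] oO.
have [Q0 [e [/finite_seqP[l ->] l0 e0 QO]]] := oO f Of.
have e2 : 0 < e / 2 by rewrite divr_gt0.
have hl (s : weak_fun X E -> K) : s \in l -> exists paqM : (E -> K) *
    ((nat -> X -> K) * (nat -> K) * K),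
  [/\ s = weak_seminorm paqM.1 paqM.2.1.1 paqM.2.1.2,
      null_weights Gamma_tau paqM.2.1.1 paqM.2.1.2, 0 < paqM.2.2 &
      forall e', polar_ball paqM.1 e' -> nrm (weak_comp f e') <= paqM.2.2].
  move=> /l0[p [q [a [Gp Gq a0 ac ->]]]].
  have [sp p1] := generating_seminorms_nbhs0 hE Gp.
  have [M M0 hM] := weak_comp_bounded hK hsaks hgamma hmontel hpointwise f sp p1.
  by exists (p, (q, a, M)); split.
have /choice[D hD] : forall s : weak_fun X E -> K, exists paqM : (E -> K) *
    ((nat -> X -> K) * (nat -> K) * K), s \in l ->
  [/\ s = weak_seminorm paqM.1 paqM.2.1.1 paqM.2.1.2,
      null_weights Gamma_tau paqM.2.1.1 paqM.2.1.2, 0 < paqM.2.2 &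
      forall e', polar_ball paqM.1 e' -> nrm (weak_comp f e') <= paqM.2.2].
  move=> s; have [/hl[z hz]|] := boolP (s \in l); first by exists z.
  by exists ((fun=> 0), ((fun _ _ => 0), (fun=> 0), 0)).
pose wsup s := weighted_sup (D s).2.1.1 (D s).2.1.2.
have [|n [x [m [c [w hap']]]]] := point_evaluation_approximation
    (U := [set y | forall s, s \in l -> wsup s y < e / 2 / (D s).2.2]) hap.
  apply: filter_forall_seq => s /hD[_ qa M0 _].
  have [sw w1] := weighted_sup_continuous hK hsaks hgamma qa.
  have eM : 0 < e / 2 / (D s).2.2 by rewrite divr_gt0.
  have := linear_topology_seminorm_ball (mixed_linear hgamma) 0 sw w1 eM.
  by apply: filterS => y /=; rewrite subr0.
have [g gE] := weak_tensor_exists x (fun i => \sum_j c i j *: f (w i j)).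
exists g; split; last by exists n, x, (fun i => \sum_j c i j *: f (w i j)).
apply: QO => s sl /=; have [sE qa M0 hM] := hD s sl; rewrite sE.
set M := (D s).2.2 in M0 hM *.
apply: (@le_lt_trans _ _ (e / 2)); last by rewrite [X in _ < X](splitr e) ltrDl.
apply: (weak_seminorm_le qa (ltW e2)) => e' pe.
set phi := weak_comp f e'.
pose rem y := y - \sum_i (\sum_j c i j * value y (w i j)) *: x i.
have -> : weak_comp (g - f) e' = - rem phi.
  apply: val_inj; apply/funext => w0; rewrite weak_comp_value.
  have le := continuous_linear_linear e'.
  have lw := evaluation_at_linear (X := X) w0.
  transitivity (e' (g w0 - f w0)); first by [].
  rewrite (linear_funB le) gE (linear_fun_sum le) /rem opprB.
  rewrite (linear_funB lw) (linear_functional_sum _ lw) weak_comp_value.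
  congr (_ - _); apply: eq_bigr => i _.
  rewrite (linear_functionalZ lw) (linear_fun_sum le) mulrC; congr (_ * _).
  by apply: eq_bigr => j _; rewrite weak_comp_value.
have sw := weighted_sup_seminorm hK hsaks qa.
rewrite (seminormN sw).
(* [phi] has norm at most [M], so this multiple lies in the unit ball; the factor [M] is recovered
   from the radius [e / 2 / M]. *)
have := hap' (M^-1 *: phi); rewrite (seminormZ sn) gtr0_norm ?invr_gt0//.
rewrite ler_pdivrMl// mulr1 => /(_ (hM _ pe)) /(_ s sl).
have -> : M^-1 *: phi - \sum_i (\sum_j c i j * value (M^-1 *: phi) (w i j)) *: x i =
    M^-1 *: rem phi.
  rewrite /rem scalerBr scaler_sumr; congr (_ - _); apply: eq_bigr => i _.
  rewrite scalerA mulr_sumr; congr (_ *: _); apply: eq_bigr => j _.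
  by rewrite (linear_functionalZ (evaluation_at_linear (X := X) (w i j))) mulrCA.
rewrite /wsup (seminormZ sw) gtr0_norm ?invr_gt0// -/M ltr_pdivrMl//.
by rewrite mulrC divfK ?gt_eqF// => /ltW.
Qed.

(** The map [dl] is a weak function because every functional on V is evaluation at some [x] of X,
    and composing it with [dl] returns [x]. *)
Lemma weak_tensor_dense_finite_rank :
  (forall E : completeNormedModType K, @weak_tensor_dense K Omega S X Gamma_tau E) ->
  finite_rank_approximation nrm gamma.
Proof.
move=> hd p [sp p1].
pose E := dual_banach hK hsaks hgamma hmontel.
have [dl hdl] := choice (exists_evaluation_at hgamma hpointwise).
have dP : (dl : Omega -> E) \in @weak_fun_pred K Omega S X E.
  rewrite unfold_in; apply/asboolP => e'.
  have le := continuous_linear_linear e'.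
  have /nbhs_ballP[r /= r0 rU] := continuous_linear_nbhs0 e'.
  have r20 : 0 <= 2 / r by rewrite divr_ge0// ltW.
  have eB (v : E) : `|e' v| <= 2 / r * `|v|.
    apply: (seminorm_le_of_ball (linear_norm_seminorm le) (norm_is_seminorm E) r0).
    by move=> z zr; apply/ltW/rU; rewrite -ball_normE /= sub0r normrN.
  have [x _ hx] := dixmier_ng hK hsaks hgamma hmontel (e' := e' : V -> K^o) le r20 eB.
  suff -> : (e' \o (dl : Omega -> E)) = \val x by exact: valP.
  by apply/funext => w /=; rewrite -hdl; exact: hx.
pose f : weak_fun X E := WeakFun dP.
have [q [a [qa qU]]] := mixed_nbhs0_weighted hK hsaks hgamma hmontel p1.
have hE := norm_generating_seminorms E.
pose Q := [set s : weak_fun X E -> K |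
  exists (p : E -> K) (q : nat -> X -> K) (a : nat -> K),
    [/\ [set (fun x : E => `|x|)] p, forall n, Gamma_tau (q n), forall n, 0 <= a n,
        a @ \oo --> (0 : K^o) & s = weak_seminorm p q a]].
pose nE : E -> K := fun x => `|x|.
have [snE n1] := generating_seminorms_nbhs0 hE (erefl : [set nE] nE).
have Qs : Q (weak_seminorm nE q a).
  by have [Gq a0 ac] := qa; exists nE, q, a.
have sQ s : Q s -> is_seminorm s.
  move=> [_ [q' [a' [-> Gq a0 ac ->]]]].
  exact: (weak_seminorm_is_seminorm (p := nE) snE n1).
have := dense_nbhs (hd E _ hE) (seminorm_ball_nbhs sQ f Qs ltr01).
move=> [g [n [x [v gE]]] /= gf]; exists n, x, (v : 'I_n -> V) => y y1.
(* Evaluation at [y] has norm at most 1 on V, so it lies in the polar of the norm; composed with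
   [g - f] it gives minus the remainder at [y]. *)
have [e' eE] : exists e' : topdual E, forall z : V, e' z = z y.
  apply: (continuous_linear_of_seminorm (tvs_linear_topology E) (E := K^o)
    (f := fun z : V => z y : K^o) (p := nE)) => // z.
  apply: le_trans (dual_norm_bound hK hsaks hgamma hmontel (z : V) y) _.
  by apply: ler_piMr => //; exact: (seminorm_ge0 snE z).
have pe : polar_ball nE e'.
  move=> z /ltW z1; rewrite eE.
  apply: le_trans (dual_norm_bound hK hsaks hgamma hmontel (z : V) y) _.
  rewrite -[1]mulr1; apply: ler_pM => //; first exact: (seminorm_ge0 snE z).
  exact: (seminorm_ge0 sn).
have := le_weak_seminorm (g - f) snE n1 qa pe.
have -> : weak_comp (g - f) e' = - rank_remainder x (v : 'I_n -> V) y.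
  apply: val_inj; apply/funext => w0; rewrite weak_comp_value opprB.
  have le := continuous_linear_linear e'.
  have lw := evaluation_at_linear (X := X) w0.
  transitivity (e' (g w0 - f w0)); first by [].
  rewrite (linear_funB le) gE (linear_fun_sum le).
  rewrite (linear_funB lw) (linear_functional_sum _ lw).
  congr (_ - _); last by rewrite eE hdl.
  apply: eq_bigr => i _; rewrite (linear_functionalZ lw) eE.
  by rewrite /GRing.scale/= mulrC.
rewrite (seminormN (weighted_sup_seminorm hK hsaks qa)) => h.
apply/ltW/qU => k; apply: le_trans (le_weighted_sup hK hsaks qa k _) _.
exact: le_trans h (ltW gf).
Qed.

End weak_functions_approximation.

Theorem corollary3p4 (K : numFieldType) (hK : real_or_complex K)
    (Omega : Type) (hOmega : inhabited Omega)
    (S : {pred Omega -> K^o}) (X : subLmodType S)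
    (nrm : X -> K) (tau : topology X) (Gamma_tau : set (X -> K))
    (hsaks : saks_space nrm tau Gamma_tau)
    (gamma : topology X) (hgamma : is_mixed_topology nrm tau gamma)
    (hmontel : semi_montel (topologized gamma))
    (hpointwise : coarser (pointwise_topology X) tau) :
  [<-> approximation_property (topologized gamma) ;
       approximation_property
         (topologized (norm_topology (@dual_norm K X gamma nrm))) ;
       forall E : completeNormedModType K, weak_tensor_dense Gamma_tau E ;
       forall E : tvsType K, hausdorff_space E -> tvs_complete E ->
         weak_tensor_dense Gamma_tau E].
Proof.
have weak_dense (E : tvsType K) :
    finite_rank_approximation nrm gamma -> weak_tensor_dense Gamma_tau E.
  exact: (finite_rank_weak_tensor_dense hK hsaks hgamma hmontel hpointwise).
split.
  move=> /(approximation_property_finite_rank hK hsaks hgamma hmontel).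
  exact: (finite_rank_dual_approximation_property hK hsaks hgamma hmontel).
split.
  move=> /(dual_approximation_property_finite_rank hK hsaks hgamma hmontel) hap E.
  exact: weak_dense.
split.
  move=> /(weak_tensor_dense_finite_rank hK hsaks hgamma hmontel hpointwise) hap E _ _.
  exact: weak_dense.
move=> hd.
apply: (finite_rank_approximation_property hK hsaks hgamma hmontel).
apply: (weak_tensor_dense_finite_rank hK hsaks hgamma hmontel hpointwise) => E.
by apply: hd; [exact: norm_hausdorff|exact: complete_normed_tvs_complete].
Qed.
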